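(* Let $$I(x,t):=\left|\mathcal{F}^{-1}\left(e^{it\Psi(\xi)}\,\mathcal{F}\big(\sqrt{n}\,\chi_\Omega e^{-i\phi}\big)(\xi)\right)(x)\right|^2,\qquad t\in[0,T],\quad T=1,$$ let $$I(x):=I(x,1)=\left|\mathcal{F}^{-1}\left(e^{i\Psi(\xi)}\,\mathcal{F}\big(\sqrt{n}\,\chi_\Omega e^{-i\phi}\big)(\xi)\right)(x)\right|^2,$$ and let $\Psi$ be such that $\Psi(\xi)\,\mathcal{F}(\chi_\Omega e^{-i\phi})(\xi)\in L_2(\mathbb{R}^N)$. Then $I(x,t)\in C^1([0,T],L^1(\mathbb{R}^N))$ and $$I(x)-n\chi_\Omega(x)\;\approx\;\frac{\partial}{\partial t}I(x,t)\Big|_{t=0}=2n\,\mathrm{Re}\left(i\,\chi_\Omega(x)\,e^{i\phi(x)}\,\mathcal{G}_\Psi\big(\chi_\Omega e^{-i\phi}\big)(x)\right).$$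
   Context: The Fourier transform is normalized as $(\mathcal{F}u)(\xi)=\int_{\mathbb{R}^N} e^{-2\pi i \xi\cdot x}u(x)\,dx$, $(\mathcal{F}^{-1}u)(x)=\int_{\mathbb{R}^N} e^{2\pi i x\cdot\xi}u(\xi)\,d\xi$. Here $\phi:\mathbb{R}^N\to\mathbb{R}$ is the wavefront aberration, $\Omega\subset\mathbb{R}^N$ is the aperture with indicator function $\chi_\Omega$, such that $\chi_\Omega e^{-i\phi}\in L_2(\mathbb{R}^N)$, $n>0$ is a constant (spatial average incoming flux), and $\Psi:\mathbb{R}^N\to\mathbb{R}$ is a $t$-independent shape function; $I(x)$ is the intensity measured by the wavefront sensor. The operator $\mathcal{G}_\Psi:X\subset L_2(\mathbb{R}^N)\to L_2(\mathbb{R}^N)$ is $\mathcal{G}_\Psi(v):=\mathcal{F}^{-1}(\Psi\,\mathcal{F}(v))$ with $X:=\{v\in L_2(\mathbb{R}^N):\mathcal{F}^{-1}(\Psi\mathcal{F}(v))\in L_2(\mathbb{R}^N)\}$. The symbol $\approx$ is used informally: since $I(x,0)=n\chi_\Omega(x)$, the quantity $I(x)-n\chi_\Omega(x)=I(x,1)-I(x,0)$ is the forward difference quotient $(I(x,\tau)-I(x,0))/\tau$ with $\tau=1$, taken as an approximation of the derivative $\frac{\partial}{\partial t}I(x,t)|_{t=0}=\lim_{\tau\to0}(I(x,\tau)-I(x,0))/\tau$. *)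

(* Defs.v *)
From mathcomp Require Import all_boot all_order all_algebra.
From mathcomp Require Import all_classical all_reals all_analysis.
From mathcomp Require Import complex.
Set Implicit Arguments.
Unset Strict Implicit.
Unset Printing Implicit Defensive.
Import Order.TTheory GRing.Theory Num.Theory.
Import numFieldNormedType.Exports.
Import Normc.

Local Open Scope classical_set_scope.
Local Open Scope ring_scope.
Local Open Scope complex_scope.

Definition RN (R : realType) (N : nat) := N.-tuple (measurableTypeR R).

Definition cons_pt (R : realType) (N : nat)
    (p : measurableTypeR R * RN R N) : RN R N.+1 := [tuple of p.1 :: p.2].

Lemma measurable_cons_pt (R : realType) (N : nat) :
  measurable_fun [set: measurableTypeR R * RN R N] (@cons_pt R N).
Proof. exact: measurable_cons measurable_fst measurable_snd. Qed.

(* Lebesgue measure on R^N: a point mass for N = 0, and the product measure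
   transported along (x, y) |-> x :: y in the successor case. The product \x^
   is used because it asks sigma-finiteness of its left factor only. *)
Fixpoint lebesgueN (R : realType) (N : nat) :
    {measure set (RN R N) -> \bar R} :=
  match N return {measure set (RN R N) -> \bar R} with
  | 0 => dirac ([tuple] : RN R 0)
  | M.+1 => measure_function_pushforward__canonical__measure_function_Measure
     (@lebesgue_measure R \x^ lebesgueN R M)%E (@measurable_cons_pt R M)
  end.

Section Wavefront.
Variables (R : realType) (N : nat).
Local Notation T := (RN R N).
Local Notation mu := (lebesgueN R N).

Definition expi (t : R) : R[i] := cos t +i* sin t.

Definition dot (x y : T) : R := \sum_(i < N) (tnth x i : R) * (tnth y i : R).

Definition cintegral (D : set T) (f : T -> R[i]) : R[i] :=
  (\int[mu]_(x in D) complex.Re (f x))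
    +i* (\int[mu]_(x in D) complex.Im (f x)).

Definition L2norm (f : T -> R[i]) : \bar R :=
  Lnorm mu 2%:E (fun x => (normc (f x))%:E).

Definition borel_L2 (f : T -> R[i]) : Prop :=
  [/\ measurable_fun [set: T] (fun x => complex.Re (f x)),
      measurable_fun [set: T] (fun x => complex.Im (f x)) &
      (L2norm f < +oo)%E].

(* measurable_fun is Borel measurability. Membership in an L^p space is that of
   an almost-everywhere class, so that Lebesgue measurable functions qualify. *)
Definition in_L2 (f : T -> R[i]) : Prop :=
  exists2 g, borel_L2 g & f = g %[ae mu].

Definition in_L1 (f : T -> R) : Prop :=
  exists2 g, g \in Lfun mu 1%E & f = g %[ae mu].

Definition cube (k : nat) : set T :=
  [set x | forall i, `|tnth x i : R| <= k%:R].

Definition truncated_fourier (s : R) (k : nat) (u : T -> R[i]) (xi : T)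
    : R[i] :=
  cintegral (cube k) (fun x => expi (s * (2 * pi * dot xi x)) * u x).

(* v is the L^2 (Plancherel) extension at u of the integral
   u |-> \int e^(s 2 pi i xi.x) u(x) dx, i.e. the limit in the mean of the
   integrals over the cubes [-k, k]^N; it only depends on the class of u. *)
Definition is_fourier (s : R) (u v : T -> R[i]) : Prop :=
  borel_L2 v /\
  exists g, [/\ borel_L2 g, u = g %[ae mu] &
    L2norm (fun xi => truncated_fourier s k g xi - v xi) @[k --> \oo]
      --> 0%E].

(* A Borel representative of the transform, and 0 if there is none (which only
   happens outside L^2). *)
Definition fourier_sign (s : R) (u : T -> R[i]) : T -> R[i] :=
  xget (cst 0) [set v | is_fourier s u v].

Definition fourier : (T -> R[i]) -> T -> R[i] := fourier_sign (-1).
Definition inv_fourier : (T -> R[i]) -> T -> R[i] := fourier_sign 1.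

Definition calG (Psi : T -> R) (v : T -> R[i]) : T -> R[i] :=
  inv_fourier (fun xi => (Psi xi)%:C * fourier v xi).

Definition pupil (Omega : set T) (phi : T -> R) (x : T) : R[i] :=
  (\1_Omega x)%:C * expi (- phi x).

Definition intensity_at (n : R) (Omega : set T) (phi Psi : T -> R)
    (t : R) (x : T) : R :=
  normc (inv_fourier (fun xi => expi (t * Psi xi) *
    fourier (fun y => (Num.sqrt n)%:C * pupil Omega phi y) xi) x) ^+ 2.

Definition intensity (n : R) (Omega : set T) (phi Psi : T -> R) : T -> R :=
  intensity_at n Omega phi Psi 1.

Definition diff_quot (F : R -> T -> R) (t tau : R) (x : T) : R :=
  (F (t + tau) x - F t x) / tau.

Definition L1norm (f : T -> R) : \bar R := Lnorm mu 1%:E (EFin \o f).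

(* F is in C^1([a, b], L^1(R^N)) with derivative dF (one-sided at a and b). *)
Definition C1_L1 (a b : R) (F dF : R -> T -> R) : Prop :=
  [/\ forall t, t \in `[a, b] -> in_L1 (F t),
      forall t, t \in `[a, b] -> in_L1 (dF t),
      forall t, t \in `[a, b] ->
        L1norm (fun x => diff_quot F t tau x - dF t x)
          @[tau --> within [set tau | t + tau \in `[a, b]] (0 : R)^'] --> 0%E &
      forall t, t \in `[a, b] ->
        L1norm (fun x => dF s x - dF t x)
          @[s --> within [set` `[a, b]] (nbhs t)] --> 0%E].

End Wavefront.

(* Main.v *)
(** Plancherel's theorem on the line comes down to the integral of
    (1 - cos (a x)) / x^2 being pi |a|: polarised, it says that the transforms of
    the indicators of [-K, a[ and [-K, b[ have real scalar product
    K + min a b, so the transform is isometric on real step functions; density,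
    Fatou's lemma and the parallelogram identity extend this to complex functions
    of bounded support. Fubini gives R^N by induction on N. Completeness of L^2
    then yields the transform on all of L^2, and inversion follows from the
    adjunction Re <F^-1 a, b> = Re <a, F b>, which gives
    |F^-1 F f + f| = 2 |f| and hence |F^-1 F f - f| = 0.

    Set h = F(sqrt n chi e^(-i phi)). Since |(e^(i s) - 1) / s - i|^2 is bounded and
    O(s^2), and Psi h is in L^2, the curve t |-> e^(i t Psi) h is C^1 in L^2 with
    derivative i Psi e^(i t Psi) h (split according to |Psi| <= M or > M). By
    isometry V_t = F^-1 (e^(i t Psi) h) is C^1 in L^2, with some derivative W_t, and
    |V_t|^2 is C^1 in L^1 with derivative 2 Re (conj V_t W_t). At t = 0 inversion
    gives V_0 = sqrt n chi e^(-i phi), while W_0 = i sqrt n G_Psi(chi e^(-i phi)).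
    As Psi need not be measurable, it is first replaced by a Borel function that
    agrees with it almost everywhere on the set where h does not vanish. *)

Require Import Defs.
From HB Require Import structures.
From mathcomp Require Import all_boot all_order all_algebra.
From mathcomp Require Import all_classical all_reals all_analysis.
From mathcomp Require Import measurable_realfun complex ring lra.
Import Order.TTheory GRing.Theory Num.Theory.
Import numFieldNormedType.Exports.
Local Open Scope classical_set_scope.
Local Open Scope ring_scope.
Local Open Scope complex_scope.
Set Implicit Arguments.
Unset Strict Implicit.
Unset Printing Implicit Defensive.

(** * Complex numbers and the energy integral *)

Section SquaredNorm.
Context {R : realType}.
Implicit Types (z w : R[i]) (t : R).

(** L^2 is handled through [energy], the extended integral of [sqnorm]. A squared modulus is
    polynomial in the real and imaginary parts, so pointwise estimates reduce to ring arithmetic,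
    and an integral with values in [\bar R] presupposes no integrability. The triangle inequality is
    replaced by a bound with a free weight t > 0: the factor 1 + t on one term and 1 + 1/t on the
    other. Functions of bounded support are the natural domain of the isometry. There L^2 lies in
    L^1, so the transform is a true integral at every frequency and is controlled pointwise by the
    energy. They are also what the statement transforms before passing to the limit, its truncated
    integrals being transforms of cutoffs. The transforms in the statement are chosen
    representatives, known up to null sets only, of functions that need not be Borel. Hence the
    arguments run on a relation between Borel functions, [FTlim], and the chosen functions enter at
    the end through almost everywhere equalities. *)

Definition sqnorm z : R := complex.Re z ^+ 2 + complex.Im z ^+ 2.

Lemma cReD z w : complex.Re (z + w) = complex.Re z + complex.Re w.
Proof. by case: z; case: w. Qed.
Lemma cImD z w : complex.Im (z + w) = complex.Im z + complex.Im w.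
Proof. by case: z; case: w. Qed.
Lemma cReN z : complex.Re (- z) = - complex.Re z.
Proof. by case: z. Qed.
Lemma cImN z : complex.Im (- z) = - complex.Im z.
Proof. by case: z. Qed.
Lemma cReM z w : complex.Re (z * w) =
  complex.Re z * complex.Re w - complex.Im z * complex.Im w.
Proof. by case: z; case: w. Qed.
Lemma cImM z w : complex.Im (z * w) =
  complex.Re z * complex.Im w + complex.Im z * complex.Re w.
Proof. by case: z => a b; case: w => c d /=. Qed.

Definition cReImE := (cReD, cImD, cReN, cImN, cReM, cImM).

Lemma complex_eq z w :
  complex.Re z = complex.Re w -> complex.Im z = complex.Im w -> z = w.
Proof. by case: z => a b; case: w => c d /= -> ->. Qed.

Lemma normc_sqnorm z : Normc.normc z ^+ 2 = sqnorm z.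
Proof. by case: z => a b; rewrite /= sqr_sqrtr// addr_ge0 ?sqr_ge0. Qed.

Lemma sqnorm_ge0 z : 0 <= sqnorm z.
Proof. by rewrite addr_ge0 ?sqr_ge0. Qed.

Lemma sqnormM z w : sqnorm (z * w) = sqnorm z * sqnorm w.
Proof. by rewrite /sqnorm !cReImE; ring. Qed.

Lemma sqnormN z : sqnorm (- z) = sqnorm z.
Proof. by rewrite /sqnorm !cReImE; ring. Qed.

Lemma sqnormB z w : sqnorm (z - w) = sqnorm (w - z).
Proof. by rewrite -sqnormN opprB. Qed.

Lemma sqnorm0 : sqnorm 0 = 0.
Proof. by rewrite /sqnorm/= expr0n/= addr0. Qed.

Lemma sqnorm_real t : sqnorm t%:C = t ^+ 2.
Proof. by rewrite /sqnorm/= expr0n/= addr0. Qed.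

Lemma sqnorm_eq0 z : sqnorm z = 0 -> z = 0.
Proof.
move/eqP; rewrite /sqnorm paddr_eq0 ?sqr_ge0// !sqrf_eq0 => /andP[/eqP a /eqP b].
exact: complex_eq.
Qed.

Lemma sqnorm_expi t : sqnorm (expi t) = 1.
Proof. by rewrite /sqnorm/= cos2Dsin2. Qed.

Lemma parallelogram z w :
  sqnorm (z + w) + sqnorm (z - w) = 2 * sqnorm z + 2 * sqnorm w.
Proof. by rewrite /sqnorm !cReImE; ring. Qed.

(** In each coordinate the right side minus the left side is t (a - b/t)^2. Letting t be small keeps
    the factor of [z] close to 1, which a fixed factor 2 would not allow. *)
Lemma sqnormD_le z w t : 0 < t ->
  sqnorm (z + w) <= (1 + t) * sqnorm z + (1 + t^-1) * sqnorm w.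
Proof.
have sq (a b : R) : 0 < t ->
    (a + b) ^+ 2 <= (1 + t) * a ^+ 2 + (1 + t^-1) * b ^+ 2.
  move=> t0; rewrite -subr_ge0.
  have -> : (1 + t) * a ^+ 2 + (1 + t^-1) * b ^+ 2 - (a + b) ^+ 2 =
    t * (a - t^-1 * b) ^+ 2 by field; rewrite gt_eqF.
  by rewrite mulr_ge0 ?sqr_ge0// ltW.
move=> t0; rewrite /sqnorm !cReImE.
have := sq (complex.Re z) (complex.Re w) t0.
have := sq (complex.Im z) (complex.Im w) t0.
lra.
Qed.

Lemma sqnormD_le2 z w : sqnorm (z + w) <= 2 * sqnorm z + 2 * sqnorm w.
Proof. by have := @sqnormD_le z w 1 ltr01; rewrite invr1; lra. Qed.

Lemma expiD s t : expi (s + t) = expi s * expi t :> R[i].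
Proof.
apply: complex_eq; rewrite !cReImE/= ?cosD ?sinD //.
by rewrite mulrC addrC; congr (_ + _); rewrite mulrC.
Qed.

Lemma expi0 : expi 0 = 1 :> R[i].
Proof. by apply: complex_eq; rewrite /= ?cos0 ?sin0. Qed.

End SquaredNorm.

Section Energy.
Local Open Scope ereal_scope.
Context {d} {T : measurableType d} {R : realType}.

Definition cmeasurable (f : T -> R[i]) : Prop :=
  measurable_fun setT (fun x => complex.Re (f x)) /\
  measurable_fun setT (fun x => complex.Im (f x)).

Lemma cmeasurableD f g : cmeasurable f -> cmeasurable g ->
  cmeasurable (fun x => f x + g x)%R.
Proof.
move=> [f1 f2] [g1 g2]; split; under eq_fun do rewrite ?cReImE;
  exact: measurable_funD.
Qed.

Lemma cmeasurableN f : cmeasurable f -> cmeasurable (fun x => - f x)%R.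
Proof.
move=> [f1 f2]; split; under eq_fun do rewrite ?cReImE; exact: measurable_funN.
Qed.

Lemma cmeasurableB f g : cmeasurable f -> cmeasurable g ->
  cmeasurable (fun x => f x - g x)%R.
Proof. by move=> mf mg; apply: cmeasurableD => //; exact: cmeasurableN. Qed.

Lemma cmeasurableM f g : cmeasurable f -> cmeasurable g ->
  cmeasurable (fun x => f x * g x)%R.
Proof.
move=> [f1 f2] [g1 g2]; split; under eq_fun do rewrite ?cReImE.
  by apply: measurable_funB; exact: measurable_funM.
by apply: measurable_funD; exact: measurable_funM.
Qed.

Lemma cmeasurable_cst (c : R[i]) : cmeasurable (fun=> c).
Proof. by split; exact: measurable_cst. Qed.

Lemma cmeasurable_real (f : T -> R) : measurable_fun setT f ->
  cmeasurable (fun x => (f x)%:C)%R.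
Proof. by move=> mf; split => //=; exact: measurable_cst. Qed.

Lemma cmeasurable_expi (f : T -> R) : measurable_fun setT f ->
  cmeasurable (fun x => expi (f x)).
Proof.
move=> mf; split => /=.
  apply: measurableT_comp mf.
  by apply: continuous_measurable_fun; exact: continuous_cos.
apply: measurableT_comp mf.
by apply: continuous_measurable_fun; exact: continuous_sin.
Qed.

Lemma measurable_sqnorm f : cmeasurable f ->
  measurable_fun setT (fun x => sqnorm (f x)).
Proof.
by move=> [f1 f2]; apply: measurable_funD; exact: measurable_funX.
Qed.

Lemma emeasurable_sqnorm f : cmeasurable f ->
  measurable_fun setT (fun x => (sqnorm (f x))%:E).
Proof. by move=> /measurable_sqnorm mf; exact/measurable_EFinP. Qed.

Variable mu : {measure set T -> \bar R}.
Implicit Types f g h : T -> R[i].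

Definition energy f : \bar R := \int[mu]_x (sqnorm (f x))%:E.

Lemma energy_ge0 f : 0 <= energy f.
Proof. by apply: integral_ge0 => x _; rewrite lee_fin sqnorm_ge0. Qed.

Lemma eq_energy f g : f =1 g -> energy f = energy g.
Proof. by move=> fg; apply: eq_integral => x _; rewrite fg. Qed.

Lemma ae_eq_energy f g : cmeasurable f -> cmeasurable g ->
  {ae mu, forall x, f x = g x} -> energy f = energy g.
Proof.
move=> mf mg fg; apply: ge0_ae_eq_integral => //;
  try exact: emeasurable_sqnorm; try by move=> x _; rewrite lee_fin sqnorm_ge0.
by apply: filterS fg => x -> .
Qed.

Lemma le_energy f g : cmeasurable f -> cmeasurable g ->
  (forall x, sqnorm (f x) <= sqnorm (g x))%R -> energy f <= energy g.
Proof.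
move=> mf mg fg; apply: ge0_le_integral => //;
  try exact: emeasurable_sqnorm; by move=> x _; rewrite lee_fin ?sqnorm_ge0.
Qed.

Lemma energyN f : energy (fun x => - f x)%R = energy f.
Proof. by apply: eq_integral => x _; rewrite sqnormN. Qed.

Lemma energyBC f g : energy (fun x => f x - g x)%R = energy (fun x => g x - f x)%R.
Proof. by apply: eq_integral => x _; rewrite sqnormB. Qed.

Lemma energyZ c f : cmeasurable f ->
  energy (fun x => c * f x)%R = (sqnorm c)%:E * energy f.
Proof.
move=> mf; rewrite /energy; under eq_integral do rewrite sqnormM EFinM.
rewrite ge0_integralZl_EFin//; last exact: sqnorm_ge0.
- by move=> x _; rewrite lee_fin sqnorm_ge0.
- exact: emeasurable_sqnorm.
Qed.

Lemma energyD_le f g t : cmeasurable f -> cmeasurable g -> (0 < t)%R ->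
  energy (fun x => f x + g x)%R <=
  (1 + t)%:E * energy f + (1 + t^-1)%:E * energy g.
Proof.
move=> mf mg t0.
have t1 : (0 <= 1 + t)%R by rewrite addr_ge0// ltW.
have t2 : (0 <= 1 + t^-1)%R by rewrite addr_ge0// invr_ge0 ltW.
have sf h x : 0 <= (sqnorm (h x))%:E by rewrite lee_fin sqnorm_ge0.
have mh h : cmeasurable h -> measurable_fun setT (fun x => (sqnorm (h x))%:E).
  exact: emeasurable_sqnorm.
rewrite /energy -!ge0_integralZl_EFin//; try exact: mh.
rewrite -ge0_integralD//; try (by move=> x _; rewrite mule_ge0// lee_fin);
  try (by apply: measurable_funeM; exact: mh).
apply: ge0_le_integral => //.
- by move=> x _; rewrite lee_fin sqnorm_ge0.
- exact/mh/cmeasurableD.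
- by apply: emeasurable_funD; apply: measurable_funeM; exact: mh.
- by move=> x _; rewrite -!EFinM -EFinD lee_fin sqnormD_le.
Qed.

Lemma energyD_le2 f g : cmeasurable f -> cmeasurable g ->
  energy (fun x => f x + g x)%R <= 2%:E * energy f + 2%:E * energy g.
Proof.
move=> mf mg; have := energyD_le mf mg ltr01; rewrite invr1.
by rewrite (_ : 1 + 1 = 2)%R.
Qed.

Lemma energyB_le2 f g : cmeasurable f -> cmeasurable g ->
  energy (fun x => f x - g x)%R <= 2%:E * energy f + 2%:E * energy g.
Proof.
move=> mf mg; rewrite -(energyN g); apply: energyD_le2 => //.
exact: cmeasurableN.
Qed.

Lemma energyD_lty f g : cmeasurable f -> cmeasurable g ->
  energy f < +oo -> energy g < +oo -> energy (fun x => f x + g x)%R < +oo.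
Proof.
move=> mf mg fy gy; apply: (le_lt_trans (energyD_le2 mf mg)).
by rewrite lte_add_pinfty// lte_mul_pinfty.
Qed.

Lemma energyB_lty f g : cmeasurable f -> cmeasurable g ->
  energy f < +oo -> energy g < +oo -> energy (fun x => f x - g x)%R < +oo.
Proof.
by move=> mf mg fy gy; apply: energyD_lty => //; rewrite ?energyN//; exact: cmeasurableN.
Qed.

Lemma energyZ_lty c f : cmeasurable f -> energy f < +oo ->
  energy (fun x => c * f x)%R < +oo.
Proof.
by move=> mf fy; rewrite energyZ// lte_mul_pinfty// lee_fin sqnorm_ge0.
Qed.

Lemma energy_parallelogram f g : cmeasurable f -> cmeasurable g ->
  energy (fun x => f x + g x)%R + energy (fun x => f x - g x)%R =
  2%:E * energy f + 2%:E * energy g.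
Proof.
move=> mf mg.
have sf h x : 0 <= (sqnorm (h x))%:E by rewrite lee_fin sqnorm_ge0.
have mh h : cmeasurable h -> measurable_fun setT (fun x => (sqnorm (h x))%:E).
  exact: emeasurable_sqnorm.
rewrite /energy -!ge0_integralZl_EFin//; try exact: mh.
rewrite -!ge0_integralD//; try (by move=> x _; rewrite mule_ge0// lee_fin);
  try (by apply: measurable_funeM; exact: mh).
- by apply: eq_integral => x _; rewrite -EFinD parallelogram EFinD !EFinM.
- by move=> x _; exact: (sf (fun x => f x + g x)%R).
- exact/mh/cmeasurableD.
- by move=> x _; exact: (sf (fun x => f x - g x)%R).
- exact/mh/cmeasurableB.
Qed.

Lemma energy_eq0 f : cmeasurable f -> energy f = 0 ->
  {ae mu, forall x, f x = 0%R}.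
Proof.
move=> mf f0.
have : {ae mu, forall x, setT x -> (sqnorm (f x))%:E = 0}.
  apply/(ae_eq_integral_abs mu measurableT (emeasurable_sqnorm mf)).
  rewrite -f0; apply: eq_integral => x _.
  by rewrite gee0_abs// lee_fin sqnorm_ge0.
by apply: filterS => x /(_ I) [] /sqnorm_eq0.
Qed.

End Energy.

(** * Convergence in the mean *)

Section EnergyConvergence.
Local Open Scope ereal_scope.
Context {d} {T : measurableType d} {R : realType}.
Variable mu : {measure set T -> \bar R}.
Implicit Types f g h : T -> R[i].

(** Nonnegativity makes the bound by a real number carry the eventual finiteness too, so that limits
    in [\bar R] are proved with plain epsilons. *)
Lemma cvge0P {I : Type} (F : set_system I) {FF : Filter F} (u : I -> \bar R) :
  (forall i, 0 <= u i) ->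
  (u i @[i --> F] --> 0) <-> (forall e : R, (0 < e)%R -> \forall i \near F, u i <= e%:E).
Proof.
move=> u0; split.
  move=> /fine_cvgP[fu cu] e e0.
  have := (@cvgrPdist_le _ _ _ _ FF _ _).1 cu _ e0.
  apply: filterS2 fu => i fi; rewrite sub0r normrN/= => le.
  by rewrite -(fineK fi) lee_fin (le_trans (ler_norm _)).
move=> H; apply/fine_cvgP; split.
  apply: filterS (H 1%R ltr01) => i le.
  by rewrite ge0_fin_numE// (le_lt_trans le)// ltry.
apply/cvgrPdist_le => e e0; apply: filterS (H e e0) => i le.
rewrite sub0r normrN /= ger0_norm ?fine_ge0// -lee_fin fineK//.
by rewrite ge0_fin_numE// (le_lt_trans le)// ltry.
Qed.

Lemma cvge0_le {I : Type} (F : set_system I) {FF : Filter F} (u v : I -> \bar R) :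
  (forall i, 0 <= u i) -> (forall i, 0 <= v i) ->
  (\forall i \near F, u i <= v i) -> v i @[i --> F] --> 0 -> u i @[i --> F] --> 0.
Proof.
move=> u0 v0 uv /cvge0P => /(_ v0) H; apply/cvge0P => // e e0.
by apply: filterS2 uv (H _ e0) => i; exact: le_trans.
Qed.

Lemma cvge0_ltpinfty {I : Type} (F : set_system I) {FF : Filter F} (u : I -> \bar R) :
  (forall i, 0 <= u i) -> u i @[i --> F] --> 0 -> \forall i \near F, u i < +oo.
Proof.
move=> u0 /cvge0P => /(_ u0 1%R ltr01); apply: filterS => i ui.
by rewrite (le_lt_trans ui)// ltry.
Qed.

Lemma cvge0ZD {I : Type} (F : set_system I) {FF : Filter F} (u v : I -> \bar R) (a b : R) :
  (0 <= a)%R -> (0 <= b)%R ->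
  (forall i, 0 <= u i) -> (forall i, 0 <= v i) ->
  u i @[i --> F] --> 0 -> v i @[i --> F] --> 0 ->
  a%:E * u i + b%:E * v i @[i --> F] --> 0.
Proof.
move=> a0 b0 u0 v0 /cvge0P => /(_ u0) U /cvge0P => /(_ v0) V.
have w0 i : 0 <= a%:E * u i + b%:E * v i.
  by rewrite adde_ge0// mule_ge0// lee_fin.
apply/cvge0P => // e e0.
have ab : (0 < a + b + 1)%R by rewrite ltr_pwDr// addr_ge0.
have e1 : (0 < e / (a + b + 1))%R by rewrite divr_gt0.
apply: filterS2 (U _ e1) (V _ e1) => i ui vi.
have : a%:E * u i + b%:E * v i <= a%:E * (e / (a + b + 1))%:E + b%:E * (e / (a + b + 1))%:E.
  by apply: leeD; apply: lee_wpmul2l => //; rewrite lee_fin.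
move=> /le_trans; apply.
rewrite -!EFinM -EFinD lee_fin -mulrDl mulrCA ler_piMr ?ltW//.
by rewrite ltr_pdivrMr// mul1r ltrDl.
Qed.

(** [energyD_le] is applied in both directions, to fs i = f + (fs i - f) and to f = fs i + (f - fs
    i). With b a bound of the energy of the difference, this leaves an error 2ta + 2(1 + 1/t)b: t is
    fixed first, then b is made small. *)
Lemma energy_cvg {I : Type} (F : set_system I) {FF : Filter F}
    (fs : I -> T -> R[i]) f :
  (forall i, cmeasurable (fs i)) -> cmeasurable f -> energy mu f < +oo ->
  energy mu (fun x => fs i x - f x)%R @[i --> F] --> 0 ->
  energy mu (fs i) @[i --> F] --> energy mu f.
Proof.
move=> mfs mf ffin cf.
have e0 h := energy_ge0 mu h.
have ff : energy mu f \is a fin_num by rewrite ge0_fin_numE.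
have [a aE] : exists a, energy mu f = a%:E by exists (fine (energy mu f)); rewrite fineK.
have a0 : (0 <= a)%R by rewrite -lee_fin -aE.
have bnd i (t : R) : (0 < t)%R -> (t <= 1)%R ->
    forall b : R, energy mu (fun x => fs i x - f x)%R <= b%:E -> 
    exists2 c : R, energy mu (fs i) = c%:E &
     (`|a - c| <= 2 * t * a + 2 * (1 + t^-1) * b)%R.
  move=> t0 t1 b hb.
  have b0 : (0 <= b)%R by rewrite -lee_fin (le_trans _ hb).
  have ti : (1 <= t^-1)%R by rewrite invf_ge1.
  have le1 : energy mu (fs i) <= (1 + t)%:E * energy mu f + (1 + t^-1)%:E * b%:E.
    have := energyD_le mu mf (cmeasurableB (mfs i) mf) t0.
    under [X in X <= _]eq_energy do rewrite subrKC.
    move=> /le_trans; apply; rewrite leeD2l//.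
    by apply: lee_wpmul2l => //; rewrite lee_fin; lra.
  rewrite aE -!EFinM -EFinD in le1.
  have fi : energy mu (fs i) \is a fin_num.
    by rewrite ge0_fin_numE// (le_lt_trans le1)// ltry.
  have [c cE] : exists c : R, energy mu (fs i) = c%:E.
    by exists (fine (energy mu (fs i))); rewrite fineK.
  exists c => //.
  have le2 : energy mu f <= (1 + t)%:E * energy mu (fs i) + (1 + t^-1)%:E * b%:E.
    have := energyD_le mu (mfs i) (cmeasurableB mf (mfs i)) t0.
    under [X in X <= _]eq_energy do rewrite subrKC.
    move=> /le_trans; apply; rewrite leeD2l//.
    by apply: lee_wpmul2l => //; [rewrite lee_fin; lra | rewrite energyBC].
  move: le1 le2; rewrite aE cE -!EFinM -EFinD !lee_fin => le1 le2.
  have tib : (0 <= (1 + t^-1) * b)%R by rewrite mulr_ge0//; lra.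
  have ta : (0 <= t * a)%R by rewrite mulr_ge0// ltW.
  (* The second bound has the unknown energy c on its right side. The first bound, multiplied by t
     <= 1, removes it. *)
  have tc : (t * c <= t * a + t * a + (1 + t^-1) * b)%R.
    have : (t * c <= t * ((1 + t) * a + (1 + t^-1) * b))%R.
      by rewrite ler_pM2l.
    have : (t * (t * a) <= t * a)%R by rewrite ler_piMl.
    have : (t * ((1 + t^-1) * b) <= (1 + t^-1) * b)%R by rewrite ler_piMl.
    lra.
  by rewrite ler_norml; apply/andP; split; lra.
have {}cf := (@cvge0P _ F FF _ (fun i => e0 _)).1 cf.
have main (e : R) : (0 < e)%R -> \forall i \near F,
   exists2 c : R, energy mu (fs i) = c%:E & (`|a - c| <= e)%R.
  move=> ep.
  (* This t brings 2ta below e/2. The denominator uses a + 1 because a may be 0, and the minimum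
     with 1 is what [bnd] requires. *)
  pose t := Num.min 1%R (e / (4 * (a + 1)))%R.
  have t0 : (0 < t)%R by rewrite lt_min ltr01/= divr_gt0//; lra.
  have t1 : (t <= 1)%R by rewrite ge_min lexx.
  have ti : (0 < t^-1)%R by rewrite invr_gt0.
  have ta : (2 * t * a <= e / 2)%R.
    have : (t <= e / (4 * (a + 1)))%R by rewrite ge_min lexx orbT.
    rewrite ler_pdivlMr; last lra.
    nra.
  have dp : (0 < e / (4 * (1 + t^-1)))%R by rewrite divr_gt0//; lra.
  apply: filterS (cf _ dp) => i /(bnd i t t0 t1)[c -> le].
  exists c => //; apply: (le_trans le).
  have -> : (2 * (1 + t^-1) * (e / (4 * (1 + t^-1))) = e / 2)%R.
    have : (1 + t^-1 != 0)%R by rewrite gt_eqF//; lra.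
    by set s := (1 + t^-1)%R => s0; field.
  lra.
rewrite aE; apply/fine_cvgP; split.
  by apply: filterS (main 1%R ltr01) => i [c -> _].
apply/cvgrPdist_le => e ep; apply: filterS (main e ep) => i [c /= -> ].
by [].
Qed.

(** The bound is asked for eventually only, which is how Cauchy criteria and limits provide it. *)
Lemma energy_fatou (fs : nat -> T -> R[i]) f (c : \bar R) :
  (forall k, cmeasurable (fs k)) -> cmeasurable f ->
  {ae mu, forall x, complex.Re (fs k x) @[k --> \oo] --> complex.Re (f x) /\
                    complex.Im (fs k x) @[k --> \oo] --> complex.Im (f x)} ->
  (\forall k \near \oo, energy mu (fs k) <= c) -> energy mu f <= c.
Proof.
move=> mfs mf cf le.
have mk k : measurable_fun setT (fun x => (sqnorm (fs k x))%:E).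
  exact: emeasurable_sqnorm.
have k0 k x : setT x -> 0 <= (sqnorm (fs k x))%:E.
  by rewrite lee_fin sqnorm_ge0.
have := fatou mu measurableT mk k0.
have -> : \int[mu]_x limn_einf (fun k => (sqnorm (fs k x))%:E) = energy mu f.
  apply: ge0_ae_eq_integral => //.
  - apply: measurableT_comp => //; apply: measurable_fun_limn_esup => k.
    by apply: measurableT_comp => //; exact: mk.
  - exact: emeasurable_sqnorm.
  - move=> x _; rewrite limn_einf_lim; apply: lime_ge; first exact: is_cvg_einfs.
    by apply: nearW => k; apply: le_ereal_inf_tmp => _ [m _ <-]; exact: k0.
  - by move=> x _; rewrite lee_fin sqnorm_ge0.
  - apply: filterS cf => x [c1 c2] _; apply: (cvg_limn_einf_sup _).1.
    by apply: cvg_EFin => //; [exact: nearW|apply: cvgD; exact: cvgM].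
move=> /le_trans; apply.
rewrite limn_einf_lim; apply: lime_le.
  exact: is_cvg_einfs.
near=> k.
apply: ge_ereal_inf.
exists (energy mu (fs k)); first by exists k => //=.
near: k; exact: le.
Unshelve. all: by end_near. Qed.

Lemma cvg_geometric_increments (u : nat -> R) (C : R) :
  (forall k, `|u k.+1 - u k| <= C * (2^-1) ^+ k)%R -> cvgn u.
Proof.
move=> uC.
have ct : cvgn (series (telescope u)).
  apply: normed_cvg.
  apply: (@series_le_cvg _ _ (geometric C 2^-1)).
  - by move=> k; exact: normr_ge0.
  - by move=> k; rewrite /= (le_trans _ (uC k)).
  - exact: uC.
  - apply: is_cvg_geometric_series.
    by rewrite ger0_norm ?invr_ge0// invf_lt1// ltr1n.
have -> : u = (fun k => u 0%N + series (telescope u) k)%R.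
  by apply/funext => k; rewrite [LHS]eq_sum_telescope.
by apply: is_cvgD => //; exact: is_cvg_cst.
Qed.

(** Riesz-Fischer: along a subsequence whose increments have energy at most 16^-k, the weighted sum
    of 4^k |D_k|^2 has a finite integral, hence is finite almost everywhere. There |D_k| is O(2^-k)
    and the subsequence converges pointwise. *)
Lemma energy_complete (fs : nat -> T -> R[i]) :
  (forall k, cmeasurable (fs k)) ->
  (forall e : R, (0 < e)%R -> exists K, forall j l, (K <= j)%N -> (K <= l)%N ->
     energy mu (fun x => fs j x - fs l x)%R <= e%:E) ->
  exists2 g, cmeasurable g & energy mu (fun x => fs k x - g x)%R @[k --> \oo] --> 0.
Proof.
move=> mfs cauchy.
have e16 k : (0 < (16^-1 : R) ^+ k)%R by rewrite exprn_gt0// invr_gt0.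
have /choice[K HK] k := cauchy _ (e16 k).
(* Partial sums of the successors make the indices increase while dominating both [K k] and k. *)
pose n k := (\sum_(i < k.+1) (K i).+1)%N.
have nS k : (n k <= n k.+1)%N by rewrite /n [X in (_ <= X)%N]big_ord_recr/= leq_addr.
have nK k : (K k <= n k)%N by rewrite /n big_ord_recr/= -addSnnS leq_addl.
have nk k : (k <= n k)%N.
  elim: k => // k ih; rewrite /n big_ord_recr/= -/(n k) (leq_ltn_trans ih)//.
  by rewrite addnS ltnS leq_addr.
pose h k := fs (n k).
have mh k : cmeasurable (h k) by exact: mfs.
pose D k x := (h k.+1 x - h k x)%R.
have mD k : cmeasurable (D k) by exact: cmeasurableB.
have eD k : energy mu (D k) <= (16^-1 ^+ k)%:E.
  by apply: HK; [exact: leq_trans (nK k) (nS k) | exact: nK].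
(* The weight 4^k lies halfway between what summability allows (4^k 16^-k = 4^-k) and what pointwise
   decay needs: a bound on 4^k |D_k|^2 bounds 2^k |D_k|. *)
pose t k x : \bar R := (4 ^+ k)%:E * (sqnorm (D k x))%:E.
have t0 k x : setT x -> 0 <= t k x.
  by move=> _; rewrite mule_ge0// lee_fin ?sqnorm_ge0// exprn_ge0.
have mt k : measurable_fun setT (t k).
  by apply: measurable_funeM; exact: emeasurable_sqnorm.
pose G x := \sum_(0 <= k <oo) t k x.
have G0 x : 0 <= G x by apply: nneseries_ge0 => k _ _; exact: t0.
have mG : measurable_fun setT G.
  by apply: (@ge0_emeasurable_sum _ _ _ _ t xpredT) => [k x Dx _|k _]; [exact: t0|exact: mt].
have intG : \int[mu]_x G x < +oo.
  rewrite integral_nneseries//; apply: (@le_lt_trans _ _ 2%:E); last exact: ltry.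
  apply: lime_le.
    by apply: is_cvg_nneseries => k _ _; apply: integral_ge0 => x; exact: t0.
  apply: nearW => m.
  apply: (@le_trans _ _ (\sum_(0 <= k < m) ((4^-1) ^+ k)%:E)).
    apply: lee_sum => k _; rewrite ge0_integralZl_EFin ?exprn_ge0//.
    - apply: (@le_trans _ _ ((4 ^+ k)%:E * (16^-1 ^+ k)%:E)).
        by apply: lee_wpmul2l; [rewrite lee_fin exprn_ge0|exact: eD].
      rewrite -EFinM lee_fin -exprMn le_eqVlt; apply/orP; left; apply/eqP.
      by congr (_ ^+ k)%R; field.
    - by move=> x _; rewrite lee_fin sqnorm_ge0.
    - exact: emeasurable_sqnorm.
  rewrite sumEFin lee_fin.
  have -> : (\sum_(0 <= k < m) (4^-1) ^+ k = 4 / 3 * (1 - (4^-1) ^+ m) :> R)%R.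
    elim: m => [|m ih]; first by rewrite big_nil expr0 subrr mulr0.
    by rewrite big_nat_recr//= ih exprS; field.
  have : (0 <= (4^-1 : R) ^+ m)%R by rewrite exprn_ge0// invr_ge0.
  lra.
have aeG : {ae mu, forall x, G x \is a fin_num}.
  have /(integrable_ae measurableT) : mu.-integrable setT G.
    apply/integrableP; split => //.
    by under eq_integral do rewrite gee0_abs//.
  by apply: filterS => x; apply.
have cvh x : G x \is a fin_num ->
    cvgn (fun k => complex.Re (h k x)) /\ cvgn (fun k => complex.Im (h k x)).
  move=> Gx; have bnd k : (4 ^+ k * sqnorm (D k x) <= fine (G x))%R.
    rewrite -lee_fin fineK// EFinM.
    have := @nneseries_lim_ge _ (fun k => t k x) xpredT 0%N k.+1 (fun i _ _ => t0 i x I).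
    apply: le_trans; rewrite big_nat_recr//= leeDr//.
    by apply: sume_ge0 => i _; exact: t0.
  have aux (a : R) k : (a ^+ 2 <= sqnorm (D k x))%R ->
      (`|a| <= (1 + fine (G x)) / 2 * 2^-1 ^+ k)%R.
    move=> aD; have := bnd k.
    have p2 : (0 < (2 : R) ^+ k)%R by rewrite exprn_gt0.
    rewrite exprVn ler_pdivlMr// (_ : 4 ^+ k = (2 ^+ k) ^+ 2)%R; last first.
      by rewrite -exprM mulnC exprM; congr (_ ^+ k)%R; ring.
    rewrite -(@real_normK _ a) ?num_real// in aD.
    move: p2 aD; set p := (2 ^+ k)%R; set b := `|a|%R => p2 aD le.
    have : ((b * p) ^+ 2 <= fine (G x))%R.
      by rewrite (le_trans _ le)// exprMn mulrC ler_pM2l// exprn_gt0.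
    (* This square gives bp <= (1 + (bp)^2) / 2, whence the constant (1 + G)/2, obtained without a
       square root. *)
    have := sqr_ge0 (b * p - 1)%R.
    nra.
  split; apply: (@cvg_geometric_increments _ ((1 + fine (G x)) / 2)%R) => k.
    by rewrite -cReN -cReD; apply: aux; rewrite /sqnorm lerDl sqr_ge0.
  by rewrite -cImN -cImD; apply: aux; rewrite /sqnorm lerDr sqr_ge0.
(* The upper limit is Borel on the whole space, including the null set where the subsequence
   diverges, and equals the limit elsewhere. *)
pose lim1 x := fine (limn_esup (fun k => (complex.Re (h k x))%:E)).
pose lim2 x := fine (limn_esup (fun k => (complex.Im (h k x))%:E)).
pose g x : R[i] := (lim1 x +i* lim2 x)%C.
have mg : cmeasurable g.
  have mlim (u : nat -> T -> R) : (forall k, measurable_fun setT (u k)) ->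
      measurable_fun setT (fun x => fine (limn_esup (fun k => (u k x)%:E))).
    move=> mu_; apply: (measurableT_comp (f := fine)); first exact: fine_measurable.
    apply: (@measurable_fun_limn_esup _ _ _ _ (fun k x => (u k x)%:E)) => k.
    exact/measurable_EFinP.
  by split; apply: mlim => k; [exact: (mh k).1 | exact: (mh k).2].
exists g => //.
apply/cvge0P => [k|e e0]; first exact: energy_ge0.
have [N HN] := cauchy e e0.
exists N => // j /= Nj.
(* With j fixed, Fatou along the subsequence turns the Cauchy bound into a bound on the distance to
   the limit, so the whole sequence converges. *)
apply: (@energy_fatou (fun k x => fs j x - h k x)%R).
- by move=> k; exact: cmeasurableB.
- exact: cmeasurableB.
- apply: filterS aeG => x /cvh[c1 c2].
  have l1 : lim1 x = limn (fun k => complex.Re (h k x)).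
    have /cvg_limn_einf_sup[_ lE] : (complex.Re (h k x))%:E @[k --> \oo] -->
        (limn (fun k => complex.Re (h k x)))%:E.
      by apply: cvg_EFin => //; exact: nearW.
    by rewrite /lim1 lE.
  have l2 : lim2 x = limn (fun k => complex.Im (h k x)).
    have /cvg_limn_einf_sup[_ lE] : (complex.Im (h k x))%:E @[k --> \oo] -->
        (limn (fun k => complex.Im (h k x)))%:E.
      by apply: cvg_EFin => //; exact: nearW.
    by rewrite /lim2 lE.
  split.
    under eq_fun do rewrite cReD cReN; rewrite cReD cReN /= l1.
    by apply: cvgB => //; exact: cvg_cst.
  under eq_fun do rewrite cImD cImN; rewrite cImD cImN /= l2.
  by apply: cvgB => //; exact: cvg_cst.
- by exists N => // k /= Nk; apply: HN => //; exact: leq_trans Nk (nk k).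
Qed.

End EnergyConvergence.

(** * The L^2 norm of the statement as the root of the energy *)

Section L2.
Local Open Scope ereal_scope.
Context {R : realType} {N : nat}.
Local Notation mu := (lebesgueN R N).
Implicit Types f : RN R N -> R[i].

Lemma L2normE f : L2norm f = energy mu f `^ 2^-1.
Proof.
rewrite /L2norm unlock; congr (_ `^ _); apply: eq_integral => x _ /=.
rewrite powR_mulrn ?normr_ge0// ger0_norm ?normc_sqnorm//.
by case: (f x) => a b /=; exact: sqrtr_ge0.
Qed.

Lemma L2norm_lty f : (L2norm f < +oo) = (energy mu f < +oo).
Proof.
rewrite L2normE; apply/idP/idP => [|]; last exact: poweR_lty.
by apply: lty_poweRy; rewrite invr_eq0.
Qed.

Lemma borel_L2P f : borel_L2 f <-> cmeasurable f /\ energy mu f < +oo.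
Proof.
by rewrite /borel_L2 L2norm_lty; split=> [[? ? ?]|[[? ?] ?]].
Qed.

Lemma L2norm_cvg0 {I : Type} (F : set_system I) {FF : Filter F}
    (fs : I -> RN R N -> R[i]) :
  (L2norm (fs i) @[i --> F] --> 0) <-> (energy mu (fs i) @[i --> F] --> 0).
Proof.
have le_sq f (e : R) : (0 < e)%R -> (L2norm f <= e%:E) <-> (energy mu f <= (e ^+ 2)%:E).
  move=> e0; have E0 := energy_ge0 mu f.
  rewrite L2normE; case: (energy mu f) E0 => [r|//|//] E0; last first.
    by rewrite poweRyr ?invr_eq0// !leye_eq.
  rewrite poweR_EFin !lee_fin powR12_sqrt// -{1}(ger0_norm (ltW e0)) -sqrtr_sqr.
  by rewrite ler_psqrt// nnegrE ?sqr_ge0.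
split=> /cvge0P H; apply/cvge0P => [i|e e0].
- exact: energy_ge0.
- have s0 : (0 < Num.sqrt e)%R by rewrite sqrtr_gt0.
  apply: filterS (H (fun i => Lnorm_ge0 _ _ _) _ s0) => i.
  by move=> /(le_sq _ _ s0); rewrite sqr_sqrtr// ltW.
- exact: Lnorm_ge0.
- have s0 : (0 < e ^+ 2)%R by rewrite exprn_gt0.
  by apply: filterS (H (fun i => energy_ge0 _ _) _ s0) => i /(le_sq _ _ e0).
Qed.

End L2.

(** * Complex integrals and Fubini *)

Section RealIntegrable.
Context {d} {T : measurableType d} {R : realType}.
Variable mu : {measure set T -> \bar R}.
Implicit Types f g : T -> R.
Local Notation integrableR f := (mu.-integrable setT (EFin \o f)).

Lemma integrable_addr f g : integrableR f -> integrableR g ->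
  integrableR (fun x => f x + g x).
Proof. exact: integrableD. Qed.

Lemma integrable_subr f g : integrableR f -> integrableR g ->
  integrableR (fun x => f x - g x).
Proof. exact: integrableB. Qed.

Lemma integrable_mulrl a f : integrableR f -> integrableR (fun x => a * f x).
Proof. exact: integrableZl. Qed.

Lemma integrableP_ge0 f : measurable_fun setT f -> (forall x, 0 <= f x) ->
  (\int[mu]_x (f x)%:E < +oo)%E -> integrableR f.
Proof.
move=> mf f0 fy; apply/integrableP; split; first exact/measurable_EFinP.
by under eq_integral do rewrite /= ger0_norm//.
Qed.

Lemma integrable_le_norm f g : measurable_fun setT f ->
  (forall x, `|f x| <= g x) -> integrableR g -> integrableR f.
Proof.
move=> mf fg; apply: le_integrable => //; first exact/measurable_EFinP.
by move=> x _; rewrite /= lee_fin (le_trans (fg x))// ler_norm.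
Qed.

Lemma integrable_indic_lty (D : set T) : measurable D -> (mu D < +oo)%E ->
  integrableR (\1_D : T -> R).
Proof.
move=> mD Dy; apply: integrableP_ge0 => //.
by rewrite integral_indic// setIT.
Qed.

End RealIntegrable.

Section ComplexIntegral.
Context {d} {T : measurableType d} {R : realType}.
Variable mu : {measure set T -> \bar R}.
Implicit Types f g : T -> R[i].

Definition cint f : R[i] :=
  (\int[mu]_x complex.Re (f x)) +i* (\int[mu]_x complex.Im (f x)).

Definition cintegrable f : Prop :=
  mu.-integrable setT (EFin \o (fun x => complex.Re (f x))) /\
  mu.-integrable setT (EFin \o (fun x => complex.Im (f x))).

Lemma eq_cint f g : f =1 g -> cint f = cint g.
Proof. by move=> /funext ->. Qed.

Lemma cintegrable_cmeasurable f : cintegrable f -> cmeasurable f.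
Proof.
by move=> [/measurable_int/measurable_EFinP ? /measurable_int/measurable_EFinP ?].
Qed.

Lemma cintD f g : cintegrable f -> cintegrable g ->
  cint (fun x => f x + g x) = cint f + cint g.
Proof.
move=> [f1 f2] [g1 g2]; apply: complex_eq; rewrite cReImE /=.
  by under eq_Rintegral do rewrite cReD; exact: RintegralD.
by under eq_Rintegral do rewrite cImD; exact: RintegralD.
Qed.

Lemma integrable_dominated (h : T -> R) f :
  measurable_fun setT h -> cintegrable f ->
  (forall x, `|h x| <= `|complex.Re (f x)| + `|complex.Im (f x)|) ->
  mu.-integrable setT (EFin \o h).
Proof.
move=> mh [f1 f2] hf.
apply: (integrable_le_norm mh hf); apply: integrable_addr.
  exact: (integrable_abse f1).
exact: (integrable_abse f2).
Qed.

Lemma cintegrableM f g : cmeasurable g -> cintegrable f ->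
  (forall x, `|complex.Re (g x)| <= 1 /\ `|complex.Im (g x)| <= 1) ->
  cintegrable (fun x => g x * f x).
Proof.
move=> mg fi g1; have mf := cintegrable_cmeasurable fi.
have [m1 m2] := cmeasurableM mg mf.
split; apply: (integrable_dominated _ fi) => // x; have [h1 h2] := g1 x.
  rewrite cReM (le_trans (ler_normB _ _))// !normrM lerD//.
    by rewrite ler_piMl.
  by rewrite ler_piMl.
rewrite cImM (le_trans (ler_normD _ _))// !normrM addrC lerD//.
  by rewrite ler_piMl.
by rewrite ler_piMl.
Qed.

Lemma cintegrable_expi (th : T -> R) f : measurable_fun setT th ->
  cintegrable f -> cintegrable (fun x => expi (th x) * f x).
Proof.
move=> mth fi; apply: cintegrableM => //; first exact: cmeasurable_expi.
by move=> x; rewrite /= !ler_norml cos_geN1 cos_le1 sin_geN1 sin_le1.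
Qed.

Lemma cintegrableZ (c : R[i]) f : cintegrable f -> cintegrable (fun x => c * f x).
Proof.
move=> [f1 f2]; split.
  under eq_fun do rewrite cReM.
  by apply: integrable_subr; exact: integrable_mulrl.
under eq_fun do rewrite cImM.
by apply: integrable_addr; exact: integrable_mulrl.
Qed.

Lemma cintZ (c : R[i]) f : cintegrable f -> cint (fun x => c * f x) = c * cint f.
Proof.
move=> [f1 f2]; apply: complex_eq; rewrite cReImE /=.
  under eq_Rintegral do rewrite cReM.
  by rewrite RintegralB// ?RintegralZl//; exact: integrable_mulrl.
under eq_Rintegral do rewrite cImM.
by rewrite RintegralD// ?RintegralZl//; exact: integrable_mulrl.
Qed.

Lemma cintB f g : cintegrable f -> cintegrable g ->
  cint (fun x => f x - g x) = cint f - cint g.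
Proof.
move=> fi gi; rewrite -[- cint g]mulN1r -cintZ// -cintD//.
  by apply: eq_cint => x; rewrite mulN1r.
exact: cintegrableZ.
Qed.

Lemma integrable_sq_lty (h : T -> R) (D : set T) : measurable D ->
  (mu D < +oo)%E -> measurable_fun setT h -> (forall x, ~ D x -> h x = 0) ->
  (\int[mu]_x (h x ^+ 2)%:E < +oo)%E ->
  mu.-integrable setT (EFin \o h).
Proof.
move=> mD Dy mh h0 hy.
have i1 := integrable_indic_lty mD Dy.
have i2 : mu.-integrable setT (EFin \o (fun x => h x ^+ 2)).
  by apply: integrableP_ge0 => [|x|//]; [exact: measurable_funX|exact: sqr_ge0].
apply: (integrable_le_norm mh _ (integrable_addr i1 i2)) => x.
rewrite indicE; have [xD|xD] := boolP (x \in D).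
  rewrite /= -(real_normK (num_real (h x))).
  by have := sqr_ge0 (`|h x| - 1); nra.
by rewrite h0 ?normr0 ?expr0n ?addr0//; move: xD; rewrite notin_setE.
Qed.

(** Cauchy-Schwarz against the indicator of [D], obtained by integrating the square of h - c on
    [D]. *)
Lemma Rintegral_sq_le (h : T -> R) (D : set T) (M : R) : measurable D ->
  (mu D <= M%:E)%E -> 0 < M -> measurable_fun setT h -> (forall x, ~ D x -> h x = 0) ->
  (((\int[mu]_x h x) ^+ 2)%:E <= M%:E * \int[mu]_x (h x ^+ 2)%:E)%E.
Proof.
move=> mD DM M0 mh h0.
have Dy : (mu D < +oo)%E by rewrite (le_lt_trans DM)// ltry.
have sq0 : (0 <= \int[mu]_x (h x ^+ 2)%:E)%E.
  by apply: integral_ge0 => x _; rewrite lee_fin sqr_ge0.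
have [hy|] := ltP (\int[mu]_x (h x ^+ 2)%:E)%E +oo%E; last first.
  by rewrite leye_eq => /eqP ->; rewrite gt0_muley ?lte_fin// leey.
have ih := integrable_sq_lty mD Dy mh h0 hy.
have i1 := integrable_indic_lty mD Dy.
have i2 : mu.-integrable setT (EFin \o (fun x => h x ^+ 2)).
  by apply: integrableP_ge0 => [|x|//]; [exact: measurable_funX|exact: sqr_ge0].
have A0 : (\int[mu]_x (h x ^+ 2)%:E)%E \is a fin_num by rewrite ge0_fin_numE.
rewrite -(fineK A0) -EFinM lee_fin.
rewrite -[fine _]/(\int[mu]_x (h x ^+ 2)).
set I := \int[mu]_x h x; set A := \int[mu]_x _.
(* The minimising constant would be I divided by the measure of [D]. Using [M] instead costs nothing
   in the bound and covers a [D] of measure zero. *)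
pose c := I / M.
have : 0 <= \int[mu]_x (h x ^+ 2 + ((- (2 * c)) * h x + c ^+ 2 * \1_D x)).
  apply: Rintegral_ge0 => x _; rewrite indicE.
  have [xD|xD] := boolP (x \in D); first by have := sqr_ge0 (h x - c); rewrite /=; nra.
  by rewrite h0 /= ?expr0n/= ?mulr0 ?addr0//; move: xD; rewrite notin_setE.
have i3 := integrable_mulrl (- (2 * c)) ih.
have i4 := integrable_mulrl (c ^+ 2) i1.
rewrite RintegralD//; last exact: integrable_addr.
rewrite RintegralD// !RintegralZl// -/I -/A.
have -> : \int[mu]_x (\1_D x : R) = fine (mu D).
  by rewrite /Rintegral integral_indic// setIT.
have : fine (mu D) <= M.
  by rewrite -lee_fin fineK// ge0_fin_numE.
have : c * M = I by rewrite /c divfK// gt_eqF.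
have : 0 <= c ^+ 2 by exact: sqr_ge0.
move: (fine _) => m.
move=> c0 cM mM.
have : c ^+ 2 * m <= c ^+ 2 * M by rewrite ler_wpM2l.
rewrite -cM; nra.
Qed.

Lemma cintegrable_energy f (D : set T) : measurable D ->
  (mu D < +oo)%E -> cmeasurable f -> (forall x, ~ D x -> f x = 0) ->
  (energy mu f < +oo)%E -> cintegrable f.
Proof.
move=> mD Dy [m1 m2] f0 fy; split; apply: (integrable_sq_lty mD Dy) => //.
- by move=> x /f0 ->.
- apply: le_lt_trans fy; apply: ge0_le_integral => //.
  + by move=> x _; rewrite lee_fin sqr_ge0.
  + exact/measurable_EFinP/measurable_funX.
  + exact: emeasurable_sqnorm.
  + by move=> x _; rewrite lee_fin /sqnorm lerDl sqr_ge0.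
- by move=> x /f0 ->.
- apply: le_lt_trans fy; apply: ge0_le_integral => //.
  + by move=> x _; rewrite lee_fin sqr_ge0.
  + exact/measurable_EFinP/measurable_funX.
  + exact: emeasurable_sqnorm.
  + by move=> x _; rewrite lee_fin /sqnorm lerDr sqr_ge0.
Qed.

(** On a set of finite measure the integral is continuous for the energy. Applied to phase times f,
    this makes every value of the transform continuous in the mean. *)
Lemma sqnorm_cint_le f (D : set T) (M : R) : measurable D ->
  (mu D <= M%:E)%E -> 0 < M -> cmeasurable f -> (forall x, ~ D x -> f x = 0) ->
  ((sqnorm (cint f))%:E <= M%:E * energy mu f)%E.
Proof.
move=> mD DM M0 [m1 m2] f0.
have h1 := @Rintegral_sq_le _ D M mD DM M0 m1 (fun x nD => congr1 _ (f0 x nD)).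
have h2 := @Rintegral_sq_le _ D M mD DM M0 m2 (fun x nD => congr1 _ (f0 x nD)).
have := leeD h1 h2; rewrite -EFinD -ge0_muleDr; last 2 first.
  by apply: integral_ge0 => x _; rewrite lee_fin sqr_ge0.
  by apply: integral_ge0 => x _; rewrite lee_fin sqr_ge0.
rewrite -ge0_integralD//; last 4 first.
  by move=> x _; rewrite lee_fin sqr_ge0.
  exact/measurable_EFinP/measurable_funX.
  by move=> x _; rewrite lee_fin sqr_ge0.
  exact/measurable_EFinP/measurable_funX.
Qed.

End ComplexIntegral.

Section ComplexFubini.
Context {d1 d2} {T1 : measurableType d1} {T2 : measurableType d2} {R : realType}.
Variable m1 : {sigma_finite_measure set T1 -> \bar R}.
Variable m2 : {sigma_finite_measure set T2 -> \bar R}.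
Implicit Types F : T1 * T2 -> R[i].

Lemma energy_tonelli1 F : cmeasurable F ->
  energy (m1 \x m2)%E F = (\int[m1]_x energy m2 (fun y => F (x, y)))%E.
Proof.
move=> mF; apply: (fubini_tonelli1 (fun z => (sqnorm (F z))%:E)).
  exact: emeasurable_sqnorm.
by move=> z; rewrite lee_fin sqnorm_ge0.
Qed.

Lemma energy_tonelli2 F : cmeasurable F ->
  energy (m1 \x m2)%E F = (\int[m2]_y energy m1 (fun x => F (x, y)))%E.
Proof.
move=> mF; apply: (fubini_tonelli2 (fun z => (sqnorm (F z))%:E)).
  exact: emeasurable_sqnorm.
by move=> z; rewrite lee_fin sqnorm_ge0.
Qed.

Lemma measurable_energy1 F : cmeasurable F ->
  measurable_fun setT (fun x => energy m2 (fun y => F (x, y))).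
Proof.
move=> mF; apply: (measurable_fun_fubini_tonelli_F (fun z => (sqnorm (F z))%:E)).
  exact: emeasurable_sqnorm.
by move=> z; rewrite lee_fin sqnorm_ge0.
Qed.

Lemma cmeasurable_slice1 F x : cmeasurable F -> cmeasurable (fun y => F (x, y)).
Proof.
move=> [m m']; split.
  exact: (measurableT_comp m (pair1_measurable x)).
exact: (measurableT_comp m' (pair1_measurable x)).
Qed.

Lemma cmeasurable_slice2 F y : cmeasurable F -> cmeasurable (fun x => F (x, y)).
Proof.
move=> [m m']; split.
  exact: (measurableT_comp m (pair2_measurable y)).
exact: (measurableT_comp m' (pair2_measurable y)).
Qed.

Lemma measurable_Rintegral1 (h : T1 * T2 -> R) : measurable_fun setT h ->
  measurable_fun setT (fun x => \int[m2]_y h (x, y)).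
Proof.
move=> mh; apply: (measurableT_comp (f := fine)); first exact: fine_measurable.
under eq_fun do rewrite integralE.
have meh : measurable_fun setT (EFin \o h) by exact/measurable_EFinP.
apply: emeasurable_funB.
  have := measurable_fun_fubini_tonelli_F (m2 := m2) ((EFin \o h)^\+)%E
    (measurable_funepos meh) (fun z => funepos_ge0 _ z).
  congr measurable_fun; apply/funext => x; apply: eq_integral => y _.
  by rewrite !funeposE.
have := measurable_fun_fubini_tonelli_F (m2 := m2) ((EFin \o h)^\-)%E
  (measurable_funeneg meh) (fun z => funeneg_ge0 _ z).
congr measurable_fun; apply/funext => x; apply: eq_integral => y _.
by rewrite !funenegE.
Qed.

Lemma cmeasurable_cint1 F : cmeasurable F ->
  cmeasurable (fun x => cint m2 (fun y => F (x, y))).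
Proof. by move=> [? ?]; split; exact: (@measurable_Rintegral1 (fun z => _ (F z))). Qed.

(** The inner real integral is [fine] of the extended one. The two agree where the slice is
    integrable, that is almost everywhere. *)
Lemma Rintegral_fubini1 (h : T1 * T2 -> R) :
  (m1 \x m2)%E.-integrable setT (EFin \o h) ->
  \int[m1]_x (\int[m2]_y h (x, y)) = \int[(m1 \x m2)%E]_z h z.
Proof.
move=> ih; rewrite {1}/Rintegral; congr fine.
rewrite -(integral12_prod_meas1 ih); apply: ae_eq_integral => //.
- apply/measurable_EFinP/measurable_Rintegral1.
  by apply/measurable_EFinP; exact: (measurable_int _ ih).
- exact: (measurable_fubini_F ih).
- apply: filterS (ae_integrable1 ih) => x /= hx _; rewrite /fubini_F/=.
  by rewrite fineK// integrable_fin_num.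
Qed.

Lemma Rintegral_fubini2 (h : T1 * T2 -> R) :
  (m1 \x m2)%E.-integrable setT (EFin \o h) ->
  \int[m2]_y (\int[m1]_x h (x, y)) = \int[(m1 \x m2)%E]_z h z.
Proof.
move=> ih; rewrite {1}/Rintegral; congr fine.
rewrite -(integral21_prod_meas1 ih); apply: ae_eq_integral => //.
- apply/measurable_EFinP; apply: (measurableT_comp (f := fine)); first exact: fine_measurable.
  exact: (measurable_fubini_G ih).
- exact: (measurable_fubini_G ih).
- apply: filterS (ae_integrable2 ih) => y /= hy _; rewrite /fubini_G/=.
  by rewrite fineK// integrable_fin_num.
Qed.

Lemma cint_fubini1 F : cintegrable (m1 \x m2)%E F ->
  cint m1 (fun x => cint m2 (fun y => F (x, y))) = cint (m1 \x m2)%E F.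
Proof. by move=> [i1 i2]; apply: complex_eq; exact: (@Rintegral_fubini1 (fun z => _ (F z))). Qed.

Lemma cint_fubini2 F : cintegrable (m1 \x m2)%E F ->
  cint m2 (fun y => cint m1 (fun x => F (x, y))) = cint (m1 \x m2)%E F.
Proof. by move=> [i1 i2]; apply: complex_eq; exact: (@Rintegral_fubini2 (fun z => _ (F z))). Qed.

End ComplexFubini.

Lemma le_of_eq {d : Order.disp_t} {T : porderType d} (x y : T) : x = y -> (x <= y)%O.
Proof. by move=> ->. Qed.

(** * Lebesgue measure and Fourier integrals on R^N *)

Section EuclideanMeasure.
Context {R : realType}.
Local Notation leb := (@lebesgue_measure R).

Lemma measurable_cube N k : measurable (@cube R N k).
Proof.
have -> : @cube R N k =
    \bigcap_(i in [set: 'I_N]) ((fun x : RN R N => tnth x i) @^-1` [set y : measurableTypeR R | `|y| <= k%:R]).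
  by apply/seteqP; split=> x /= H i; [move=> _; exact: H|exact: (H i I)].
apply: fin_bigcap_measurable; first exact: finite_finset.
move=> i _; rewrite -[X in measurable X]setTI; apply: measurable_tnth => //.
have -> : [set y : measurableTypeR R | `|y| <= k%:R] = [set` `[- k%:R, k%:R]%R].
  by apply/seteqP; split=> y /=; rewrite in_itv/= ler_norml.
exact: measurable_itv.
Qed.

Lemma cube_cons_pt N k (z : measurableTypeR R * RN R N) :
  cube k (cons_pt z) <-> `|z.1 : R| <= k%:R /\ cube k z.2.
Proof.
split=> [H|[H1 H2] i].
  by split=> [|i]; [have := H ord0; rewrite tnth0|have := H (lift ord0 i); rewrite tnthS].
by case: (unliftP ord0 i) => [j|] ->; rewrite ?tnthS ?tnth0//; exact: H2.
Qed.

Lemma dot_cons_pt N (w z : measurableTypeR R * RN R N) :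
  dot (cons_pt w) (cons_pt z) = (w.1 : R) * (z.1 : R) + dot w.2 z.2.
Proof.
rewrite /dot big_ord_recl !tnth0; congr (_ + _).
by apply: eq_bigr => i _; rewrite !tnthS.
Qed.

Lemma lebesgue_segment_fin_num (a b : R) : leb [set` `[a, b]%R] \is a fin_num.
Proof. by rewrite lebesgue_measure_itv/=; case: ifP. Qed.

Lemma lebesgueN_cube_lty N k : (lebesgueN R N (cube k) < +oo)%E.
Proof.
elim: N => [|N ih]; first by rewrite /= diracE ltry.
rewrite -[lebesgueN _ _ _]/((leb \x^ lebesgueN R N)%E (@cons_pt R N @^-1` cube k)).
have -> : @cons_pt R N @^-1` cube k =
    [set` `[- k%:R, k%:R]%R] `*` cube k.
  apply/seteqP; split=> z /=; rewrite in_itv/= -ler_norml => H.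
    exact/cube_cons_pt.
  exact/cube_cons_pt.
rewrite product_measure2E//; last exact: measurable_cube.
apply: lte_mul_pinfty => //.
exact: lebesgue_segment_fin_num.
Qed.

Lemma cube_cover N (x : RN R N) : exists k, cube k x.
Proof.
pose b : R := \sum_i `|tnth x i : R|.
exists (Num.bound b) => i.
have b0 : 0 <= b by apply: sumr_ge0 => j _.
have /ltW : b < (Num.bound b)%:R by exact: archi_boundP.
apply: le_trans.
by rewrite /b (bigD1 i)//= lerDl sumr_ge0.
Qed.

Lemma sigma_finite_lebesgueN N : sigma_finite setT (lebesgueN R N).
Proof.
exists (fun k => @cube R N k); last first.
  by move=> k; split; [exact: measurable_cube|exact: lebesgueN_cube_lty].
apply/seteqP; split=> // x _; have [k kx] := cube_cover x.
by exists k.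
Qed.

(* [lebesgueN R N] repackaged with its sigma-finiteness, as Fubini requires. *)
Definition lebesgueN_fun N : set (RN R N) -> \bar R := lebesgueN R N.

HB.instance Definition _ N := Measure.copy (@lebesgueN_fun N) (lebesgueN R N).

HB.instance Definition _ N := @Measure_isSigmaFinite.Build _ _ _
  (@lebesgueN_fun N) (@sigma_finite_lebesgueN N).

Definition lebesgueN_sigma N : {sigma_finite_measure set (RN R N) -> \bar R} :=
  @lebesgueN_fun N.

Local Notation lebS := lebesgueN_sigma.

(** [lebesgueN] is built with [\x^], while Fubini is applied with [\x]. The two products agree on
    rectangles, hence everywhere by sigma-finiteness. *)
Lemma ge0_integral_cons_pt N (f : RN R N.+1 -> \bar R) : measurable_fun setT f ->
  (forall x, 0 <= f x)%E ->
  (\int[lebesgueN R N.+1]_x f x = \int[leb \x lebS N]_z f (cons_pt z))%E.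
Proof.
move=> mf f0.
transitivity (\int[(leb \x^ lebesgueN R N)%E]_z f (cons_pt z))%E.
  exact: (ge0_integral_pushforward (@measurable_cons_pt R N) _ measurableT mf).
apply: esym; apply: eq_measure_integral => A mA _.
apply: (@product_measure_unique _ _ _ _ _ leb (lebS N)) => // B C mB mC.
exact: (product_measure2E leb (lebesgueN R N)).
Qed.

Lemma measurable_comp_cons_pt d (U : measurableType d) N (f : RN R N.+1 -> U) :
  measurable_fun setT f -> measurable_fun setT (fun z => f (cons_pt z)).
Proof. by move=> mf; exact: measurableT_comp mf (@measurable_cons_pt R N). Qed.

Lemma cmeasurable_cons_pt N (f : RN R N.+1 -> R[i]) : cmeasurable f ->
  cmeasurable (fun z => f (cons_pt z)).
Proof.
move=> [m1 m2]; split.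
  exact: (measurable_comp_cons_pt m1).
exact: (measurable_comp_cons_pt m2).
Qed.

Lemma energy_cons_pt N (f : RN R N.+1 -> R[i]) : cmeasurable f ->
  energy (lebesgueN R N.+1) f =
  energy (leb \x lebS N)%E (fun z => f (cons_pt z)).
Proof.
move=> mf; apply: (@ge0_integral_cons_pt N (fun x => (sqnorm (f x))%:E)).
  exact: emeasurable_sqnorm.
by move=> x; rewrite lee_fin sqnorm_ge0.
Qed.

Lemma Rintegral_cons_pt N (h : RN R N.+1 -> R) : measurable_fun setT h ->
  \int[lebesgueN R N.+1]_x h x = \int[(leb \x lebS N)%E]_z h (cons_pt z).
Proof.
move=> mh; rewrite /Rintegral; congr fine.
have meh : measurable_fun setT (EFin \o h) by exact/measurable_EFinP.
rewrite integralE [RHS]integralE.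
rewrite (ge0_integral_cons_pt (measurable_funepos meh) (fun z => funepos_ge0 _ z)).
rewrite (ge0_integral_cons_pt (measurable_funeneg meh) (fun z => funeneg_ge0 _ z)).
by congr (_ - _)%E; apply: eq_integral => z _; rewrite ?funeposE ?funenegE.
Qed.

Lemma cint_cons_pt N (f : RN R N.+1 -> R[i]) : cmeasurable f ->
  cint (lebesgueN R N.+1) f = cint (leb \x lebS N)%E (fun z => f (cons_pt z)).
Proof.
move=> [m1 m2]; apply: complex_eq.
  exact: (Rintegral_cons_pt m1).
exact: (Rintegral_cons_pt m2).
Qed.

Lemma measurable_dot N d (U : measurableType d) (f g : U -> RN R N) :
  measurable_fun setT f -> measurable_fun setT g ->
  measurable_fun setT (fun u => dot (f u) (g u)).
Proof.
move=> mf mg; apply: (@measurable_sum _ _ _ setT _ _ (fun i u => (tnth (f u) i : R) * (tnth (g u) i : R))) => i.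
apply: measurable_funM.
  exact: (measurableT_comp (measurable_tnth i) mf).
exact: (measurableT_comp (measurable_tnth i) mg).
Qed.

Lemma cmeasurable_phase N d (U : measurableType d) s (f g : U -> RN R N) :
  measurable_fun setT f -> measurable_fun setT g ->
  cmeasurable (fun u => expi (s * (2 * pi * dot (f u) (g u)))).
Proof.
move=> mf mg; apply: cmeasurable_expi.
by apply: measurable_funM => //; apply: measurable_funM => //; exact: measurable_dot.
Qed.

Definition FT N (s : R) (f : RN R N -> R[i]) (xi : RN R N) : R[i] :=
  cint (lebesgueN R N) (fun x => expi (s * (2 * pi * dot xi x)) * f x).

(** The line has its own transform because the induction on N splits off a coordinate of type [R],
    not a 1-tuple. *)
Definition FT1 (s : R) (f : R -> R[i]) (xi : R) : R[i] :=
  cint leb (fun x => expi (s * (2 * pi * (xi * x))) * f x).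

(** The version with a parameter serves the partial transforms in the induction on N, where the
    remaining coordinate is carried along. *)
Lemma cmeasurable_FT_param N d (U : measurableType d) s (F : U * RN R N -> R[i])
    (x : U -> RN R N) :
  cmeasurable F -> measurable_fun setT x ->
  cmeasurable (fun u => FT s (fun y => F (u, y)) (x u)).
Proof.
move=> mF mx.
apply: (@cmeasurable_cint1 _ _ _ _ _ (lebS N)
  (fun w => expi (s * (2 * pi * dot (x w.1) w.2)) * F (w.1, w.2))).
apply: cmeasurableM; first by apply: cmeasurable_phase => //; exact: measurableT_comp.
by under eq_fun do rewrite -surjective_pairing.
Qed.

Lemma cmeasurable_FT N s (f : RN R N -> R[i]) : cmeasurable f -> cmeasurable (FT s f).
Proof.
move=> [m1 m2]; apply: (@cmeasurable_FT_param N _ _ s (fun w : RN R N * RN R N => f w.2) id) => //.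
split; first exact: (measurableT_comp m1 measurable_snd).
exact: (measurableT_comp m2 measurable_snd).
Qed.

Definition cubic N (f : RN R N -> R[i]) := exists k, forall x, ~ cube k x -> f x = 0.

Lemma cubic_cintegrable N (f : RN R N -> R[i]) : cmeasurable f -> cubic f ->
  (energy (lebesgueN R N) f < +oo)%E -> cintegrable (lebesgueN R N) f.
Proof.
move=> mf [k fk]; apply: (cintegrable_energy (measurable_cube k)) => //.
exact: lebesgueN_cube_lty.
Qed.

Lemma energy_expi {d} {T : measurableType d} (mu : {measure set T -> \bar R})
  (th : T -> R) (f : T -> R[i]) :
  energy mu (fun x => expi (th x) * f x) = energy mu f.
Proof. by apply: eq_integral => x _; rewrite sqnormM sqnorm_expi mul1r. Qed.

(** [M] does not depend on f or xi. Integrating the bound over a parameter therefore shows that a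
    partial transform has finite energy in the remaining variable at every frequency. *)
Lemma sqnorm_FT_le N k : exists2 M : R, 0 < M & forall s (f : RN R N -> R[i]) xi,
  cmeasurable f -> (forall x, ~ cube k x -> f x = 0) ->
  ((sqnorm (FT s f xi))%:E <= M%:E * energy (lebesgueN R N) f)%E.
Proof.
have cf : lebesgueN R N (cube k) \is a fin_num.
  by rewrite ge0_fin_numE// lebesgueN_cube_lty.
exists (fine (lebesgueN R N (cube k)) + 1); first by rewrite ltr_wpDl// fine_ge0.
move=> s f xi mf fk.
rewrite -(energy_expi _ (fun x => s * (2 * pi * dot xi x))).
apply: sqnorm_cint_le (measurable_cube k) _ _ _ _.
- by rewrite EFinD fineK// leeDl.
- by rewrite ltr_wpDl// fine_ge0.
- by apply: cmeasurableM => //; exact: cmeasurable_phase.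
- by move=> x /fk ->; rewrite mulr0.
Qed.

Lemma ae_eq_cint {d} {T : measurableType d} (mu : {measure set T -> \bar R})
    (f g : T -> R[i]) : cmeasurable f -> cmeasurable g ->
  {ae mu, forall x, f x = g x} -> cint mu f = cint mu g.
Proof.
move=> [f1 f2] [g1 g2] fg; apply: complex_eq; rewrite /= /Rintegral; congr fine;
  apply: ae_eq_integral => //; try exact/measurable_EFinP;
  by apply: filterS fg => x ->.
Qed.

Lemma cint0 {d} {T : measurableType d} (mu : {measure set T -> \bar R})
    (f : T -> R[i]) : (forall x, f x = 0) -> cint mu f = 0.
Proof.
move=> f0; apply: complex_eq; rewrite /cint /= /Rintegral.
  by under eq_integral do rewrite f0; rewrite integral0.
by under eq_integral do rewrite f0; rewrite integral0.
Qed.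

Lemma ae_integral_lty {d} {T : measurableType d} (mu : {measure set T -> \bar R})
    (f : T -> \bar R) : measurable_fun setT f -> (forall x, 0 <= f x)%E ->
  (\int[mu]_x f x < +oo)%E -> {ae mu, forall x, (f x < +oo)%E}.
Proof.
move=> mf f0 fy.
have /(integrable_ae measurableT) : mu.-integrable setT f.
  by apply/integrableP; split => //; under eq_integral do rewrite gee0_abs//.
by apply: filterS => x /(_ I); rewrite ge0_fin_numE.
Qed.

End EuclideanMeasure.

(** * The integral of (1 - cos (a x)) / x^2 *)

Section RealDerivatives.
Context {R : realType}.
Implicit Types (f g : R -> R) (x u v a : R).

Lemma is_derive_mul f g x u v : is_derive x (1 : R) f u -> is_derive x (1 : R) g v ->
  is_derive x (1 : R) (fun y => f y * g y) (u * g x + f x * v).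
Proof.
by move=> df dg; apply: (is_derive_eq (is_deriveM df dg)); rewrite /GRing.scale/=; ring.
Qed.

Lemma is_derive_add f g x u v : is_derive x (1 : R) f u -> is_derive x (1 : R) g v ->
  is_derive x (1 : R) (fun y => f y + g y) (u + v).
Proof. by move=> df dg; exact: is_deriveD. Qed.

Lemma is_derive_cst0 (c x : R) : is_derive x (1 : R) (fun=> c) (0 : R).
Proof. exact: is_derive_cst. Qed.

Lemma is_derive_mull a x : is_derive x (1 : R) (fun y => a * y) a.
Proof.
by apply: (is_derive_eq (is_derive_mul (is_derive_cst a _ _) (is_derive_id x _))); rewrite mul0r add0r mulr1.
Qed.

Lemma is_derive_comp_mull f a x u : is_derive (a * x) (1 : R) f u ->
  is_derive x (1 : R) (fun y => f (a * y)) (u * a).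
Proof. by move=> df; exact: (is_derive1_comp df (is_derive_mull a x)). Qed.

End RealDerivatives.

Lemma measurable_invr {R : realType} {d} {T : measurableType d} (f : T -> R) :
  measurable_fun setT f -> measurable_fun setT (fun x => (f x)^-1).
Proof.
suff mV : measurable_fun setT (fun x : R => x^-1) by move=> mf; exact: (measurableT_comp mV mf).
rewrite -(setUv [set (0 : R)]); apply/measurable_funU.
- exact: measurable_set1.
- by apply: measurableC; exact: measurable_set1.
split; first exact: measurable_fun_set1.
apply: open_continuous_measurable_fun.
  by apply: closed_openC; exact: closed_eq.
by move=> x; rewrite inE /= => /eqP x0; exact: inv_continuous.
Qed.

Section SincIntegral.
Context {R : realType}.
Local Notation leb := (@lebesgue_measure R).

Lemma lebesgue_measure_opp (A : set (measurableTypeR R)) : measurable A ->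
  leb (-%R @^-1` A) = leb A.
Proof.
have mN : measurable_fun setT (-%R : measurableTypeR R -> measurableTypeR R).
  exact: oppr_measurable.
pose nu := measure_function_pushforward__canonical__measure_function_Measure leb mN.
move=> mA; apply: esym; apply: (@lebesgue_measure_unique R nu) => // _ [[a b] _ <-].
rewrite /= /nu /pushforward /=.
have -> : -%R @^-1` `]a, b]%classic = [set` `[- b, - a[%R].
  apply/seteqP; split=> x /=; rewrite !in_itv/=.
    by move=> /andP[h1 h2]; rewrite lerNl h2/= ltrNr.
  by move=> /andP[h1 h2]; rewrite ltrNr h2/= lerNl.
rewrite !lebesgue_measure_itv/= !lte_fin ltrN2.
by case: ifP => // _; rewrite -!EFinB opprK addrC.
Qed.

Lemma ge0_integral_opp (f : R -> \bar R) : measurable_fun setT f ->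
  (forall x, 0 <= f x)%E -> (\int[leb]_x f (- x)%R = \int[leb]_x f x)%E.
Proof.
move=> mf f0.
have mN : measurable_fun setT (-%R : measurableTypeR R -> measurableTypeR R).
  exact: oppr_measurable.
rewrite -(ge0_integral_pushforward mN leb measurableT mf)//.
apply: (eq_measure_integral leb) => A mA _; exact: lebesgue_measure_opp.
Qed.

Lemma cvgr_expR_scale (a : R) : 0 < a -> expR (- a * x) @[x --> +oo] --> (0 : R).
Proof.
move=> a0; under eq_fun do rewrite mulNr.
apply: (cvg_comp (fun x => a * x) (fun x => expR (- x))); last exact: cvgr_expR.
exact: gt0_cvgMry.
Qed.

Lemma continuous_is_derive (f : R -> R) (df : R -> R) :
  (forall x, is_derive x (1 : R) f (df x)) -> continuous f.
Proof.
move=> H x; apply: differentiable_continuous; apply/derivable1_diffP.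
by have [] := H x.
Qed.

Lemma integral0y_FTC (f F : R -> R) (l : R) :
  (forall x, 0 <= x -> 0 <= f x) -> continuous f ->
  (forall x, is_derive x (1 : R) F (f x)) -> F x @[x --> +oo] --> l ->
  (\int[leb]_(x in `[0%R, +oo[) (f x)%:E = (l - F 0%R)%:E)%E.
Proof.
move=> f0 cf dF Fl; rewrite EFinB; apply: ge0_continuous_FTC2y => //.
- exact: continuous_subspaceT.
- by apply: cvg_at_right_filter; exact: (continuous_is_derive dF).
- by move=> x _; rewrite derive1E; have [] := dF x.
Qed.

(** This writes 1/x^2 as the Laplace transform of t, so that the integral of (1 - cos (a x)) / x^2
    becomes a double integral of elementary functions. *)
Lemma integral_laplace_id (x : R) : 0 < x ->
  (\int[leb]_(t in `[0%R, +oo[) (t * expR (- x * t))%:E = (x ^- 2)%:E)%E.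
Proof.
move=> x0.
have xN : x != 0 by rewrite gt_eqF.
have dE t : is_derive t (1 : R) (fun t => expR (- x * t)) (expR (- x * t) * - x).
  apply: is_derive_comp_mull; exact: is_derive_expR.
have dF t : is_derive t (1 : R) (fun t => (- x^-1 * t + - x ^- 2) * expR (- x * t))
    (t * expR (- x * t)).
  apply: (is_derive_eq (is_derive_mul (is_derive_add (is_derive_mull _ _) (is_derive_cst0 _ _)) (dE t))).
  by field.
have dG t : is_derive t (1 : R) (fun t => t * expR (- x * t)) (1 * expR (- x * t) + t * (expR (- x * t) * - x)).
  exact: is_derive_mul.
rewrite (integral0y_FTC (F := fun t => (- x^-1 * t + - x ^- 2) * expR (- x * t)) (l := 0)).
- by rewrite !mulr0 expR0 mulr1 add0r sub0r opprK.
- by move=> t t0; rewrite mulr_ge0// expR_ge0.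
- exact: continuous_is_derive dG.
- have H : (- (2 / x ^+ 2) - x ^- 2) * expR (- (x / 2) * t) @[t --> +oo] --> (0 : R).
    rewrite -[X in _ --> X](mulr0 (- (2 / x ^+ 2) - x ^- 2)).
    by apply: cvgMr; apply: cvgr_expR_scale; rewrite divr_gt0.
  apply: (@squeeze_cvgr _ _ _ _ (fun t => (- (2 / x ^+ 2) - x ^- 2) * expR (- (x / 2) * t)) (cst 0)).
  + near=> t.
    have t0 : 0 <= t by near: t; exact: nbhs_pinfty_ge.
    apply/andP; split; last first.
      rewrite -(mul0r (expR (- x * t))) ler_pM2r ?expR_gt0//.
      have : 0 <= x^-1 * t by rewrite mulr_ge0// invr_ge0 ltW.
      have : 0 <= x ^- 2 by rewrite invr_ge0 exprn_ge0// ltW.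
      lra.
    (* One half of the exponential absorbs the factor t, since (x t / 2) e^(-x t / 2) <= 1; the
       other half gives the decay. *)
    rewrite (_ : - x * t = - (x / 2) * t + - (x / 2) * t); last by field.
    rewrite expRD mulrA ler_pM2r ?expR_gt0//.
    set e := expR _; have e0 : 0 < e by exact: expR_gt0.
    have e1 : e <= 1.
      by rewrite /e -expR0 ler_expR mulNr oppr_le0 mulr_ge0// divr_ge0// ltW.
    have te : x / 2 * t * e <= 1.
      rewrite /e mulNr expRN ler_pdivrMr ?expR_gt0// mul1r.
      by have := expR_ge1Dx (x / 2 * t); lra.
    have x2 : 0 < x ^- 2 by rewrite invr_gt0 exprn_gt0.
    have -> : - x^-1 * t + - x ^- 2 = - (2 / x ^+ 2) * (x / 2 * t) - x ^- 2 by field.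
    have : x ^- 2 * e <= x ^- 2 * 1 by rewrite ler_pM2l.
    have : (2 / x ^+ 2) * (x / 2 * t * e) <= (2 / x ^+ 2) * 1.
      by rewrite ler_pM2l// divr_gt0// exprn_gt0.
    nra.
  + exact: H.
  + exact: cvg_cst.
Unshelve. all: by end_near. Qed.

Lemma integral_laplace_cos (a t : R) : 0 < t ->
  (\int[leb]_(x in `[0%R, +oo[) ((1 - cos (a * x)) * expR (- t * x))%:E =
   (a ^+ 2 / (t * (t ^+ 2 + a ^+ 2)))%:E)%E.
Proof.
move=> t0.
have tN : t != 0 by rewrite gt_eqF.
have s0 : 0 < t ^+ 2 + a ^+ 2 by rewrite ltr_wpDr ?sqr_ge0// exprn_gt0.
have sN : t ^+ 2 + a ^+ 2 != 0 by rewrite gt_eqF.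
have dE x : is_derive x (1 : R) (fun x => expR (- t * x)) (expR (- t * x) * - t).
  apply: is_derive_comp_mull; exact: is_derive_expR.
have dC x : is_derive x (1 : R) (fun x => cos (a * x)) (- sin (a * x) * a).
  apply: is_derive_comp_mull; exact: is_derive_cos.
have dS x : is_derive x (1 : R) (fun x => sin (a * x)) (cos (a * x) * a).
  apply: is_derive_comp_mull; exact: is_derive_sin.
pose s := t ^+ 2 + a ^+ 2.
(* The oscillating part is minus the real part of e^((ia - t) x) / (ia - t). *)
pose F x := (- t^-1 + (t / s * cos (a * x) + - (a / s) * sin (a * x))) * expR (- t * x).
have dF x : is_derive x (1 : R) F ((1 - cos (a * x)) * expR (- t * x)).
  apply: (is_derive_eq (is_derive_mul (is_derive_add (is_derive_cst0 _ _)
    (is_derive_add (is_derive_mul (is_derive_cst0 _ _) (dC x))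
                   (is_derive_mul (is_derive_cst0 _ _) (dS x)))) (dE x))).
  by rewrite /s; field; rewrite sN tN.
rewrite (integral0y_FTC (F := F) (l := 0)).
- rewrite /F !mulr0 expR0 cos0 sin0 mulr0 addr0 !mulr1 sub0r; congr EFin.
  by rewrite /s; field; rewrite sN tN.
- by move=> x _; rewrite mulr_ge0 ?expR_ge0// subr_ge0 cos_le1.
- apply: (@continuous_is_derive _ (fun x => (0 + - (- sin (a * x) * a)) * expR (- t * x) + (1 - cos (a * x)) * (expR (- t * x) * - t))) => x.
  exact: (is_derive_mul (is_derive_add (is_derive_cst0 _ _) (is_deriveN (dC x))) (dE x)).
- pose C := t^-1 + (t / s + `|a| / s).
  have H : C * expR (- t * x) @[x --> +oo] --> (0 : R).
    by rewrite -[X in _ --> X](mulr0 C); apply: cvgMr; exact: cvgr_expR_scale.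
  have H' : - (C * expR (- t * x)) @[x --> +oo] --> (0 : R).
    by rewrite -[X in _ --> X]oppr0; exact: cvgN.
  apply: (squeeze_cvgr _ H' H); apply: nearW => x.
  rewrite -ler_norml /F normrM (@ger0_norm _ (expR _)) ?expR_ge0//.
  rewrite ler_pM2r ?expR_gt0//.
  apply: (le_trans (ler_normD _ _)); rewrite normrN.
  have ti : 0 <= t^-1 by rewrite invr_ge0 ltW.
  have si : 0 <= s^-1 by rewrite invr_ge0 ltW.
  rewrite (ger0_norm ti) lerD2l; apply: (le_trans (ler_normD _ _)).
  rewrite !normrM normrN normrM (ger0_norm si) (ger0_norm (ltW t0)).
  have st : 0 <= t / s by rewrite divr_ge0// ltW.
  have sa : 0 <= `|a| / s by rewrite divr_ge0// ltW.
  have c1 : `|cos (a * x)| <= 1 by rewrite ler_norml cos_geN1 cos_le1.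
  have s1 : `|sin (a * x)| <= 1 by rewrite ler_norml sin_geN1 sin_le1.
  by rewrite lerD// ler_piMr.
Qed.

Lemma integral_cauchy_kernel (a : R) : 0 < a ->
  (\int[leb]_(t in `[0%R, +oo[) (a ^+ 2 / (t ^+ 2 + a ^+ 2))%:E =
   (a * (pi / 2))%:E)%E.
Proof.
move=> a0.
have aN : a != 0 by rewrite gt_eqF.
have sN t : t ^+ 2 + a ^+ 2 != 0 by rewrite gt_eqF// ltr_wpDl ?sqr_ge0// exprn_gt0.
have dF t : is_derive t (1 : R) (fun t => a * atan (a^-1 * t)) (a ^+ 2 / (t ^+ 2 + a ^+ 2)).
  apply: (is_derive_eq (is_derive_mul (is_derive_cst0 _ _) (is_derive_comp_mull (is_derive1_atan _)))).
  have : 1 + (a^-1 * t) ^+ 2 != 0 by rewrite gt_eqF// ltr_pwDl// sqr_ge0.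
  have : a ^+ 2 + t ^+ 2 != 0 by rewrite addrC.
  move: (sN t) => h1 h2 h3; rewrite mul0r add0r.
  have -> : 1 + (a^-1 * t) ^+ 2 = (t ^+ 2 + a ^+ 2) / a ^+ 2 by field.
  by field; rewrite h1.
rewrite (integral0y_FTC (F := fun t => a * atan (a^-1 * t)) (l := a * (pi / 2))).
- by rewrite mulr0 atan0 mulr0 subr0.
- by move=> t _; rewrite divr_ge0 ?addr_ge0 ?sqr_ge0.
- move=> t; apply: cvgM; first exact: cvg_cst.
  apply: cvgV => //; apply: cvgD; last exact: cvg_cst.
  exact: exprn_continuous.
- apply: cvgMr; apply: (cvg_comp (fun t => a^-1 * t) (@atan R)); last exact: cvgy_atan.
  by apply: gt0_cvgMry; rewrite ?invr_gt0.
Qed.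

Lemma integral_halfline_indic (f : R -> R) :
  (\int[leb]_(x in `[0%R, +oo[) (f x)%:E = \int[leb]_x (\1_(`[0%R, +oo[) x * f x)%:E)%E.
Proof.
rewrite integral_mkcond; apply: eq_integral => x _.
by rewrite epatch_indic /= -EFinM mulrC.
Qed.

Lemma measurable_one_sub_cos (a : R) : measurable_fun setT (fun x : R => (1 - cos (a * x)) / x ^+ 2).
Proof.
have mc : measurable_fun setT (fun x : R => 1 - cos (a * x)).
  apply: measurable_funB => //.
  apply: (measurableT_comp (f := cos)) => //.
  by apply: continuous_measurable_fun; exact: continuous_cos.
apply: measurable_funM => //.
by apply: measurable_invr; exact: measurable_funX.
Qed.

(** Tonelli for (1 - cos (a x)) t e^(-x t) on the positive quadrant: integrating in t gives the left
    side, integrating in x gives a^2 / (t^2 + a^2), whose integral is an arctangent. *)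
Lemma integral_one_sub_cos_half (a : R) : 0 < a ->
  (\int[leb]_(x in `[0%R, +oo[) ((1 - cos (a * x)) / x ^+ 2)%:E = (a * (pi / 2))%:E)%E.
Proof.
move=> a0; pose D : set R := `[0%R, +oo[%classic.
have mD : measurable D by exact: measurable_itv.
pose K (z : R * R) := \1_D z.1 * (\1_D z.2 * ((1 - cos (a * z.1)) * (z.2 * expR (- z.1 * z.2)))).
have K0 z : 0 <= K z.
  rewrite /K !indicE; case: (boolP (z.2 \in D)) => [|_]; last by rewrite mul0r mulr0.
  rewrite inE /D /= in_itv/= andbT => z2.
  by rewrite mul1r !mulr_ge0// ?expR_ge0// subr_ge0 cos_le1.
have mI : measurable_fun setT (\1_D : R -> R) by exact: measurable_indic.
have mK : measurable_fun setT K.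
  apply: measurable_funM; first exact: (measurableT_comp mI measurable_fst).
  apply: measurable_funM; first exact: (measurableT_comp mI measurable_snd).
  apply: measurable_funM.
    apply: measurable_funB => //; apply: (measurableT_comp (f := cos)).
      by apply: continuous_measurable_fun; exact: continuous_cos.
    by apply: measurable_funM => //; exact: measurable_fst.
  apply: measurable_funM; first exact: measurable_snd.
  apply: (measurableT_comp (f := expR)); first exact: measurable_expR.
  apply: measurable_funM; last exact: measurable_snd.
  by apply: measurable_funN; exact: measurable_fst.
transitivity (\int[leb]_x \int[leb]_t (K (x, t))%:E)%E.
  rewrite integral_halfline_indic; apply: eq_integral => x _.
  rewrite -/D /K /= indicE; have [xD|xD] := boolP (x \in D); last first.
    under eq_integral do rewrite mul0r.
    by rewrite integral0 mul0r.
  under eq_integral do rewrite mul1r mulrC -mulrA.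
  move: xD; rewrite inE /D /= in_itv/= andbT le_eqVlt => /orP[/eqP <-|x0].
    (* The Laplace formula requires x > 0; at x = 0 the factor 1 - cos 0 makes both sides vanish. *)
    rewrite mulr0 cos0 subrr mul0r mulr0.
    by under eq_integral do rewrite mul0r; rewrite integral0.
  rewrite mul1r EFinM -(integral_laplace_id x0) integral_halfline_indic.
  rewrite -ge0_integralZl_EFin//.
  - by apply: eq_integral => t _; rewrite -EFinM mulrC [in RHS]mulrC [in RHS]mulrC; congr EFin; ring.
  - move=> t _; rewrite lee_fin indicE; case: (boolP (t \in D)) => [|_]; last by rewrite mul0r.
    by rewrite inE /D /= in_itv/= andbT => t0; rewrite !mulr_ge0// expR_ge0.
  - apply/measurable_EFinP; apply: measurable_funM => //; apply: measurable_funM => //.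
    by apply: (measurableT_comp (f := expR)); [exact: measurable_expR|exact: measurable_funM].
have meK : measurable_fun setT (EFin \o K) by exact/measurable_EFinP.
have eK0 z : (0 <= (EFin \o K) z)%E by rewrite lee_fin.
rewrite [LHS](@fubini_tonelli _ _ _ _ _ leb leb (EFin \o K) meK eK0).
rewrite -(integral_cauchy_kernel a0) [RHS]integral_halfline_indic.
apply: ge0_ae_eq_integral => //.
- exact: (@measurable_fun_fubini_tonelli_G _ _ _ _ _ leb (EFin \o K) meK eK0).
- apply/measurable_EFinP; apply: measurable_funM => //; apply: measurable_funM => //.
  by apply: measurable_invr; apply: measurable_funD => //; exact: measurable_funX.
- by move=> t _; apply: integral_ge0 => x _; rewrite lee_fin.
- by move=> t _; rewrite lee_fin mulr_ge0// divr_ge0 ?addr_ge0 ?sqr_ge0.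
(* The point t = 0 is a true exception: the factor t makes the inner integral 0 there, while a^2 /
   (t^2 + a^2) is 1. *)
exists [set (0 : R)]; split; [exact: measurable_set1|exact: lebesgue_measure_set1|].
move=> t /= H; apply: contrapT => tN; apply: H => _.
rewrite /K /= indicE; case: (boolP (t \in D)) => [tD|_]; last first.
  by under eq_integral do rewrite mul0r mulr0; rewrite integral0 mul0r.
have t0 : 0 < t.
  by move: tD; rewrite inE /D /= in_itv/= andbT le_eqVlt => /orP[/eqP t0|//]; case: tN.
rewrite mul1r (_ : a ^+ 2 / (t ^+ 2 + a ^+ 2) = t * (a ^+ 2 / (t * (t ^+ 2 + a ^+ 2)))); last first.
  have : t ^+ 2 + a ^+ 2 != 0 by rewrite gt_eqF// ltr_wpDl ?sqr_ge0// exprn_gt0.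
  have : t != 0 by rewrite gt_eqF.
  by move=> h1 h2; field; rewrite h1 h2.
rewrite EFinM -(integral_laplace_cos a t0) integral_halfline_indic -ge0_integralZl_EFin ?ltW//.
- apply: eq_integral => x _; rewrite -EFinM -/D; congr EFin.
  rewrite (_ : - x * t = - t * x); last by rewrite !mulNr mulrC.
  have swap (p q r s : R) : p * (1 * (q * (r * s))) = r * (p * (q * s)) by ring.
  exact: swap.
- apply/measurable_EFinP; apply: measurable_funM => //; apply: measurable_funM => //.
    apply: measurable_funB => //; apply: (measurableT_comp (f := cos)) => //.
    by apply: continuous_measurable_fun; exact: continuous_cos.
  by apply: (measurableT_comp (f := expR)); [exact: measurable_expR|exact: measurable_funM].
Qed.

Lemma integral_one_sub_cos (a : R) :
  (\int[leb]_x ((1 - cos (a * x)) / x ^+ 2)%:E = (pi * `|a|)%:E)%E.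
Proof.
wlog a0 : a / 0 < a.
  move=> H; have [a0|a0|<-] := ltgtP 0 a.
  - exact: H.
  - rewrite -normrN -H ?oppr_gt0//; apply: eq_integral => x _.
    by rewrite mulNr cosN.
  - rewrite normr0 mulr0; under eq_integral do rewrite mul0r cos0 subrr mul0r.
    by rewrite integral0.
pose f (x : R) := (1 - cos (a * x)) / x ^+ 2.
have f0 x : 0 <= f x by rewrite divr_ge0 ?sqr_ge0// subr_ge0 cos_le1.
pose g x := \1_(`[0%R, +oo[) x * f x.
have g0 x : 0 <= g x by rewrite mulr_ge0.
have mg : measurable_fun setT g.
  by apply: measurable_funM; [exact: measurable_indic|exact: measurable_one_sub_cos].
have fg x : f x = g x + g (- x).
  have fN : f (- x) = f x by rewrite /f mulrN cosN sqrrN.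
  rewrite /g fN -mulrDl !indicE.
  have [x0|x0|<-] := ltgtP 0 x; last by rewrite /f mulr0 cos0 subrr mul0r mulr0.
    rewrite mem_set /=; last by rewrite in_itv/= andbT ltW.
    rewrite memNset /= ?addr0 ?mul1r// in_itv/= andbT oppr_ge0; apply/negP.
    by rewrite -ltNge.
  rewrite memNset /=; last by rewrite in_itv/= andbT; apply/negP; rewrite -ltNge.
  by rewrite mem_set /= ?add0r ?mul1r// in_itv/= andbT oppr_ge0 ltW.
transitivity (\int[leb]_x ((g x)%:E + (g (- x))%:E))%E.
  by apply: eq_integral => x _; rewrite -EFinD -fg.
have mgN : measurable_fun setT (fun x : R => g (- x)).
  by apply: (measurableT_comp mg); exact: oppr_measurable.
rewrite ge0_integralD//; last 4 first.
- by move=> x _; rewrite lee_fin.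
- exact/measurable_EFinP.
- by move=> x _; rewrite lee_fin.
- exact/measurable_EFinP.
rewrite (ge0_integral_opp (f := EFin \o g)); last 2 first.
- exact/measurable_EFinP.
- by move=> x; rewrite lee_fin.
rewrite -integral_halfline_indic integral_one_sub_cos_half// -EFinD ger0_norm ?ltW//.
by congr EFin; field.
Qed.

End SincIntegral.

(** * Plancherel for real step functions *)

Section FiniteSums.
Context {d} {T : measurableType d} {R : realType}.
Variable mu : {measure set T -> \bar R}.

Lemma Rintegral_sum (I : Type) (s : seq I) (f : I -> T -> R) :
  (forall i, mu.-integrable setT (EFin \o f i)) ->
  mu.-integrable setT (EFin \o (fun x => \sum_(i <- s) f i x)) /\
  \int[mu]_x (\sum_(i <- s) f i x) = \sum_(i <- s) \int[mu]_x f i x.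
Proof.
move=> fi; elim: s => [|i s [ih1 ih2]].
  under eq_fun do rewrite big_nil; rewrite big_nil; split; first exact: integrable0.
  by rewrite Rintegral_cst// mul0r.
under [X in EFin \o X]eq_fun do rewrite big_cons; split; first exact: integrable_addr.
by under eq_Rintegral do rewrite big_cons; rewrite RintegralD// ih2 big_cons.
Qed.

Lemma Rintegral_double_sum (I : Type) (s : seq I) (c : I -> R) (G : I -> I -> T -> R) :
  (forall i j, mu.-integrable setT (EFin \o G i j)) ->
  mu.-integrable setT (EFin \o (fun x => \sum_(i <- s) \sum_(j <- s) c i * c j * G i j x)) /\
  \int[mu]_x (\sum_(i <- s) \sum_(j <- s) c i * c j * G i j x) =
  \sum_(i <- s) \sum_(j <- s) c i * c j * \int[mu]_x G i j x.
Proof.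
move=> Gi.
have inner i := @Rintegral_sum I s (fun j x => c i * c j * G i j x)
  (fun j => integrable_mulrl (c i * c j) (Gi i j)).
have [sumi sumE] := @Rintegral_sum I s (fun i x => \sum_(j <- s) c i * c j * G i j x)
  (fun i => (inner i).1).
split=> //; rewrite sumE; apply: eq_bigr => i _; rewrite (inner i).2.
by apply: eq_bigr => j _; rewrite RintegralZl.
Qed.

Lemma ae_eq_integrable (f g : T -> R) : measurable_fun setT f ->
  {ae mu, forall x, f x = g x} -> mu.-integrable setT (EFin \o g) ->
  mu.-integrable setT (EFin \o f) /\ \int[mu]_x f x = \int[mu]_x g x.
Proof.
move=> mf fg gi.
have mg : measurable_fun setT g by apply/measurable_EFinP; exact: (measurable_int _ gi).
split; last first.
  rewrite /Rintegral; congr fine; apply: ae_eq_integral => //; try exact/measurable_EFinP.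
  by apply: filterS fg => x ->.
move/integrableP : gi => [_ gy]; apply/integrableP; split; first exact/measurable_EFinP.
rewrite (@ae_eq_integral _ _ _ _ _ (fun x => `|(EFin \o g) x|)%E)//.
- by apply: measurableT_comp => //; exact/measurable_EFinP.
- by apply: measurableT_comp => //; exact/measurable_EFinP.
- by apply: filterS fg => x /= ->.
Qed.

Lemma energy_Rintegral (f : T -> R[i]) :
  mu.-integrable setT (EFin \o (fun x => sqnorm (f x))) ->
  energy mu f = (\int[mu]_x sqnorm (f x))%:E.
Proof. by move=> fi; rewrite /Rintegral fineK// integrable_fin_num. Qed.

End FiniteSums.

Section StepFunctions.
Context {R : realType}.
Local Notation leb := (@lebesgue_measure R).
Variable K : R.
Hypothesis K0 : 0 < K.

(** Clamping admits every real endpoint, so that any list of pairs (coefficient, endpoint) is a step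
    function and no side condition is carried along. *)
Definition clamp (b : R) : R := Num.max (- K) (Num.min b K).

Lemma clampP b : - K <= clamp b <= K.
Proof.
rewrite /clamp le_max lexx/= ge_max; apply/andP; split; last by rewrite ge_min lexx orbT.
by rewrite ge0_cp// ltW.
Qed.

(** With a common left end, the product of two rays is the ray of the smaller endpoint: scalar
    products become minima, and the supports are stable under intersection, as the density argument
    requires. *)
Definition ray b (x : R) : R := \1_`[- K, clamp b[ x.

Definition step (s : seq (R * R)) (x : R) : R := \sum_(p <- s) p.1 * ray p.2 x.

Lemma measurable_ray b : measurable_fun setT (ray b).
Proof. exact: measurable_indic. Qed.

Lemma ray_mul a b x : ray a x * ray b x = \1_`[- K, Num.min (clamp a) (clamp b)[ x.
Proof.
rewrite /ray !indicE -natrM mulnb; congr (_%:R); congr nat_of_bool.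
apply/idP/idP; rewrite !inE /= !in_itv/= lt_min.
  by move=> /andP[]; rewrite !inE/= !in_itv/= => /andP[-> ->] /andP[_ ->].
by move=> /andP[h /andP[h1 h2]]; rewrite !mem_set//= in_itv/= h ?h1 ?h2.
Qed.

Lemma integral_ray_mul a b :
  leb.-integrable setT (EFin \o (fun x => ray a x * ray b x)) /\
  \int[leb]_x (ray a x * ray b x) = K + Num.min (clamp a) (clamp b).
Proof.
have E : (fun x => ray a x * ray b x) = \1_`[- K, Num.min (clamp a) (clamp b)[.
  by apply/funext => x; exact: ray_mul.
rewrite E; have mu_ : leb `[- K, Num.min (clamp a) (clamp b)[%classic = (K + Num.min (clamp a) (clamp b))%:E.
  have [/andP[a1 a2] /andP[b1 b2]] := (clampP a, clampP b).
  rewrite lebesgue_measure_itv/= lte_fin; case: ltP => h.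
    by rewrite -EFinB opprK addrC.
  have h' : - K <= Num.min (clamp a) (clamp b) by rewrite le_min a1.
  have -> : Num.min (clamp a) (clamp b) = - K by apply/eqP; rewrite eq_le h h'.
  by rewrite addrN.
split.
  by apply: integrable_indic_lty; [exact: measurable_itv|exact: (le_lt_trans (le_of_eq mu_) (ltry _))].
rewrite /Rintegral integral_indic// setIT; exact: (congr1 fine mu_).
Qed.

Lemma energy_real_step s : energy leb (fun x => (step s x)%:C) =
  (\sum_(p <- s) \sum_(q <- s) p.1 * q.1 * (K + Num.min (clamp p.2) (clamp q.2)))%:E.
Proof.
have [i1 i2] := @Rintegral_double_sum _ _ _ leb _ s fst
  (fun p q x => ray p.2 x * ray q.2 x) (fun p q => (integral_ray_mul p.2 q.2).1).
have E x : sqnorm (step s x)%:C =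
    \sum_(p <- s) \sum_(q <- s) p.1 * q.1 * (ray p.2 x * ray q.2 x).
  rewrite sqnorm_real /step expr2 big_distrl/=; apply: eq_bigr => p _.
  by rewrite big_distrr/=; apply: eq_bigr => q _; rewrite mulrACA.
rewrite energy_Rintegral; last by under eq_fun do rewrite E.
under eq_Rintegral do rewrite E.
rewrite i2; congr EFin; apply: eq_bigr => p _; apply: eq_bigr => q _.
by rewrite (integral_ray_mul _ _).2.
Qed.

Lemma Rintegral_ray_FTC (f F : R -> R) b : continuous f ->
  (forall x, is_derive x (1 : R) F (f x)) ->
  \int[leb]_x (f x * ray b x) = F (clamp b) - F (- K).
Proof.
move=> cf dF; have /andP[b1 b2] := clampP b.
have -> : \int[leb]_x (f x * ray b x) = \int[leb]_(x in `[- K, clamp b[) f x.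
  rewrite [RHS]Rintegral_mkcond; apply: eq_Rintegral => x _.
  by rewrite patch_indic.
move: b1; rewrite le_eqVlt => /orP[/eqP <-|Kb].
  by rewrite subrr set_itv_ge ?Rintegral_set0// bnd_simp ltxx.
have fi : leb.-integrable `[- K, clamp b] (EFin \o f).
  apply: continuous_compact_integrable; first exact: segment_compact.
  exact: continuous_subspaceT.
rewrite Rintegral_itv_bndo_bndc; last first.
  apply: integrableS fi => //.
  by apply: subset_itvl; rewrite bnd_simp.
rewrite /Rintegral (continuous_FTC2 Kb (F := F)) ?fineK//.
- exact: continuous_subspaceT.
- have cF := continuous_is_derive dF; split.
  + by move=> x _; have [] := dF x.
  + by apply: cvg_at_right_filter; exact: cF.
  + by apply: cvg_at_left_filter; exact: cF.
- by move=> x _; rewrite derive1E; have [] := dF x.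
Qed.

Lemma FT1_ray xi b : xi != 0 -> let w := 2 * pi * xi in
  FT1 1 (fun x => (ray b x)%:C) xi =
  ((sin (w * clamp b) + sin (w * K)) / w) +i* ((cos (w * K) - cos (w * clamp b)) / w).
Proof.
move=> xi0 w; have w0 : w != 0 by rewrite /w !mulf_neq0// gt_eqF ?pi_gt0.
have ph x : 1 * (2 * pi * (xi * x)) = w * x by rewrite /w mul1r !mulrA.
have dS x : is_derive x (1 : R) (fun x => w^-1 * sin (w * x)) (cos (w * x)).
  apply: (is_derive_eq (is_derive_mul (is_derive_cst0 _ _) (is_derive_comp_mull (is_derive_sin _)))).
  by field.
have dC x : is_derive x (1 : R) (fun x => - w^-1 * cos (w * x)) (sin (w * x)).
  apply: (is_derive_eq (is_derive_mul (is_derive_cst0 _ _) (is_derive_comp_mull (is_derive_cos _)))).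
  by field.
have cc : continuous (fun x : R => cos (w * x)).
  by apply: (@continuous_is_derive _ _ (fun x => - sin (w * x) * w)) => x; apply: is_derive_comp_mull; exact: is_derive_cos.
have cs : continuous (fun x : R => sin (w * x)).
  by apply: (@continuous_is_derive _ _ (fun x => cos (w * x) * w)) => x; apply: is_derive_comp_mull; exact: is_derive_sin.
apply: complex_eq; rewrite /FT1 /cint /=.
  rewrite -[RHS]/((sin (w * clamp b) + sin (w * K)) / w).
  transitivity (\int[leb]_x (cos (w * x) * ray b x)).
    by apply: eq_Rintegral => x _; rewrite ph mulr0 subr0.
  by rewrite (Rintegral_ray_FTC _ cc dS) mulrN sinN; field.
transitivity (\int[leb]_x (sin (w * x) * ray b x)).
  by apply: eq_Rintegral => x _; rewrite ph mulr0 add0r.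
by rewrite (Rintegral_ray_FTC _ cs dC) mulrN cosN; field.
Qed.

Lemma cmeasurable_FT1 s (f : R -> R[i]) : cmeasurable f -> cmeasurable (FT1 s f).
Proof.
move=> mf.
apply: (@cmeasurable_cint1 _ _ _ _ _ leb (fun z : R * R => expi (s * (2 * pi * (z.1 * z.2))) * f z.2)).
apply: cmeasurableM.
  apply: cmeasurable_expi; apply: measurable_funM => //; apply: measurable_funM => //.
  by apply: measurable_funM; [exact: measurable_fst|exact: measurable_snd].
by split; [exact: (measurableT_comp mf.1 measurable_snd)|exact: (measurableT_comp mf.2 measurable_snd)].
Qed.

Definition ray_hat b := FT1 1 (fun x => (ray b x)%:C).

(** The real part of one transform times the conjugate of the other. With real coefficients the
    imaginary parts cancel in the double sum, so they are never integrated. *)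
Definition ray_cross a b (xi : R) : R :=
  complex.Re (ray_hat a xi) * complex.Re (ray_hat b xi) +
  complex.Im (ray_hat a xi) * complex.Im (ray_hat b xi).

(** With w = 2 pi xi, the addition formulas turn the cross term into (1 - cos w(a + K)) + (1 - cos
    w(b + K)) - (1 - cos w(a - b)), divided by w^2. Its integral is half of (a + K) + (b + K) - |a -
    b|, which is K + min a b. *)
Lemma integral_ray_cross a b :
  leb.-integrable setT (EFin \o ray_cross a b) /\
  \int[leb]_xi ray_cross a b xi = K + Num.min (clamp a) (clamp b).
Proof.
pose q (c : R) (xi : R) := (1 - cos (2 * pi * c * xi)) / xi ^+ 2.
have qi c : leb.-integrable setT (EFin \o q c).
  apply: integrableP_ge0; first exact: measurable_one_sub_cos.
    by move=> x; rewrite divr_ge0 ?sqr_ge0// subr_ge0 cos_le1.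
  by rewrite integral_one_sub_cos ltry.
have qE c : \int[leb]_xi q c xi = 2 * pi ^+ 2 * `|c|.
  rewrite /Rintegral integral_one_sub_cos /= normrM (@ger0_norm _ (2 * pi)) ?mulr_ge0 ?pi_ge0//.
  by ring.
pose h xi := (4 * pi ^+ 2)^-1 * (q (clamp a + K) xi + q (clamp b + K) xi - q (clamp a - clamp b) xi).
have hi : leb.-integrable setT (EFin \o h).
  by apply: integrable_mulrl; apply: integrable_subr => //; exact: integrable_addr.
have hE : \int[leb]_xi h xi = K + Num.min (clamp a) (clamp b).
  rewrite RintegralZl//; last by apply: integrable_subr => //; exact: integrable_addr.
  rewrite RintegralB//; last exact: integrable_addr.
  rewrite RintegralD// !qE.
  have [/andP[a1 a2] /andP[b1 b2]] := (clampP a, clampP b).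
  rewrite (@ger0_norm _ (clamp a + K)); last lra.
  rewrite (@ger0_norm _ (clamp b + K)); last lra.
  have pi0 : pi != 0 :> R by rewrite gt_eqF// pi_gt0.
  have -> : `|clamp a - clamp b| = clamp a + clamp b - 2 * Num.min (clamp a) (clamp b).
    case: (lerP (clamp a) (clamp b)) => ab.
      by ring.
    by ring.
  have alg (p u v m : R) : p != 0 -> (4 * p ^+ 2)^-1 *
      (2 * p ^+ 2 * (u + K) + 2 * p ^+ 2 * (v + K) - 2 * p ^+ 2 * (u + v - 2 * m)) = K + m.
    by move=> p0; field.
  exact: alg.
rewrite -hE; apply: ae_eq_integrable => //.
  have mr c : cmeasurable (ray_hat c).
    by apply: cmeasurable_FT1; apply: cmeasurable_real; exact: measurable_ray.
  have [[a1 a2] [b1 b2]] := (mr a, mr b).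
  exact: (measurable_funD (measurable_funM a1 b1) (measurable_funM a2 b2)).
(* The closed form of the transforms divides by w, so the frequency 0 is set aside. *)
exists [set (0 : R)]; split; [exact: measurable_set1|exact: lebesgue_measure_set1|].
move=> xi /= H; apply: contrapT => /eqP xi0; apply: H.
rewrite /ray_cross /ray_hat !FT1_ray//=.
rewrite /h /q.
have pi0 : pi != 0 :> R by rewrite gt_eqF// pi_gt0.
set w := 2 * pi * xi.
have e1 : 2 * pi * (clamp a + K) * xi = w * clamp a + w * K by rewrite /w; ring.
have e2 : 2 * pi * (clamp b + K) * xi = w * clamp b + w * K by rewrite /w; ring.
have e3 : 2 * pi * (clamp a - clamp b) * xi = w * clamp a - w * clamp b by rewrite /w; ring.
rewrite e1 e2 e3 cosB !cosD.
have w0 : w != 0 by rewrite /w !mulf_neq0.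
have x2 (p x : R) : p != 0 -> x ^+ 2 = (2 * p * x) ^+ 2 / (4 * p ^+ 2) by move=> p0; field.
rewrite (x2 _ xi pi0) -/w.
have alg (p cK sK ca sa cb sb : R) : p != 0 -> cK ^+ 2 + sK ^+ 2 = 1 ->
    (sa + sK) / w * ((sb + sK) / w) + (cK - ca) / w * ((cK - cb) / w) =
    (4 * p ^+ 2)^-1 * ((1 - (ca * cK - sa * sK)) / (w ^+ 2 / (4 * p ^+ 2)) +
      (1 - (cb * cK - sb * sK)) / (w ^+ 2 / (4 * p ^+ 2)) -
      (1 - (ca * cb + sa * sb)) / (w ^+ 2 / (4 * p ^+ 2))).
  move=> p0 cs1.
  have -> : (1 - (ca * cK - sa * sK)) / (w ^+ 2 / (4 * p ^+ 2)) +
      (1 - (cb * cK - sb * sK)) / (w ^+ 2 / (4 * p ^+ 2)) -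
      (1 - (ca * cb + sa * sb)) / (w ^+ 2 / (4 * p ^+ 2)) =
      4 * p ^+ 2 / w ^+ 2 * (cK ^+ 2 + sK ^+ 2 - (ca * cK - sa * sK) - (cb * cK - sb * sK) + (ca * cb + sa * sb)).
    by rewrite cs1; field; rewrite w0 p0.
  by field; rewrite w0 p0.
exact: (alg _ _ _ _ _ _ _ pi0 (cos2Dsin2 _)).
Qed.

End StepFunctions.

Lemma eq_energy_sqnorm {d} {T : measurableType d} {R : realType}
    (mu : {measure set T -> \bar R}) (f g : T -> R[i]) :
  (forall x, sqnorm (f x) = sqnorm (g x)) -> energy mu f = energy mu g.
Proof. by move=> fg; apply: eq_integral => x _; rewrite fg. Qed.

(** * Plancherel on the line *)

Section Linearity.
Context {R : realType}.
Local Notation leb := (@lebesgue_measure R).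

Lemma measurable_phase1 (s xi : R) : measurable_fun setT (fun x : R => s * (2 * pi * (xi * x))).
Proof. by apply: measurable_funM => //; apply: measurable_funM => //; exact: measurable_funM. Qed.

Lemma FT1D s (f g : R -> R[i]) xi : cintegrable leb f -> cintegrable leb g ->
  FT1 s (fun x => f x + g x) xi = FT1 s f xi + FT1 s g xi.
Proof.
move=> fi gi; rewrite /FT1 -cintD; first by apply: eq_cint => x; rewrite mulrDr.
- by apply: cintegrable_expi => //; exact: measurable_phase1.
- by apply: cintegrable_expi => //; exact: measurable_phase1.
Qed.

Lemma FT1Z s (c : R[i]) (f : R -> R[i]) xi : cintegrable leb f ->
  FT1 s (fun x => c * f x) xi = c * FT1 s f xi.
Proof.
move=> fi; rewrite /FT1 -cintZ; first by apply: eq_cint => x; rewrite mulrCA.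
by apply: cintegrable_expi => //; exact: measurable_phase1.
Qed.

Lemma FT1B s (f g : R -> R[i]) xi : cintegrable leb f -> cintegrable leb g ->
  FT1 s (fun x => f x - g x) xi = FT1 s f xi - FT1 s g xi.
Proof.
move=> fi gi; rewrite /FT1 -cintB; first by apply: eq_cint => x; rewrite mulrBr.
- by apply: cintegrable_expi => //; exact: measurable_phase1.
- by apply: cintegrable_expi => //; exact: measurable_phase1.
Qed.

Lemma cintegrable_real {d} {T : measurableType d} (mu : {measure set T -> \bar R}) (h : T -> R) :
  mu.-integrable setT (EFin \o h) -> cintegrable mu (fun x => (h x)%:C).
Proof. by move=> hi; split => //=; exact: integrable0. Qed.

Lemma sqnorm_cvg (z : nat -> R[i]) (l : R[i]) (u : nat -> \bar R) :
  (forall n, 0 <= u n)%E -> u n @[n --> \oo] --> 0%E ->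
  (forall n, (sqnorm (z n - l))%:E <= u n)%E ->
  complex.Re (z n) @[n --> \oo] --> complex.Re l /\
  complex.Im (z n) @[n --> \oo] --> complex.Im l.
Proof.
move=> u0 /cvge0P => /(_ u0) uc zu.
have main (p : R[i] -> R) : (forall w, p w ^+ 2 <= sqnorm w) -> (forall w w', p (w - w') = p w - p w') ->
    p (z n) @[n --> \oo] --> p l.
  move=> p2 pB; apply/cvgrPdist_le => e e0.
  have e2 : 0 < e ^+ 2 by rewrite exprn_gt0.
  apply: filterS (uc _ e2) => n un.
  have h : `|p (z n - l)| ^+ 2 <= e ^+ 2.
    by rewrite real_normK ?num_real// (le_trans (p2 _))// -lee_fin (le_trans (zu n)).
  by rewrite distrC -pB -(ler_pXn2r (ltn0Sn 1)) ?nnegrE// ltW.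
split; apply: main => w; rewrite /sqnorm ?lerDl ?lerDr ?sqr_ge0// => w'.
  by rewrite cReD cReN.
by rewrite cImD cImN.
Qed.

Lemma sqnorm_FT1_le (K s : R) (f : R -> R[i]) xi : 0 < K -> cmeasurable f ->
  (forall x, ~ `[- K, K]%classic x -> f x = 0) ->
  ((sqnorm (FT1 s f xi))%:E <= (2 * K)%:E * energy leb f)%E.
Proof.
move=> K0 mf f0; rewrite -(energy_expi leb (fun x => s * (2 * pi * (xi * x)))).
have mD : measurable (`[- K, K]%classic : set (measurableTypeR R)) by exact: measurable_itv.
apply: (sqnorm_cint_le mD).
- apply: (le_trans (le_of_eq (lebesgue_measure_itv `[- K, K]))) => /=.
  by case: ifP => _; rewrite -?EFinB lee_fin; lra.
- lra.
- apply: cmeasurableM => //; apply: cmeasurable_expi; exact: measurable_phase1.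
- by move=> x /f0 ->; rewrite mulr0.
Qed.

Lemma supported_cintegrable (K : R) (f : R -> R[i]) : cmeasurable f ->
  (forall x, ~ `[- K, K]%classic x -> f x = 0) -> (energy leb f < +oo)%E ->
  cintegrable leb f.
Proof.
move=> mf f0 fy.
have mD : measurable (`[- K, K]%classic : set (measurableTypeR R)) by exact: measurable_itv.
apply: (cintegrable_energy mD) => //.
apply: (le_lt_trans (le_of_eq (lebesgue_measure_itv `[- K, K]))) => /=.
by case: ifP => _; rewrite -?EFinB ltry.
Qed.

Lemma lee_quarters (a b : \bar R) (e : R) : (a <= (e / 4)%:E)%E -> (b <= (e / 4)%:E)%E ->
  (2%:E * a + 2%:E * b <= e%:E)%E.
Proof.
move=> ae be; apply: (@le_trans _ _ (2%:E * (e / 4)%:E + 2%:E * (e / 4)%:E)%E).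
  by rewrite leeD// lee_wpmul2l.
by rewrite -!EFinM -EFinD lee_fin; lra.
Qed.

(* By Fatou the isometry passes to limits in the mean, because convergence in
   the mean on a bounded set forces pointwise convergence of the transforms. *)
Lemma FT1_isometry_lim (K s : R) (f : R -> R[i]) (g : nat -> R -> R[i]) : 0 < K ->
  cmeasurable f -> (forall x, ~ `[- K, K]%classic x -> f x = 0) -> (energy leb f < +oo)%E ->
  (forall n, cmeasurable (g n)) -> (forall n x, ~ `[- K, K]%classic x -> g n x = 0) ->
  (forall n, energy leb (g n) < +oo)%E ->
  (forall n, energy leb (FT1 s (g n)) = energy leb (g n)) ->
  (forall n m, energy leb (FT1 s (fun x => g n x - g m x)) = energy leb (fun x => g n x - g m x)) ->
  energy leb (fun x => g n x - f x) @[n --> \oo] --> 0%E ->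
  energy leb (FT1 s f) = energy leb f.
Proof.
move=> K0 mf f0 fy mg g0 gy iso isoB gf.
have fi := supported_cintegrable mf f0 fy.
have gi n := supported_cintegrable (mg n) (g0 n) (gy n).
have mFf := cmeasurable_FT1 s mf.
have mFg n := cmeasurable_FT1 s (mg n).
have ptw xi : complex.Re (FT1 s (g n) xi) @[n --> \oo] --> complex.Re (FT1 s f xi) /\
    complex.Im (FT1 s (g n) xi) @[n --> \oo] --> complex.Im (FT1 s f xi).
  apply: (@sqnorm_cvg _ _ (fun n => (2 * K)%:E * energy leb (fun x => g n x - f x)%R)%E).
  - by move=> n; rewrite mule_ge0 ?energy_ge0// lee_fin; lra.
  - rewrite -[X in _ --> X](mule0 (2 * K)%:E); exact: cvgeZl.
  - move=> n; rewrite -FT1B//; apply: sqnorm_FT1_le => //.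
      exact: cmeasurableB.
    by move=> x nx; rewrite f0 ?g0// subrr.
move/cvge0P: (gf) => /(_ (fun n => energy_ge0 leb _)) gf'.
have Fgf : energy leb (fun x => FT1 s (g n) x - FT1 s f x) @[n --> \oo] --> 0%E.
  apply/cvge0P => [n|e e0]; first exact: energy_ge0.
  have e4 : 0 < e / 4 by rewrite divr_gt0.
  apply: filterS (gf' _ e4) => n gn.
  apply: (@energy_fatou _ _ _ leb (fun m x => FT1 s (g n) x - FT1 s (g m) x)).
  - by move=> m; exact: (cmeasurableB (mFg n) (mFg m)).
  - exact: (cmeasurableB (mFg n) mFf).
  - apply/nearW => x; have [c1 c2] := ptw x; split.
      under eq_fun do rewrite cReD cReN; rewrite cReD cReN.
      by apply: cvgB => //; exact: cvg_cst.
    under eq_fun do rewrite cImD cImN; rewrite cImD cImN.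
    by apply: cvgB => //; exact: cvg_cst.
  - apply: filterS (gf' _ e4) => m gm.
    rewrite [X in (X <= _)%E](_ : _ = energy leb (FT1 s (fun x => g n x - g m x))); last first.
      by apply: eq_energy => x; rewrite FT1B.
    rewrite isoB.
    have := energyB_le2 leb (cmeasurableB (mg n) mf) (cmeasurableB (mg m) mf).
    rewrite [X in (X <= _)%E -> _](_ : _ = energy leb (fun x => g n x - g m x)); last first.
      by apply: eq_energy => x; rewrite opprB addrA subrK.
    move=> /le_trans; apply.
    exact: lee_quarters.
have Fy : (energy leb (FT1 s f) < +oo)%E.
  have [N _ HN] := @cvge0_ltpinfty _ _ _ _ _ (fun n => energy_ge0 leb (fun x => FT1 s (g n) x - FT1 s f x)) Fgf.
  have gNy : (energy leb (FT1 s (g N)) < +oo)%E by rewrite iso.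
  have := @energyB_lty _ _ _ leb _ _ (mFg N) (cmeasurableB (mFg N) mFf) gNy (HN N (leqnn N)).
  rewrite [X in (X < _)%E -> _](_ : _ = energy leb (FT1 s f))//.
  by apply: eq_energy => x; rewrite opprB addrC subrK.
have c1 := @energy_cvg _ _ _ leb nat \oo _ _ _ mFg mFf Fy Fgf.
have c2 := @energy_cvg _ _ _ leb nat \oo _ _ _ mg mf fy gf.
apply: (cvg_unique _ _ (c2 _)) => //.
have E : (fun i : nat => energy leb (g i)) = (fun i => energy leb (FT1 s (g i))).
  by apply/funext => i; rewrite iso.
by rewrite /= E; exact: (c1 _).
Qed.

End Linearity.

(** * Density of step functions on a bounded interval *)

Section Density.
Context {R : realType}.
Local Notation leb := (@lebesgue_measure R).
Variable K : R.
Hypothesis K0 : 0 < K.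

Local Notation Q := (`[- K, K[%classic : set R).
Local Notation stepc s := (fun x => (step K s x)%:C).

Lemma measurable_step s : measurable_fun setT (step K s).
Proof.
apply: (@measurable_sum _ _ _ setT _ _ (fun p x => p.1 * ray K p.2 x)) => p.
by apply: measurable_funM => //; exact: measurable_ray.
Qed.

Lemma integrable_ray b : leb.-integrable setT (EFin \o ray K b).
Proof.
have := (integral_ray_mul K0 b b).1; congr (_.-integrable _ _).
by apply/funext => x /=; rewrite ray_mul minxx.
Qed.

Lemma FT1_step s xi :
  complex.Re (FT1 1 (stepc s) xi) = \sum_(p <- s) p.1 * complex.Re (ray_hat K p.2 xi) /\
  complex.Im (FT1 1 (stepc s) xi) = \sum_(p <- s) p.1 * complex.Im (ray_hat K p.2 xi).
Proof.
have rint p := cintegrable_real (integrable_mulrl p.1 (integrable_ray p.2)).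
have sint t : cintegrable leb (stepc t).
  apply: cintegrable_real.
  exact: (Rintegral_sum t (fun p : R * R => integrable_mulrl p.1 (integrable_ray p.2))).1.
elim: s => [|p s [ih1 ih2]].
  have -> : FT1 1 (stepc [::]) xi = 0.
    by apply: cint0 => x; rewrite /step big_nil mulr0.
  by rewrite !big_nil.
have -> : FT1 1 (stepc (p :: s)) xi = (p.1)%:C * ray_hat K p.2 xi + FT1 1 (stepc s) xi.
  rewrite /ray_hat -FT1Z; last by apply: cintegrable_real; exact: integrable_ray.
  rewrite -FT1D//.
    apply: eq_cint => x; congr (_ * _); rewrite /step big_cons.
    by apply: complex_eq; rewrite !cReImE/=; ring.
  have := rint p; congr (cintegrable leb); apply/funext => x.
  by apply: complex_eq; rewrite !cReImE/=; ring.
by rewrite !cReImE ih1 ih2 !big_cons /=; split; ring.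
Qed.

Lemma sum_sqrD (I : Type) (s : seq I) (c u v : I -> R) :
  (\sum_(i <- s) c i * u i) ^+ 2 + (\sum_(i <- s) c i * v i) ^+ 2 =
  \sum_(i <- s) \sum_(j <- s) c i * c j * (u i * u j + v i * v j).
Proof.
rewrite !expr2 !big_distrl -big_split/=; apply: eq_bigr => i _.
by rewrite !big_distrr -big_split/=; apply: eq_bigr => j _; ring.
Qed.

(** Rays and their transforms have the same Gram matrix, so both sides are the same quadratic form
    in the coefficients. *)
Lemma energy_FT1_step s : energy leb (FT1 1 (stepc s)) = energy leb (stepc s).
Proof.
rewrite energy_real_step//.
have [i1 i2] := @Rintegral_double_sum _ _ _ leb _ s fst
  (fun p q xi => ray_cross K p.2 q.2 xi) (fun p q => (integral_ray_cross K0 p.2 q.2).1).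
have E xi : sqnorm (FT1 1 (stepc s) xi) =
    \sum_(p <- s) \sum_(q <- s) p.1 * q.1 * ray_cross K p.2 q.2 xi.
  rewrite /sqnorm; have [-> ->] := FT1_step s xi.
  exact: sum_sqrD.
rewrite energy_Rintegral; last by under eq_fun do rewrite E.
under eq_Rintegral do rewrite E.
rewrite i2; congr EFin; apply: eq_bigr => p _; apply: eq_bigr => q _.
by rewrite (integral_ray_cross K0 _ _).2.
Qed.

Definition step_approx (h : R -> R) := forall e : R, 0 < e ->
  exists s, (energy leb (fun x => (h x - step K s x)%:C) <= e%:E)%E.

Lemma step_approxD h1 h2 : measurable_fun setT h1 -> measurable_fun setT h2 ->
  step_approx h1 -> step_approx h2 -> step_approx (fun x => h1 x + h2 x).
Proof.
move=> m1 m2 a1 a2 e e0; have e4 : 0 < e / 4 by rewrite divr_gt0.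
have [s1 H1] := a1 _ e4; have [s2 H2] := a2 _ e4; exists (s1 ++ s2).
have c1 : cmeasurable (fun x => (h1 x - step K s1 x)%:C).
  by apply: cmeasurable_real; apply: measurable_funB => //; exact: measurable_step.
have c2 : cmeasurable (fun x => (h2 x - step K s2 x)%:C).
  by apply: cmeasurable_real; apply: measurable_funB => //; exact: measurable_step.
have := energyD_le2 leb c1 c2.
rewrite [X in (X <= _)%E -> _](_ : _ = energy leb (fun x => (h1 x + h2 x - step K (s1 ++ s2) x)%:C)); last first.
  by apply: eq_energy => x; rewrite /step big_cat/=; apply: complex_eq; rewrite !cReImE/=; ring.
move=> /le_trans; apply.
exact: lee_quarters.
Qed.

Lemma step_approxZ c h : measurable_fun setT h ->
  step_approx h -> step_approx (fun x => c * h x).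
Proof.
move=> mh ah e e0.
have e1 : 0 < e / (c ^+ 2 + 1) by rewrite divr_gt0// ltr_wpDl// sqr_ge0.
have [s Hs] := ah _ e1; exists [seq (c * p.1, p.2) | p <- s].
rewrite [X in (X <= _)%E](_ : _ = energy leb (fun x => c%:C * (h x - step K s x)%:C)); last first.
  apply: eq_energy => x; rewrite /step big_map/=.
  rewrite (eq_bigr (fun p => c * (p.1 * ray K p.2 x))); last by move=> p _; rewrite mulrA.
  by rewrite -big_distrr/=; apply: complex_eq; rewrite !cReImE/=; ring.
rewrite energyZ; last by apply: cmeasurable_real; apply: measurable_funB => //; exact: measurable_step.
rewrite sqnorm_real.
apply: (@le_trans _ _ ((c ^+ 2)%:E * (e / (c ^+ 2 + 1))%:E)%E).
  by apply: lee_wpmul2l => //; rewrite lee_fin sqr_ge0.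
rewrite -EFinM lee_fin mulrCA; apply: ler_piMr; first exact: ltW.
by rewrite ler_pdivrMr ?mul1r ?lerDl// ltr_wpDl// sqr_ge0.
Qed.

Lemma step_approx_lim (h : R -> R) : measurable_fun setT h ->
  (forall e : R, 0 < e -> exists h' : R -> R, [/\ measurable_fun setT h', step_approx h' &
     (energy leb (fun x => (h x - h' x)%:C) <= e%:E)%E]) -> step_approx h.
Proof.
move=> mh H e e0; have e4 : 0 < e / 4 by rewrite divr_gt0.
have [h' [mh' ah' hh']] := H _ e4; have [s Hs] := ah' _ e4; exists s.
have c1 : cmeasurable (fun x => (h x - h' x)%:C).
  by apply: cmeasurable_real; exact: measurable_funB.
have c2 : cmeasurable (fun x => (h' x - step K s x)%:C).
  by apply: cmeasurable_real; apply: measurable_funB => //; exact: measurable_step.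
have := energyD_le2 leb c1 c2.
rewrite [X in (X <= _)%E -> _](_ : _ = energy leb (fun x => (h x - step K s x)%:C)); last first.
  by apply: eq_energy => x; apply: complex_eq; rewrite !cReImE/=; ring.
move=> /le_trans; apply.
exact: lee_quarters.
Qed.

Lemma step_approx_ray b : step_approx (ray K b).
Proof.
move=> e e0; exists [:: (1, b)].
rewrite [X in (X <= _)%E](_ : _ = energy leb (fun=> 0 : R[i])); last first.
  by apply: eq_energy => x; rewrite /step big_seq1 mul1r subrr.
rewrite /energy; under eq_integral do rewrite sqnorm0.
by rewrite integral0 lee_fin ltW.
Qed.

Lemma step_approx0 : step_approx (fun=> 0).
Proof.
move=> e e0; exists [::].
rewrite [X in (X <= _)%E](_ : _ = energy leb (fun=> 0 : R[i])); last first.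
  by apply: eq_energy => x; rewrite /step big_nil subrr.
rewrite /energy; under eq_integral do rewrite sqnorm0.
by rewrite integral0 lee_fin ltW.
Qed.

Lemma energy_dominated (h : R -> R) (hs : nat -> R -> R) (g : R -> R) :
  measurable_fun setT h -> (forall n, measurable_fun setT (hs n)) ->
  (forall x, hs n x @[n --> \oo] --> h x) ->
  (forall n x, `|h x - hs n x| <= g x) -> leb.-integrable setT (EFin \o (fun x => g x ^+ 2)) ->
  energy leb (fun x => (h x - hs n x)%:C) @[n --> \oo] --> 0%E.
Proof.
move=> mh mhs hsh hg gi.
have := @dominated_convergence _ _ _ leb setT measurableT
  (fun n x => ((h x - hs n x) ^+ 2)%:E) (cst 0%E) (EFin \o (fun x => g x ^+ 2)).
case.
- by move=> n; apply/measurable_EFinP; exact: (measurable_funX 2 (measurable_funB mh (mhs n))).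
- exact: measurable_cst.
- apply/nearW => x _; apply: cvg_EFin; first exact: nearW.
  rewrite (_ : 0 = (h x - h x) ^+ 2); last by rewrite subrr expr0n.
  have c : h x - hs n x @[n --> \oo] --> h x - h x by apply: cvgB => //; exact: cvg_cst.
  by under eq_fun do rewrite expr2; rewrite expr2; exact: cvgM.
- exact: gi.
- apply/nearW => x n _ /=; rewrite lee_fin ger0_norm ?sqr_ge0//.
  by rewrite -real_normK ?num_real// ler_sqr ?nnegrE// (le_trans _ (hg n x)).
move=> _ _; rewrite integral_cst// mul0e => H.
have -> : (fun n => energy leb (fun x => (h x - hs n x)%:C)) =
    (fun n => (\int[leb]_x ((h x - hs n x) ^+ 2)%:E)%E); last exact: H.
by apply/funext => n; apply: eq_integral => x _; rewrite sqnorm_real.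
Qed.

Lemma integrable_indicQ : leb.-integrable setT (EFin \o (\1_Q : R -> R)).
Proof.
apply: integrable_indic_lty; first exact: measurable_itv.
apply: (le_lt_trans (le_of_eq (lebesgue_measure_itv `[- K, K[))) => /=.
by case: ifP => _; rewrite -?EFinB ltry.
Qed.

(** Dynkin's pi-lambda theorem, started from the open half-lines unbounded below, which cut [Q] in
    rays. Complements are taken relative to [Q], whose indicator is itself a ray, and countable
    disjoint unions are limits of finite ones by dominated convergence, with the indicator of [Q] as
    bound. *)
Lemma step_approx_indic (A : set (measurableTypeR R)) : measurable A ->
  step_approx (\1_(A `&` Q)).
Proof.
have mI (B : set (measurableTypeR R)) : measurable B -> measurable_fun setT (\1_(B `&` Q) : R -> R).
  by move=> mB; apply: measurable_indic; apply: measurableI => //; exact: measurable_itv.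
have KK : clamp K K = K by rewrite /clamp minxx; rewrite maxEle ifT// (@le_trans _ _ 0) ?oppr_le0 ?ltW.
have QE : (\1_Q : R -> R) = ray K K by apply/funext => x; rewrite /ray KK.
move=> mA; have : <<s @RGenInftyO.G R >> A.
  exact: (eq_ind _ (fun X : Prop => X) mA _ (congr1 (fun M => M A) (RGenInftyO.measurableE R))).
apply: (dynkin_induction (G := @RGenInftyO.G R) (P := fun A : set (measurableTypeR R) => step_approx (\1_(A `&` Q)))).
- exact: RGenInftyO.measurableE.
- move=> _ _ [a ->] [b ->]; exists (Num.min a b).
  by apply/seteqP; split=> x /=; rewrite !in_itv/= lt_min => /andP.
- by rewrite setTI QE; exact: step_approx_ray.
- move=> _ [b ->]; rewrite (_ : \1_ _ = ray K b); first exact: step_approx_ray.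
  apply/funext => x; rewrite /ray; congr (\1_ _ x); apply/seteqP; split=> y /=; rewrite !in_itv/= /clamp.
    by move=> [yb /andP[h1 h2]]; rewrite h1/= lt_max lt_min yb h2 orbT.
  rewrite lt_max lt_min => /andP[h1]; rewrite ltNge h1/= => /andP[h2 h3].
  by split.
- move=> S mS aS.
  rewrite (_ : \1_ _ = fun x => \1_Q x + (- 1) * \1_(S `&` Q) x).
    apply: step_approxD => //.
    + by apply: measurable_funM => //; exact: mI.
    + by rewrite QE; exact: step_approx_ray.
    + by apply: step_approxZ => //; exact: mI.
  apply/funext => x; rewrite !indicE !in_setI in_setC.
  by case: (x \in S); case: (x \in Q) => /=; ring.
- move=> F mF tF aF.
  have mU : measurable (\bigcup_k F k) by exact: bigcup_measurable.
  pose U n := \big[setU/set0]_(i < n) F i.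
  have mUn n : measurable (U n) by exact: bigsetU_measurable.
  have aU n : step_approx (\1_(U n `&` Q)).
    elim: n => [|n ih].
      rewrite /U big_ord0 set0I indic0; exact: step_approx0.
    rewrite (_ : \1_ _ = fun x => \1_(U n `&` Q) x + \1_(F n `&` Q) x).
      exact: (step_approxD (mI _ (mUn n)) (mI _ (mF n)) ih (aF n)).
    apply/funext => x; rewrite /U big_ord_recr/= -/(U n) !indicE !in_setI in_setU.
    have : ~ (x \in U n /\ x \in F n).
      rewrite !inE /U => -[]; rewrite -bigcup_mkord => -[i /= ilt Fi] Fn.
      have := tF i n I I; rewrite /= => H; have iN : i = n by apply: H; exists x.
      by move: ilt; rewrite iN ltnn.
    by case: (x \in U n); case: (x \in F n); case: (x \in Q) => //= H; rewrite ?addr0 ?add0r//; case: H.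
  apply: step_approx_lim; first exact: mI.
  move=> e e0.
  have hc x : (\1_(U n `&` Q) x : R) @[n --> \oo] --> (\1_((\bigcup_k F k) `&` Q) x : R).
    apply: cvg_near_cst.
    have [[k _ Fk]|nU] := pselect ((\bigcup_k F k) x).
      exists k.+1 => // n /= kn; rewrite !indicE !in_setI; congr (_ && _)%:R.
      rewrite !mem_set//; first by exists k.
      by rewrite /U -bigcup_mkord; exists k.
    apply: nearW => n; rewrite !indicE !in_setI.
    have -> : (x \in U n) = false.
      by apply: memNset; rewrite /U -bigcup_mkord => -[i _ Fi]; apply: nU; exists i.
    by have -> : (x \in \bigcup_k F k) = false by exact: memNset.
  have hb n x : `|\1_((\bigcup_k F k) `&` Q) x - \1_(U n `&` Q) x : R| <= \1_Q x.
    rewrite !indicE !in_setI.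
    case: (x \in Q); rewrite ?andbF ?subr0 ?normr0// !andbT.
    by case: (x \in _); case: (x \in _); rewrite /= ?subrr ?subr0 ?sub0r ?normrN ?normr1 ?normr0.
  have hi : leb.-integrable setT (EFin \o (fun x => (\1_Q x : R) ^+ 2)).
    have := integrable_indicQ; congr (_.-integrable _ _); apply/funext => x /=.
    by rewrite indicE; case: (x \in Q); rewrite ?expr1n ?expr0n.
  have := energy_dominated (mI _ mU) (fun n => mI _ (mUn n)) hc hb hi.
  move=> /cvge0P => /(_ (fun n => energy_ge0 leb _) e e0) [n _ /(_ n (leqnn n)) Hn].
  by exists (\1_(U n `&` Q)); split; [exact: (mI _ (mUn n))|exact: aU|exact: Hn].
Qed.

Lemma step_approx_eq (h1 h2 : R -> R) : h1 =1 h2 -> step_approx h1 -> step_approx h2.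
Proof. by move=> /funext ->. Qed.

Import HBNNSimple.

Lemma step_approx_ge0 (h : R -> R) : measurable_fun setT h -> (forall x, 0 <= h x) ->
  (forall x, ~ Q x -> h x = 0) -> (\int[leb]_x (h x ^+ 2)%:E < +oo)%E -> step_approx h.
Proof.
move=> mh h0 hQ hy.
have meh : measurable_fun setT (EFin \o h : measurableTypeR R -> \bar R) by exact/measurable_EFinP.
have [g [gnd gh]] := approximation measurableT meh (fun x _ => h0 x).
have g0 n x : 0 <= g n x by exact: fun_ge0.
have ghR x : g n x @[n --> \oo] --> h x.
  by have /fine_cvgP[_] := gh x I.
have gle n x : g n x <= h x.
  rewrite -(cvg_lim _ (ghR x))//; apply: nondecreasing_cvgn_le.
    by move=> i j ij; exact/lefP/gnd.
  by apply/cvg_ex; exists (h x).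
have mg n : measurable_fun setT (g n) by [].
have ag n : step_approx (g n).
  (* The level sets are cut by [Q] in order to be approximable. This changes nothing in the sum,
     since 0 <= g n <= h forces [g n] to vanish off [Q]. *)
  pose G y (x : R) : R := y * \1_((g n @^-1` [set y]) `&` Q) x.
  have mG y : measurable_fun setT (G y).
    apply: measurable_funM => //; apply: measurable_indic; apply: measurableI => //.
    by rewrite -[X in measurable X]setTI; exact: mg.
  have aG y : step_approx (G y).
    apply: step_approxZ; first by apply: measurable_indic; apply: measurableI; [rewrite -[X in measurable X]setTI; exact: mg|exact: measurable_itv].
    by apply: step_approx_indic; rewrite -[X in measurable X]setTI; exact: mg.
  apply: (@step_approx_eq (fun x => \sum_(y <- finmap.enum_fset (fset_set (range (g n)))) G y x)).
    move=> x; rewrite [RHS]fimfunE fsbig_finite//=; apply: eq_bigr => y _.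
    rewrite /G indicE in_setI indicE.
    have [xQ|xQ] := boolP (x \in Q); first by rewrite andbT.
    rewrite andbF mulr0; have gx : g n x = 0.
      apply/eqP; rewrite eq_le g0 andbT (le_trans (gle n x))// hQ//.
      by move: xQ; rewrite notin_setE.
    have [xy|_] := boolP (x \in g n @^-1` [set y]); last by rewrite mulr0.
    by move: xy; rewrite inE /= gx => <-; rewrite mul0r.
  elim: (finmap.enum_fset _) => [|y s ih].
    by apply: (step_approx_eq _ step_approx0) => x; rewrite big_nil.
  apply: (@step_approx_eq (fun x => G y x + \sum_(z <- s) G z x)).
    by move=> x; rewrite big_cons.
  apply: step_approxD => //.
  by apply: (@measurable_sum _ _ _ setT _ _ G).
apply: step_approx_lim => // e e0.
have hb n x : `|h x - g n x| <= h x.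
  by rewrite ger0_norm ?subr_ge0// lerBlDr lerDl.
have hi : leb.-integrable setT (EFin \o (fun x => h x ^+ 2)).
  by apply: integrableP_ge0 => [|x|//]; [exact: measurable_funX|exact: sqr_ge0].
have /cvge0P := energy_dominated mh mg ghR hb hi.
move=> /(_ (fun n => energy_ge0 leb _) e e0) [n _ /(_ n (leqnn n)) Hn].
by exists (g n); split; [exact: mg|exact: ag|exact: Hn].
Qed.

Lemma step_approx_supported (h : R -> R) : measurable_fun setT h ->
  (forall x, ~ Q x -> h x = 0) -> (\int[leb]_x (h x ^+ 2)%:E < +oo)%E -> step_approx h.
Proof.
move=> mh hQ hy.
have part (p : R -> R) : measurable_fun setT p -> (forall x, 0 <= p x <= `|h x|) ->
    step_approx p.
  move=> mp ph; apply: step_approx_ge0 => //.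
  - by move=> x; have /andP[] := ph x.
  - move=> x /hQ hx; have := ph x; rewrite hx normr0 => p0.
    by apply/eqP; rewrite eq_le andbC.
  - apply: le_lt_trans hy; apply: ge0_le_integral => //.
    + by move=> x _; rewrite lee_fin sqr_ge0.
    + by apply/measurable_EFinP; exact: (measurable_funX 2 mp).
    + by apply/measurable_EFinP; exact: (measurable_funX 2 mh).
    + move=> x _; have /andP[p0 pl] := ph x.
      by rewrite lee_fin -(real_normK (num_real (h x))) ler_sqr ?nnegrE// (le_trans p0).
have mN : measurable_fun setT (fun x => `|h x|) by exact: measurableT_comp.
apply: (@step_approx_eq (fun x => (`|h x| + h x) / 2 + -1 * ((`|h x| - h x) / 2))).
  by move=> x; field.
have m1 : measurable_fun setT (fun x => (`|h x| + h x) / 2).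
  by apply: measurable_funM => //; exact: measurable_funD.
have m2 : measurable_fun setT (fun x => (`|h x| - h x) / 2).
  by apply: measurable_funM => //; exact: measurable_funB.
apply: step_approxD => //; first by apply: measurable_funM.
  apply: part => // x; have := ler_norm (h x); have := ler_norm (- h x).
  by rewrite normrN; lra.
apply: step_approxZ => //.
apply: part => // x; have := ler_norm (h x); have := ler_norm (- h x).
by rewrite normrN; lra.
Qed.

End Density.

(** * The isometry for functions of bounded support on the line *)

Section Plancherel1.
Context {R : realType}.
Local Notation leb := (@lebesgue_measure R).

Lemma FT1_isometry_real (k : nat) (h : R -> R) : measurable_fun setT h ->
  (forall x, k%:R < `|x| -> h x = 0) -> (energy leb (fun x => (h x)%:C) < +oo)%E ->
  energy leb (FT1 1 (fun x => (h x)%:C)) = energy leb (fun x => (h x)%:C).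
Proof.
(* The rays are open on the right, so [K] must exceed k for the point k to be covered; k + 1 is also
   positive when k = 0. *)
move=> mh h0 hy; pose K : R := k.+1%:R.
have K0 : 0 < K by rewrite ltr0n.
have far (x : R) : ~ `[- K, K[%classic x -> k%:R < `|x|.
  rewrite /= in_itv/= => /negP; rewrite negb_and -!ltNge -leNgt => /orP[] H.
    rewrite lter_normr; apply/orP; right; rewrite ltrNr (lt_trans H)// ltrN2.
    by rewrite ltr_nat.
  by rewrite (lt_le_trans _ (ler_norm _))// (lt_le_trans _ H)// ltr_nat.
have hy2 : (\int[leb]_x (h x ^+ 2)%:E < +oo)%E.
  by under eq_integral do rewrite -sqnorm_real.
have ah := step_approx_supported K0 mh (fun x nx => h0 x (far x nx)) hy2.
have /choice[s Hs] : forall n : nat, exists s,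
    (energy leb (fun x => (h x - step K s x)%:C) <= (n.+1%:R^-1)%:E)%E.
  by move=> n; apply: ah; rewrite invr_gt0.
have stepK t x : ~ `[- K, K]%classic x -> (step K t x)%:C = 0.
  move=> nx; rewrite /step big1// => p _; rewrite /ray indicE memNset ?mulr0//.
  move=> H; apply: nx; move: H; rewrite /= !in_itv/= => /andP[-> xc]/=.
  by rewrite ltW// (lt_le_trans xc)//; have /andP[] := clampP K0 p.2.
(* The isometry is needed for differences too, to make the transforms Cauchy. Appending the second
   list with negated coefficients keeps them step functions. *)
have stepB t u x : (step K t x)%:C - (step K u x)%:C =
    (step K (t ++ [seq (- p.1, p.2) | p <- u]) x)%:C.
  rewrite /step big_cat big_map /=.
  have -> : \sum_(p <- u) - p.1 * ray K p.2 x = - \sum_(p <- u) p.1 * ray K p.2 x.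
    by rewrite -sumrN; apply: eq_bigr => p _; rewrite mulNr.
  by apply: complex_eq; rewrite !cReImE/= ?subr0.
have ms t : cmeasurable (fun x => (step K t x)%:C).
  by apply: cmeasurable_real; exact: measurable_step.
apply: (@FT1_isometry_lim _ K 1 _ (fun n x => (step K (s n) x)%:C)) => //.
- move=> x nx; rewrite h0//; apply: far => H; apply: nx; move: H.
  by rewrite /= !in_itv/= => /andP[-> /ltW ->].
- by move=> n x; exact: stepK.
- by move=> n; rewrite energy_real_step// ltry.
- by move=> n; exact: energy_FT1_step.
- move=> n m.
  have -> : (fun x => (step K (s n) x)%:C - (step K (s m) x)%:C) =
      (fun x => (step K (s n ++ [seq (- p.1, p.2) | p <- s m]) x)%:C).
    by apply/funext => x; exact: stepB.
  exact: energy_FT1_step.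
- apply/cvge0P => [n|e e0]; first exact: energy_ge0.
  near=> n; rewrite energyBC.
  rewrite [X in (X <= _)%E](_ : _ = energy leb (fun x => (h x - step K (s n) x)%:C)); last first.
    by apply: eq_energy => x; apply: complex_eq; rewrite !cReImE/= ?subr0.
  rewrite (le_trans (Hs n))// lee_fin invf_ple ?posrE ?ltr0n//.
  apply: ltW; apply: (lt_trans (archi_boundP _)); first by rewrite invr_ge0 ltW.
  rewrite ltr_nat ltnS; near: n; exact: nbhs_infty_ge.
Unshelve. all: by end_near. Qed.

Lemma FT1_opp s (f : R -> R[i]) xi : FT1 (- s) f xi = FT1 s f (- xi).
Proof. by apply: eq_cint => x; congr (expi _ * _); ring. Qed.

Lemma energy_comp_opp (f : R -> R[i]) : cmeasurable f ->
  energy leb (fun x => f (- x)) = energy leb f.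
Proof.
move=> mf; apply: (ge0_integral_opp (f := fun x => (sqnorm (f x))%:E)).
  exact: emeasurable_sqnorm.
by move=> x; rewrite lee_fin sqnorm_ge0.
Qed.

(** Conjugating f conjugates its transform and reflects it, and neither operation changes the
    energy. *)
Lemma FT1_conj_energy (f : R -> R[i]) : cintegrable leb f ->
  energy leb (FT1 1 (fun x => (f x)^*%C)) = energy leb (FT1 1 f).
Proof.
move=> fi; rewrite -[RHS]energy_comp_opp; last first.
  by apply: cmeasurable_FT1; exact: cintegrable_cmeasurable fi.
apply: eq_energy_sqnorm => xi.
have [_ i2] : cintegrable leb (fun x => expi (1 * (2 * pi * (- xi * x))) * f x).
  by apply: cintegrable_expi => //; exact: measurable_phase1.
have -> : FT1 1 (fun x => (f x)^*%C) xi = (FT1 1 f (- xi))^*%C.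
  apply: complex_eq; rewrite /FT1 /cint /=.
    apply: eq_Rintegral => x _; rewrite !cReM /= !mulNr !mulrN cosN sinN.
    by case: (f x) => a b /=; ring.
  rewrite -mulN1r -RintegralZl//; apply: eq_Rintegral => x _.
  rewrite !cImM /= !mulNr !mulrN cosN sinN.
  by case: (f x) => a b /=; ring.
by rewrite /sqnorm; case: (FT1 _ _ _) => a b /=; rewrite sqrrN.
Qed.

Lemma plancherel1 (s : R) (k : nat) (f : R -> R[i]) : s ^+ 2 = 1 ->
  cmeasurable f -> (forall x, k%:R < `|x| -> f x = 0) ->
  (energy leb f < +oo)%E -> energy leb (FT1 s f) = energy leb f.
Proof.
(* Here s is 1 or -1, and changing its sign reflects the transform. *)
move=> s1 mf f0 fy; wlog -> : s s1 / s = 1.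
  move=> H; move: (s1) => /eqP; rewrite sqrf_eq1 => /orP[] /eqP sE; first exact: H.
  rewrite sE; under eq_energy do rewrite FT1_opp.
  rewrite energy_comp_opp; last exact: cmeasurable_FT1.
  by apply: H => //; rewrite expr1n.
have fi : cintegrable leb f.
  apply: (@supported_cintegrable _ k%:R) => // x nx; apply: f0.
  by move: nx; rewrite /= in_itv/= -ler_norml => /negP; rewrite -ltNge.
pose f1 x := complex.Re (f x); pose f2 x := complex.Im (f x).
have [m1 m2] := mf; have [i1 i2] := fi.
have c1 := cmeasurable_real m1; have c2 := cmeasurable_real m2.
have j1 := cintegrable_real i1; have j2 := cintegrable_real i2.
have Ef : energy leb f = (energy leb (fun x => (f1 x)%:C) + energy leb (fun x => (f2 x)%:C))%E.
  rewrite -ge0_integralD//; try (by move=> x _; rewrite lee_fin sqnorm_ge0);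
    try exact: emeasurable_sqnorm.
  by apply: eq_integral => x _; rewrite -EFinD !sqnorm_real.
have [y1 y2] : (energy leb (fun x => (f1 x)%:C) < +oo)%E /\ (energy leb (fun x => (f2 x)%:C) < +oo)%E.
  by move: fy; rewrite Ef; split; apply: le_lt_trans fy; rewrite ?leeDl ?leeDr ?energy_ge0.
have e1 := FT1_isometry_real (k := k) m1 (fun x kx => congr1 _ (f0 x kx)) y1.
have e2 := FT1_isometry_real (k := k) m2 (fun x kx => congr1 _ (f0 x kx)) y2.
(* With f = f1 + i f2, the transforms of f and of its conjugate are the sum and the difference of F
   f1 and i F f2. The parallelogram identity adds their energies without any cross term, and these
   two energies are equal by conjugation. *)
have P : (energy leb (FT1 1 f) + energy leb (FT1 1 f) = 2%:E * energy leb f)%E.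
  rewrite -{2}(FT1_conj_energy fi) Ef -e1 -e2 ge0_muleDr ?energy_ge0//.
  have <- : energy leb (fun xi => 'i%C * FT1 1 (fun x => (f2 x)%:C) xi) = energy leb (FT1 1 (fun x => (f2 x)%:C)).
    by apply: eq_energy_sqnorm => xi; rewrite sqnormM /sqnorm/= expr0n expr1n/= add0r mul1r.
  rewrite -energy_parallelogram; last 2 first.
  - exact: cmeasurable_FT1.
  - by apply: cmeasurableM; [exact: cmeasurable_cst|exact: cmeasurable_FT1].
  congr (_ + _)%E; apply: eq_energy => xi.
    rewrite -FT1Z// -FT1D//; last exact: cintegrableZ.
    by apply: eq_cint => x; congr (_ * _); apply: complex_eq; rewrite !cReImE/=; ring.
  rewrite -FT1Z// -FT1B//; last exact: cintegrableZ.
  apply: eq_cint => x; congr (_ * _); apply: complex_eq; rewrite !cReImE/=.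
    by rewrite /f1; case: (f x) => a b /=; ring.
  by rewrite /f2; case: (f x) => a b /=; ring.
have ff : energy leb f \is a fin_num by rewrite ge0_fin_numE// energy_ge0.
have : energy leb (FT1 1 f) \is a fin_num.
  rewrite ge0_fin_numE ?energy_ge0//; apply: (@le_lt_trans _ _ (2%:E * energy leb f)%E).
    by rewrite -P leeDl// energy_ge0.
  by rewrite lte_mul_pinfty.
move: P; rewrite -(fineK ff); case: (energy leb (FT1 1 f)) => // r P _.
by move: P; rewrite -EFinD -EFinM => -[P]; congr EFin; lra.
Qed.

End Plancherel1.

(** * Plancherel on R^N and Fourier inversion *)

Section Isometry.
Context {R : realType}.
Local Notation leb := (@lebesgue_measure R).
Local Notation lebS := lebesgueN_sigma.

(** The transform factors as a partial transform [H] in the last N variables followed by one in the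
    first. The line result is used for each frequency of the last variables, the induction
    hypothesis for almost every slice. *)
Lemma FT_isometry N s (f : RN R N -> R[i]) : s ^+ 2 = 1 ->
  cmeasurable f -> cubic f -> (energy (lebesgueN R N) f < +oo)%E ->
  energy (lebesgueN R N) (FT s f) = energy (lebesgueN R N) f.
Proof.
move=> s1; elim: N f => [|N ih] f mf [k fk] fy.
  (* In dimension 0 the space is a point, the scalar product an empty sum and the transform the
     identity. *)
  apply: eq_integral => x _; congr (sqnorm _)%:E.
  rewrite /FT /cint /Rintegral !integral_dirac//.
  - rewrite !diracT !mul1e /= /dot big_ord0 !mulr0 expi0 !mul1r (tuple0 x).
    by case: (f _).
  - by apply/measurable_EFinP; have [] := cmeasurableM (cmeasurable_phase s (@measurable_cst _ _ _ _ setT x) (@measurable_id _ _ setT)) mf.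
  - by apply/measurable_EFinP; have [] := cmeasurableM (cmeasurable_phase s (@measurable_cst _ _ _ _ setT x) (@measurable_id _ _ setT)) mf.
pose F (z : measurableTypeR R * RN R N) := f (cons_pt z).
have mF : cmeasurable F by exact: cmeasurable_cons_pt.
have EF : energy (lebesgueN R N.+1) f = energy (leb \x lebS N)%E F.
  exact: energy_cons_pt.
have F0 x y : ~ (`|x : R| <= k%:R /\ cube k y) -> F (x, y) = 0.
  by move=> H; apply: fk => /cube_cons_pt.
pose D : set (measurableTypeR R * RN R N) := [set` `[- k%:R, k%:R : R]%R] `*` cube k.
have mD : measurable D by apply: measurableX => //; exact: measurable_cube.
have Fi : cintegrable (leb \x lebS N)%E F.
  apply: (cintegrable_energy mD) => //; last by rewrite -EF.
  - have DE := product_measure1E leb (lebS N) (measurable_itv `[- k%:R, k%:R]) (measurable_cube k).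
    apply: (le_lt_trans (le_of_eq DE)) => {DE}.
    apply: lte_mul_pinfty => //; last exact: lebesgueN_cube_lty.
    exact: lebesgue_segment_fin_num.
  - by move=> [x y] H; apply: F0 => -[H1 H2]; apply: H; split => //=; rewrite in_itv/= -ler_norml.
have mEF := @measurable_energy1 _ _ _ _ _ (lebS N) F mF.
(* Tonelli yields finite energy for almost every slice only. The others may lack an integrable
   slice, so the factorisation and the induction hypothesis are used off a null set of x. *)
have aeF : {ae leb, forall x, (energy (lebS N) (fun y => F (x, y)) < +oo)%E}.
  apply: ae_integral_lty => //; first by move=> x; exact: energy_ge0.
  by rewrite -energy_tonelli1// -EF.
pose H (w : measurableTypeR R * RN R N) := FT s (fun y => F (w.1, y)) w.2.
have mH : cmeasurable H.
  apply: (@cmeasurable_FT_param R N _ _ s (fun v => F (v.1.1, v.2)) snd) => //.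
  have mp : measurable_fun setT (fun v : measurableTypeR R * RN R N * RN R N => (v.1.1, v.2)).
    by apply: measurable_fun_pair => //; exact: measurableT_comp.
  by split; [exact: (measurableT_comp mF.1 mp)|exact: (measurableT_comp mF.2 mp)].
have cubicF x : cubic (fun y => F (x, y)).
  by exists k => y ny; apply: F0 => -[].
have HE (w : measurableTypeR R * RN R N) :
    FT s f (cons_pt w) = FT1 s (fun x => H (x, w.2)) w.1.
  have mph : measurable_fun setT (fun z : measurableTypeR R * RN R N =>
      s * (2 * pi * ((w.1 : R) * (z.1 : R) + dot w.2 z.2))).
    apply: measurable_funM => //; apply: measurable_funM => //.
    apply: measurable_funD; first exact: measurable_funM.
    exact: measurable_dot.
  rewrite /FT cint_cons_pt; last by apply: cmeasurableM => //; exact: cmeasurable_phase.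
  under eq_cint do rewrite dot_cons_pt.
  rewrite -[LHS]cint_fubini1; last exact: cintegrable_expi.
  apply: ae_eq_cint.
  - apply: (@cmeasurable_cint1 _ _ _ _ _ (lebS N) (fun z => expi _ * F z)).
    by apply: cmeasurableM => //; exact: cmeasurable_expi.
  - apply: cmeasurableM; last exact: cmeasurable_slice2 mH.
    apply: cmeasurable_expi; apply: measurable_funM => //; apply: measurable_funM => //.
  - apply: filterS aeF => x xy /=; rewrite -cintZ; last first.
      apply: cintegrable_expi.
        by apply: measurable_funM => //; apply: measurable_funM => //; exact: measurable_dot.
      apply: cubic_cintegrable => //; exact: cmeasurable_slice1.
    by apply: eq_cint => y; rewrite [RHS]mulrA -expiD -!mulrDr.
have [M M0 HM] := @sqnorm_FT_le R N k.
rewrite energy_cons_pt; last exact: cmeasurable_FT.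
rewrite (eq_energy _ HE).
rewrite energy_tonelli2; last first.
  have := cmeasurable_cons_pt (cmeasurable_FT s mf).
  by congr cmeasurable; apply/funext.
under eq_integral => y _ /=.
  rewrite (plancherel1 (k := k) s1).
  over.
  - exact: cmeasurable_slice2 mH.
  - move=> x kx; rewrite /H /FT cint0// => z; rewrite F0 ?mulr0// => -[].
    by rewrite leNgt kx.
  (* The pointwise bound by [M] gives finite energy in x at every frequency y, so that the line
     result applies without exceptional frequencies. *)
  - have : (\int[leb]_x (M%:E * energy (lebS N) (fun y => F (x, y))) < +oo)%E.
      rewrite ge0_integralZl_EFin ?ltW//; last by move=> x _; exact: energy_ge0.
      by rewrite -energy_tonelli1// -EF lte_mul_pinfty// lee_fin ltW.
    apply: le_lt_trans; apply: ge0_le_integral => //.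
    + by move=> x _; rewrite lee_fin sqnorm_ge0.
    + exact: emeasurable_sqnorm (cmeasurable_slice2 y mH).
    + exact: measurable_funeM.
    + move=> x _; apply: HM; first exact: cmeasurable_slice1.
      by move=> z nz; apply: F0 => -[].
rewrite -(@energy_tonelli2 _ _ _ _ _ leb (lebS N) H)// energy_tonelli1// EF energy_tonelli1//.
apply: ge0_ae_eq_integral => //.
- exact: measurable_energy1.
- by move=> x _; exact: energy_ge0.
- by move=> x _; exact: energy_ge0.
- apply: filterS aeF => x xy _.
  exact: (ih (fun y => F (x, y)) (cmeasurable_slice1 x mF) (cubicF x) xy).
Qed.

End Isometry.

(** * The transform on L^2(R^N) and its inverse *)

Section FourierRN.
Context {R : realType} {N : nat}.
Local Notation mu := (lebesgueN R N).
Local Notation T := (RN R N).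
Implicit Types (s : R) (f g u v w : T -> R[i]).

Lemma measurable_phaseN s (xi : T) : measurable_fun setT (fun x : T => s * (2 * pi * dot xi x)).
Proof. by apply: measurable_funM => //; apply: measurable_funM => //; exact: measurable_dot. Qed.

Lemma FTD s f g xi : cintegrable mu f -> cintegrable mu g ->
  FT s (fun x => f x + g x) xi = FT s f xi + FT s g xi.
Proof.
move=> fi gi; rewrite /FT -cintD; first by apply: eq_cint => x; rewrite mulrDr.
- by apply: cintegrable_expi => //; exact: measurable_phaseN.
- by apply: cintegrable_expi => //; exact: measurable_phaseN.
Qed.

Lemma FTZ s (c : R[i]) f xi : cintegrable mu f ->
  FT s (fun x => c * f x) xi = c * FT s f xi.
Proof.
move=> fi; rewrite /FT -cintZ; first by apply: eq_cint => x; rewrite mulrCA.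
by apply: cintegrable_expi => //; exact: measurable_phaseN.
Qed.

Lemma FTB s f g xi : cintegrable mu f -> cintegrable mu g ->
  FT s (fun x => f x - g x) xi = FT s f xi - FT s g xi.
Proof.
move=> fi gi; rewrite /FT -cintB; first by apply: eq_cint => x; rewrite mulrBr.
- by apply: cintegrable_expi => //; exact: measurable_phaseN.
- by apply: cintegrable_expi => //; exact: measurable_phaseN.
Qed.

Definition cutoff (k : nat) f (x : T) : R[i] := (\1_(cube k) x)%:C * f x.

Lemma truncated_fourierE s k u : truncated_fourier s k u = FT s (cutoff k u).
Proof.
apply/funext => xi; rewrite /truncated_fourier /cintegral /FT /cint.
congr (_ +i* _); rewrite Rintegral_mkcond; apply: eq_Rintegral => x _.
  by rewrite patch_indic /cutoff mulrCA cReM /= mul0r subr0 mulrC.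
by rewrite patch_indic /cutoff mulrCA cImM /= mul0r addr0 mulrC.
Qed.

Lemma cmeasurable_cut k f : cmeasurable f -> cmeasurable (cutoff k f).
Proof.
by move=> mf; apply: cmeasurableM => //; apply: cmeasurable_real; apply: measurable_indic; exact: measurable_cube.
Qed.

Lemma cut_out k f x : ~ cube k x -> cutoff k f x = 0.
Proof. by move=> nx; rewrite /cutoff indicE memNset// mul0r. Qed.

Lemma sqnorm_cut_le k f x : sqnorm (cutoff k f x) <= sqnorm (f x).
Proof.
rewrite /cutoff sqnormM sqnorm_real indicE; case: (_ \in _) => /=.
  by rewrite expr1n mul1r.
by rewrite expr0n mul0r sqnorm_ge0.
Qed.

Lemma sqnorm_cutB_le k f x : sqnorm (cutoff k f x - f x) <= sqnorm (f x).
Proof.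
rewrite /cutoff indicE; case: (_ \in _) => /=.
  by rewrite mul1r subrr sqnorm0 sqnorm_ge0.
by rewrite mul0r sub0r sqnormN.
Qed.

Lemma energy_cut_lty k f : cmeasurable f -> (energy mu f < +oo)%E ->
  (energy mu (cutoff k f) < +oo)%E.
Proof.
move=> mf; apply: le_lt_trans; apply: le_energy => //; first exact: cmeasurable_cut.
exact: sqnorm_cut_le.
Qed.

Lemma cintegrable_cut k f : cmeasurable f -> (energy mu f < +oo)%E ->
  cintegrable mu (cutoff k f).
Proof.
move=> mf fy; apply: cubic_cintegrable; first exact: cmeasurable_cut.
  by exists k => x; exact: cut_out.
exact: energy_cut_lty.
Qed.

Lemma cut_cvg f : cmeasurable f -> (energy mu f < +oo)%E ->
  energy mu (fun x => cutoff k f x - f x) @[k --> \oo] --> 0%E.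
Proof.
move=> mf fy.
have := @dominated_convergence _ _ _ mu setT measurableT
  (fun k x => (sqnorm (cutoff k f x - f x))%:E) (cst 0%E) (fun x => (sqnorm (f x))%:E).
case.
- by move=> k; apply: emeasurable_sqnorm; apply: cmeasurableB => //; exact: cmeasurable_cut.
- exact: measurable_cst.
- apply/nearW => x _; apply: cvg_near_cst.
  have [k kx] := cube_cover x; exists k => // j /= kj; congr EFin.
  rewrite /cutoff indicE mem_set/=; first by rewrite mul1r subrr sqnorm0.
  by move=> i; rewrite (le_trans (kx i))// ler_nat.
- exact: (integrableP_ge0 (measurable_sqnorm mf) (fun x => sqnorm_ge0 _) fy).
- apply/nearW => x k _ /=; rewrite lee_fin ger0_norm ?sqnorm_ge0//.
  exact: sqnorm_cutB_le.
by move=> _ _; rewrite integral_cst// mul0e.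
Qed.

Lemma cubic_cut k f : cubic (cutoff k f).
Proof. by exists k => x; exact: cut_out. Qed.

Lemma energy_FT_cutB s j l f : s ^+ 2 = 1 -> cmeasurable f -> (energy mu f < +oo)%E ->
  energy mu (fun x => FT s (cutoff j f) x - FT s (cutoff l f) x) =
  energy mu (fun x => cutoff j f x - cutoff l f x).
Proof.
move=> s1 mf fy; have mc k := cmeasurable_cut k mf.
transitivity (energy mu (FT s (fun x => cutoff j f x - cutoff l f x))).
  by apply: eq_energy => x; rewrite FTB//; exact: cintegrable_cut.
apply: FT_isometry => //.
- exact: cmeasurableB.
- exists (maxn j l) => x nx; rewrite !cut_out ?subrr// => H; apply: nx => i.
    by rewrite (le_trans (H i))// ler_nat leq_maxr.
  by rewrite (le_trans (H i))// ler_nat leq_maxl.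
- by apply: energyB_lty => //; exact: energy_cut_lty.
Qed.

(** The counterpart of [is_fourier] for Borel f, with both sides in L^2. It is a relation because a
    limit in the mean is determined only up to a null set. *)
Definition FTlim s f v :=
  [/\ cmeasurable f, (energy mu f < +oo)%E, cmeasurable v, (energy mu v < +oo)%E &
      energy mu (fun xi => FT s (cutoff k f) xi - v xi) @[k --> \oo] --> 0%E].

Lemma energy_lim_lty (fs : nat -> T -> R[i]) f :
  (forall k, cmeasurable (fs k)) -> cmeasurable f -> (forall k, energy mu (fs k) < +oo)%E ->
  energy mu (fun x => fs k x - f x) @[k --> \oo] --> 0%E -> (energy mu f < +oo)%E.
Proof.
move=> mfs mf fsy fsf.
have [K _ HK] := cvge0_ltpinfty (fun n => energy_ge0 mu (fun x => fs n x - f x)) fsf.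
have := energyB_lty (mfs K) (cmeasurableB (mfs K) mf) (fsy K) (HK K (leqnn K)).
by under eq_energy do rewrite subKr.
Qed.

Lemma FTlim_exists s f : s ^+ 2 = 1 -> cmeasurable f -> (energy mu f < +oo)%E ->
  exists v, FTlim s f v.
Proof.
move=> s1 mf fy; have mF k := cmeasurable_FT s (cmeasurable_cut k mf).
have Fy k : (energy mu (FT s (cutoff k f)) < +oo)%E.
  rewrite FT_isometry//; [exact: energy_cut_lty|exact: cmeasurable_cut|exact: cubic_cut|exact: energy_cut_lty].
have [e e0|v mv Fv] := @energy_complete _ _ _ mu (fun k => FT s (cutoff k f)) mF.
  move/cvge0P: (cut_cvg mf fy) => /(_ (fun n => energy_ge0 mu _)) cf.
  have e4 : 0 < e / 4 by rewrite divr_gt0.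
  have [K _ HK] := cf _ e4; exists K => j l Kj Kl.
  rewrite energy_FT_cutB//.
  have := energyB_le2 mu (cmeasurableB (cmeasurable_cut j mf) mf) (cmeasurableB (cmeasurable_cut l mf) mf).
  under [X in (X <= _)%E]eq_energy do rewrite opprB addrA subrK.
  by move=> /le_trans; apply; apply: lee_quarters; [exact: HK|exact: HK].
exists v; split => //.
exact: energy_lim_lty mF mv Fy Fv.
Qed.

Lemma FTlim_isometry s f v : s ^+ 2 = 1 -> FTlim s f v -> energy mu v = energy mu f.
Proof.
move=> s1 [mf fy mv vy Fv]; have mF k := cmeasurable_FT s (cmeasurable_cut k mf).
have c1 := energy_cvg (F := \oo) mF mv vy Fv.
have c2 := energy_cvg (F := \oo) (fun k => cmeasurable_cut k mf) mf fy (cut_cvg mf fy).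
apply: (cvg_unique _ (c1 _)) => //.
have E : (fun k : nat => energy mu (FT s (cutoff k f))) = (fun k => energy mu (cutoff k f)).
  apply/funext => k; apply: FT_isometry => //; [exact: cmeasurable_cut|exact: cubic_cut|exact: energy_cut_lty].
by rewrite /= E; exact: (c2 _).
Qed.

Lemma energy_cvgD (fs gs : nat -> T -> R[i]) f g :
  (forall k, cmeasurable (fs k)) -> cmeasurable f ->
  (forall k, cmeasurable (gs k)) -> cmeasurable g ->
  energy mu (fun x => fs k x - f x) @[k --> \oo] --> 0%E ->
  energy mu (fun x => gs k x - g x) @[k --> \oo] --> 0%E ->
  energy mu (fun x => (fs k x + gs k x) - (f x + g x)) @[k --> \oo] --> 0%E.
Proof.
move=> mfs mf mgs mg cf cg.
have /(_ _) := cvge0ZD (F := \oo) (ler0n R 2) (ler0n R 2) (fun k => energy_ge0 mu (fun x => fs k x - f x))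
  (fun k => energy_ge0 mu (fun x => gs k x - g x)) cf cg.
apply: cvge0_le.
- by move=> k; exact: energy_ge0.
- by move=> k; rewrite adde_ge0// mule_ge0// ?energy_ge0.
- apply: nearW => k.
  have := energyD_le2 mu (cmeasurableB (mfs k) mf) (cmeasurableB (mgs k) mg).
  by under [X in (X <= _)%E -> _]eq_energy do rewrite addrACA -opprD.
Qed.

Lemma FTlimD s f g v w : FTlim s f v -> FTlim s g w ->
  FTlim s (fun x => f x + g x) (fun x => v x + w x).
Proof.
move=> [mf fy mv vy Fv] [mg gy mw wy Gw]; split.
- exact: cmeasurableD.
- exact: energyD_lty.
- exact: cmeasurableD.
- exact: energyD_lty.
have E : (fun k => energy mu (fun xi => FT s (cutoff k (fun x => f x + g x)) xi - (v xi + w xi))) =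
    (fun k => energy mu (fun xi => (FT s (cutoff k f) xi + FT s (cutoff k g) xi) - (v xi + w xi))).
  apply/funext => k; apply: eq_energy => xi; congr (_ - _).
  rewrite -FTD; [|exact: cintegrable_cut|exact: cintegrable_cut].
  by congr FT; apply/funext => x; rewrite /cutoff mulrDr.
by rewrite E; apply: energy_cvgD => // k; apply: cmeasurable_FT; exact: cmeasurable_cut.
Qed.

Lemma FTlimZ s c f v : FTlim s f v -> FTlim s (fun x => c * f x) (fun x => c * v x).
Proof.
move=> [mf fy mv vy Fv].
have mc h : cmeasurable h -> cmeasurable (fun x => c * h x).
  by move=> mh; apply: cmeasurableM => //; exact: cmeasurable_cst.
split; [exact: mc|exact: energyZ_lty|exact: mc|exact: energyZ_lty|].
have E : (fun k => energy mu (fun xi => FT s (cutoff k (fun x => c * f x)) xi - c * v xi)) =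
    (fun k => ((sqnorm c)%:E * energy mu (fun xi => FT s (cutoff k f) xi - v xi)%R)%E).
  apply/funext => k; rewrite -energyZ; last first.
    by apply: cmeasurableB => //; apply: cmeasurable_FT; exact: cmeasurable_cut.
  apply: eq_energy => xi; rewrite mulrBr -FTZ; last exact: cintegrable_cut.
  by congr (_ - _); congr FT; apply/funext => x; rewrite /cutoff mulrCA.
rewrite E -[X in _ --> X](mule0 (sqnorm c)%:E); exact: cvgeZl.
Qed.

Lemma FTlimB s f g v w : FTlim s f v -> FTlim s g w ->
  FTlim s (fun x => f x - g x) (fun x => v x - w x).
Proof.
move=> Fv /(FTlimZ (-1)) Gw; have := FTlimD Fv Gw.
by congr FTlim; apply/funext => x; rewrite mulN1r.
Qed.

(** The real part of the scalar product is all that the energy of a sum involves. *)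
Definition re_dot u v : R := \int[mu]_x complex.Re (u x * (v x)^*%C).

Lemma integrable_re_dot u v : cmeasurable u -> cmeasurable v ->
  (energy mu u < +oo)%E -> (energy mu v < +oo)%E ->
  mu.-integrable setT (EFin \o (fun x => complex.Re (u x * (v x)^*%C))).
Proof.
move=> [u1 u2] [v1 v2] uy vy.
have ui := integrableP_ge0 (measurable_sqnorm (conj u1 u2)) (fun x => sqnorm_ge0 _) uy.
have vi := integrableP_ge0 (measurable_sqnorm (conj v1 v2)) (fun x => sqnorm_ge0 _) vy.
have E x : complex.Re (u x * (v x)^*%C) =
    complex.Re (u x) * complex.Re (v x) + complex.Im (u x) * complex.Im (v x).
  by rewrite cReM; case: (v x) => a b /=; rewrite mulrN opprK.
apply: (integrable_le_norm _ _ (integrable_addr ui vi)).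
  by under eq_fun do rewrite E; apply: measurable_funD; exact: measurable_funM.
move=> x; rewrite E /sqnorm ler_norml.
have := sqr_ge0 (complex.Re (u x) + complex.Re (v x)).
have := sqr_ge0 (complex.Re (u x) - complex.Re (v x)).
have := sqr_ge0 (complex.Im (u x) + complex.Im (v x)).
have := sqr_ge0 (complex.Im (u x) - complex.Im (v x)).
by move=> h1 h2 h3 h4; apply/andP; split; nra.
Qed.

Lemma energyD_re_dot u v : cmeasurable u -> cmeasurable v ->
  (energy mu u < +oo)%E -> (energy mu v < +oo)%E ->
  (energy mu (fun x => u x + v x)%R = energy mu u + energy mu v + (2 * re_dot u v)%:E)%E.
Proof.
move=> mu_ mv uy vy.
have ui := integrableP_ge0 (measurable_sqnorm mu_) (fun x => sqnorm_ge0 _) uy.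
have vi := integrableP_ge0 (measurable_sqnorm mv) (fun x => sqnorm_ge0 _) vy.
have di := integrable_re_dot mu_ mv uy vy.
rewrite !energy_Rintegral//; last first.
  apply: integrableP_ge0; [exact: measurable_sqnorm (cmeasurableD mu_ mv)|by move=> x; exact: sqnorm_ge0|exact: energyD_lty].
rewrite -!EFinD /re_dot -RintegralZl// -RintegralD// -RintegralD//; last 2 first.
- exact: integrable_addr.
- exact: integrable_mulrl.
congr EFin; apply: eq_Rintegral => x _.
by rewrite /sqnorm !cReImE; case: (u x) => a b; case: (v x) => c d /=; ring.
Qed.

Lemma cint_conj {d} {U : measurableType d} (nu : {measure set U -> \bar R}) (h : U -> R[i]) :
  cintegrable nu h -> cint nu (fun x => (h x)^*%C) = (cint nu h)^*%C.
Proof.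
move=> [h1 h2]; apply: complex_eq; rewrite /cint /=.
  by apply: eq_Rintegral => x _; case: (h x).
by rewrite -mulN1r -RintegralZl//; apply: eq_Rintegral => x _; case: (h x) => a b /=; rewrite mulN1r.
Qed.

Lemma dotC (x y : T) : dot x y = dot y x.
Proof. by apply: eq_bigr => i _; rewrite mulrC. Qed.

Lemma cintegrable_conj {d} {U : measurableType d} (nu : {measure set U -> \bar R}) (h : U -> R[i]) :
  cintegrable nu h -> cintegrable nu (fun x => (h x)^*%C).
Proof.
move=> [h1 h2]; split.
  by move: h1; congr (_.-integrable _ _); apply/funext => x /=; case: (h x).
have := integrable_mulrl (-1) h2.
by congr (_.-integrable _ _); apply/funext => x /=; case: (h x) => p q /=; rewrite mulN1r.
Qed.

Lemma cmeasurable_conj {d} {U : measurableType d} (h : U -> R[i]) : cmeasurable h ->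
  cmeasurable (fun x => (h x)^*%C).
Proof.
move=> [h1 h2]; split.
  by apply: (eq_measurable_fun _ _ h1) => x _; case: (h x).
have h2' := measurable_funN h2.
by apply: (eq_measurable_fun _ _ h2') => x _ /=; case: (h x).
Qed.

(** Both sides are iterated integrals of e^(2 pi i x.y) a(x) conj b(y), integrable on the product
    because the supports are bounded. Conjugation accounts for the change of sign. *)
Lemma FT_adjoint a b : cmeasurable a -> cmeasurable b -> cubic a -> cubic b ->
  (energy mu a < +oo)%E -> (energy mu b < +oo)%E ->
  re_dot (FT 1 a) b = re_dot a (FT (-1) b).
Proof.
move=> ma mb [ka Ha] [kb Hb] ay by_.
have ai : cintegrable mu a by apply: cubic_cintegrable => //; exists ka.
have bi : cintegrable mu b by apply: cubic_cintegrable => //; exists kb.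
have mcb := cmeasurable_conj mb.
pose P : {sigma_finite_measure set T -> \bar R} := @lebesgueN_sigma R N.
pose H (z : T * T) := a z.1 * (b z.2)^*%C.
have mH : cmeasurable H.
  apply: cmeasurableM.
    by split; [exact: (measurableT_comp ma.1 measurable_fst)|exact: (measurableT_comp ma.2 measurable_fst)].
  by split; [exact: (measurableT_comp mcb.1 measurable_snd)|exact: (measurableT_comp mcb.2 measurable_snd)].
have Hi : cintegrable (P \x P)%E H.
  have mD := measurableX (@measurable_cube R N ka) (@measurable_cube R N kb).
  apply: (cintegrable_energy mD) => //.
  - have DE := product_measure1E P P (@measurable_cube R N ka) (@measurable_cube R N kb).
    apply: (le_lt_trans (le_of_eq DE)).
    apply: lte_mul_pinfty => //; last exact: lebesgueN_cube_lty.
    by rewrite ge0_fin_numE//; exact: lebesgueN_cube_lty.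
  - move=> [x y] nD; rewrite /H /=; have [xa|nxa] := pselect (cube ka x); last by rewrite Ha// mul0r.
    have [yb|nyb] := pselect (cube kb y); first by case: nD.
    by rewrite Hb// conjc0 mulr0.
  rewrite energy_tonelli1// /H.
  have Ex x : energy P (fun y => a x * (b y)^*%C) =
      ((sqnorm (a x))%:E * energy P (fun y => (b y)^*%C))%E by exact: energyZ.
  under eq_integral => x _ do rewrite /= Ex.
  rewrite ge0_integralZr//; last 3 first.
  - exact: emeasurable_sqnorm.
  - by move=> x _; rewrite lee_fin sqnorm_ge0.
  - exact: energy_ge0.
  apply: lte_mul_pinfty; [exact: energy_ge0|by rewrite ge0_fin_numE// energy_ge0|].
  rewrite (@eq_energy_sqnorm _ _ _ _ _ b)// => x.
  by case: (b x) => c d; rewrite /sqnorm/= sqrrN.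
pose G (z : T * T) := expi (1 * (2 * pi * dot z.2 z.1)) * H z.
have Gi : cintegrable (P \x P)%E G.
  apply: cintegrable_expi => //.
  by apply: measurable_funM => //; apply: measurable_funM => //; apply: measurable_dot; [exact: measurable_snd|exact: measurable_fst].
have e1 : re_dot (FT 1 a) b = complex.Re (cint P (fun y => cint P (fun x => G (x, y)))).
  transitivity (\int[mu]_y complex.Re (cint P (fun x => G (x, y)))); last exact: erefl.
  apply: eq_Rintegral => y _; apply: congr1.
  rewrite mulrC -cintZ; last by apply: cintegrable_expi => //; exact: measurable_phaseN.
  transitivity (cint mu (fun x => G (x, y))); last exact: erefl.
  by apply: eq_cint => x; exact: (etrans (mulrC _ _) (esym (mulrA _ _ _))).
have e2 : re_dot a (FT (-1) b) = complex.Re (cint P (fun x => cint P (fun y => G (x, y)))).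
  transitivity (\int[mu]_x complex.Re (cint P (fun y => G (x, y)))); last exact: erefl.
  apply: eq_Rintegral => x _; apply: congr1.
  have bei : cintegrable mu (fun y => expi (-1 * (2 * pi * dot x y)) * b y).
    by apply: cintegrable_expi => //; exact: measurable_phaseN.
  rewrite /FT -cint_conj// -cintZ; last exact: cintegrable_conj.
  transitivity (cint mu (fun y => G (x, y))); last exact: erefl.
  apply: eq_cint => y; rewrite /G /H /= dotC mulN1r mul1r.
  rewrite [RHS]mulrCA; congr (a x * _).
  by rewrite /expi cosN sinN; case: (b y) => p q; apply: complex_eq; rewrite !cReImE /=; ring.
by rewrite e1 e2 (cint_fubini1 Gi) (cint_fubini2 Gi).
Qed.

Lemma FTlim_inversion f v w : FTlim (-1) f v -> FTlim 1 v w ->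
  energy mu (fun x => w x - f x) = 0%E.
Proof.
move=> Ff Fv; have sN : (-1 : R) ^+ 2 = 1 by rewrite sqrrN expr1n.
have Ev := FTlim_isometry sN Ff; have Ew := FTlim_isometry (expr1n _ _) Fv.
move: Ff Fv => [mf fy mv vy cf] [_ _ mw wy cv].
have mc k h : cmeasurable h -> cmeasurable (cutoff k h) by exact: cmeasurable_cut.
(* For cutoffs v_k and f_k both energies expand into those of v_k and f_k, by isometry, plus twice a
   scalar product; the adjunction identifies the two scalar products. *)
have E k : energy mu (fun x => FT 1 (cutoff k v) x + cutoff k f x) =
    energy mu (fun x => cutoff k v x + FT (-1) (cutoff k f) x).
  have i1 : energy mu (FT 1 (cutoff k v)) = energy mu (cutoff k v).
    apply: FT_isometry; rewrite ?expr1n//; [exact: mc|exact: cubic_cut|exact: energy_cut_lty].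
  have i2 : energy mu (FT (-1) (cutoff k f)) = energy mu (cutoff k f).
    apply: FT_isometry => //; [exact: mc|exact: cubic_cut|exact: energy_cut_lty].
  have vky := energy_cut_lty k mv vy; have fky := energy_cut_lty k mf fy.
  have mvk := mc k _ mv; have mfk := mc k _ mf.
  rewrite energyD_re_dot ?i1//; last exact: cmeasurable_FT.
  rewrite energyD_re_dot ?i2//; last exact: cmeasurable_FT.
  by rewrite FT_adjoint//; exact: cubic_cut.
have mFv k := cmeasurable_FT 1 (mc k _ mv); have mFf k := cmeasurable_FT (-1) (mc k _ mf).
have l1 := energy_cvgD mFv mw (fun k => mc k _ mf) mf cv (cut_cvg mf fy).
have l2 := energy_cvgD (fun k => mc k _ mv) mv mFf mv (cut_cvg mv vy) cf.
have c1 := energy_cvg (F := \oo) (fun k => cmeasurableD (mFv k) (mc k _ mf)) (cmeasurableD mw mf) (energyD_lty mw mf wy fy) l1.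
have c2 := energy_cvg (F := \oo) (fun k => cmeasurableD (mc k _ mv) (mFf k)) (cmeasurableD mv mv) (energyD_lty mv mv vy vy) l2.
(* In the limit the cutoffs of v and the transforms of the cutoffs of f both tend to v, so the right
   side becomes the energy of 2v. *)
have Ewf : energy mu (fun x => w x + f x) = energy mu (fun x => v x + v x).
  apply: (cvg_unique _ (c1 _)) => //.
  have EE : (fun k : nat => energy mu (fun x => FT 1 (cutoff k v) x + cutoff k f x)) =
    (fun k => energy mu (fun x => cutoff k v x + FT (-1) (cutoff k f) x)) by apply/funext => k.
  by rewrite /= EE; exact: (c2 _).
have P1 := energy_parallelogram mu mw mf.
have P2 := energy_parallelogram mu mv mv.
have z0 : energy mu (fun x => v x - v x) = 0%E.
  by rewrite (@eq_energy_sqnorm _ _ _ _ _ (fun=> 0)) => [|x]; rewrite ?subrr// /energy sqnorm0 integral0.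
rewrite Ewf Ew in P1; rewrite z0 adde0 in P2.
rewrite P2 -Ev in P1.
have ff : energy mu v \is a fin_num by rewrite ge0_fin_numE// energy_ge0.
move: P1; rewrite -(fineK ff) -!EFinM -EFinD.
case: (energy mu (fun x => w x - f x)) => [r| |] //; rewrite -EFinD => -[h].
by congr EFin; lra.
Qed.

End FourierRN.

(** * Multipliers *)

Section Exponential.
Context {R : realType}.
Implicit Types (s t x y : R) (f df : R -> R).

Lemma ler_norm_MVT0 f df s (B : R) : (forall x, is_derive x 1 f (df x)) ->
  (forall x, `|x| <= `|s| -> `|df x| <= B) -> `|f s - f 0| <= B * `|s|.
Proof.
move=> fd le.
have cf a b : {within `[a, b], continuous f}.
  apply: continuous_subspaceT => x; apply: differentiable_continuous.
  by apply/derivable1_diffP; case: (fd x).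
have [s0|s0] := leP 0 s.
  have [c cs ->] := MVT_segment s0 (fun x _ => fd x) (@cf 0 s).
  rewrite subr0 normrM ler_wpM2r//; apply: le.
  by move: cs; rewrite in_itv/= => /andP[c0 cs]; rewrite !ger0_norm.
have [c cs E] := MVT_segment (ltW s0) (fun x _ => fd x) (@cf s 0).
rewrite distrC E sub0r normrM normrN ler_wpM2r//; apply: le.
by move: cs; rewrite in_itv/= => /andP[cs c0]; rewrite !ler0_norm ?lerN2// ltW.
Qed.

Lemma ler_sqr_norm x y : `|x| <= `|y| -> x ^+ 2 <= y ^+ 2.
Proof. by move=> xy; rewrite -(real_normK (num_real x)) -(real_normK (num_real y)) lerXn2r ?nnegrE. Qed.

Lemma norm_sin_le s : `|sin s| <= `|s|.
Proof.
have := @ler_norm_MVT0 sin cos s 1 (@is_derive_sin R) (fun x _ => cos_max x).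
by rewrite sin0 subr0 mul1r.
Qed.

Lemma sqnorm_expiB1 s : sqnorm (expi s - 1) = 4 * sin (s / 2) ^+ 2.
Proof.
have E : s = (s / 2) *+ 2 by rewrite -mulr_natr; field.
rewrite {1}E /sqnorm !cReImE /= cos_mulr2n sin_mulr2n.
move: (cos2Dsin2 (s / 2)); set c := cos _; set b := sin _ => H.
have -> : c ^+ 2 = 1 - b ^+ 2 by rewrite -H addrK.
have -> : (c * b *+ 2 - 0) ^+ 2 = 4 * c ^+ 2 * b ^+ 2 by ring.
have -> : c ^+ 2 = 1 - b ^+ 2 by rewrite -H addrK.
by ring.
Qed.

Lemma sqnorm_expiB1_le4 s : sqnorm (expi s - 1) <= 4.
Proof.
rewrite sqnorm_expiB1; have : sin (s / 2) ^+ 2 <= 1.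
  by rewrite -[leRHS](expr1n _ 2) ler_sqr_norm// normr1 sin_max.
lra.
Qed.

Lemma sqnorm_expiB1_le s : sqnorm (expi s - 1) <= s ^+ 2.
Proof.
rewrite sqnorm_expiB1; have : sin (s / 2) ^+ 2 <= (s / 2) ^+ 2.
  exact: ler_sqr_norm (norm_sin_le _).
by rewrite expr_div_n; lra.
Qed.

(** A crude constant, shared with the next bound because [energy_multiplier_cvg] takes a single [C].
    This bound serves large s, the next one small s. *)
Lemma sqnorm_expi_remainder_le8 s : sqnorm (expi s - 1 - 'i%C * s%:C) <= 8 * s ^+ 2.
Proof.
have := @sqnormD_le2 _ (expi s - 1) (- ('i%C * s%:C)); rewrite sqnormN.
have -> : sqnorm ('i%C * s%:C) = s ^+ 2 by rewrite /sqnorm /=; ring.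
have := sqnorm_expiB1_le s; have := sqr_ge0 s; lra.
Qed.

Lemma sqnorm_expi_remainder_le s : sqnorm (expi s - 1 - 'i%C * s%:C) <= 8 * s ^+ 2 * s ^+ 2.
Proof.
have cB x : `|cos x - 1| <= `|x|.
  have := @ler_norm_MVT0 cos (fun x => - sin x) x 1 (@is_derive_cos R).
  by rewrite cos0 mul1r; apply => y _; rewrite normrN sin_max.
have c2 : `|cos s - 1| <= `|s| * `|s|.
  have := @ler_norm_MVT0 cos (fun x => - sin x) s `|s| (@is_derive_cos R).
  by rewrite cos0; apply => y ys; rewrite normrN (le_trans (norm_sin_le y)).
have s2 : `|sin s - s| <= `|s| * `|s|.
  have := @ler_norm_MVT0 (fun x => sin x - x) (fun x => cos x - 1) s `|s| _ _.
  rewrite sin0 !subr0; apply => // y ys; exact: le_trans (cB y) ys.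
have -> : sqnorm (expi s - 1 - 'i%C * s%:C) = (cos s - 1) ^+ 2 + (sin s - s) ^+ 2.
  by rewrite /sqnorm /=; ring.
have a1 : (cos s - 1) ^+ 2 <= s ^+ 2 * s ^+ 2.
  by rewrite -exprMn ler_sqr_norm// normrM.
have a2 : (sin s - s) ^+ 2 <= s ^+ 2 * s ^+ 2.
  by rewrite -exprMn ler_sqr_norm// normrM.
have := sqr_ge0 (s ^+ 2).
rewrite !expr2 in a1 a2 *; nra.
Qed.

End Exponential.

Section Multiplier.
Context {d} {T : measurableType d} {R : realType}.
Variable mu : {measure set T -> \bar R}.
Implicit Types (f g : T -> R[i]) (p : T -> R).

Lemma measurable_norm_gt p (a : R) : measurable_fun setT p -> measurable [set x | a < `|p x|].
Proof.
move=> mp; have -> : [set x | a < `|p x|] = setT `&` (fun x => `|p x|) @^-1` `]a, +oo[.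
  by rewrite setTI; apply/seteqP; split => x /=; rewrite in_itv/= andbT.
exact: (measurableT_comp (@normr_measurable R setT) mp) measurableT _ (measurable_itv _).
Qed.

Lemma energy_tail_cvg g p : cmeasurable g -> (energy mu g < +oo)%E ->
  measurable_fun setT p ->
  energy mu (fun x => (\1_[set x | k%:R < `|p x|] x)%:C * g x) @[k --> \oo] --> 0%E.
Proof.
move=> mg gy mp.
have mA (k : nat) := measurable_norm_gt k%:R mp.
have mi (k : nat) : cmeasurable (fun x => (\1_[set x | k%:R < `|p x|] x)%:C * g x).
  by apply: cmeasurableM => //; apply: cmeasurable_real; exact: measurable_indic.
have := @dominated_convergence _ _ _ mu setT measurableT
  (fun k x => (sqnorm ((\1_[set x | k%:R < `|p x|] x)%:C * g x))%:E) (cst 0%E)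
  (fun x => (sqnorm (g x))%:E).
case.
- by move=> k; exact: emeasurable_sqnorm.
- exact: measurable_cst.
- apply/nearW => x _; apply: cvg_near_cst.
  exists (Num.bound `|p x|) => // k /= lek.
  have : `|p x| <= k%:R.
    by rewrite (le_trans (ltW (archi_boundP (normr_ge0 (p x)))))// ler_nat.
  by move=> px; rewrite indicE memNset/= ?mul0r ?sqnorm0//; apply/negP; rewrite -leNgt.
- exact: (integrableP_ge0 (measurable_sqnorm mg) (fun x => sqnorm_ge0 _) gy).
- apply/nearW => x k _ /=; rewrite lee_fin ger0_norm ?sqnorm_ge0//.
  rewrite sqnormM sqnorm_real ler_piMl ?sqnorm_ge0//.
by move=> _ _; rewrite integral0.
Qed.

(** Dominated convergence concerns sequences, whereas [F] is an arbitrary filter. It is therefore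
    used only on the tails |p| > k, where the first bound applies; once k is fixed, the second bound
    gives C (delta k)^2 |g|^2 on the rest. *)
Lemma energy_multiplier_cvg {I : Type} (F : set_system I) {FF : Filter F}
    (fs : I -> T -> R[i]) g p (C : R) (delta : I -> R) :
  (forall i, cmeasurable (fs i)) -> cmeasurable g -> (energy mu g < +oo)%E ->
  measurable_fun setT p -> 0 <= C ->
  (forall i x, sqnorm (fs i x) <= C * sqnorm (g x)) ->
  (forall i x, sqnorm (fs i x) <= C * (delta i * p x) ^+ 2 * sqnorm (g x)) ->
  delta i @[i --> F] --> 0 ->
  energy mu (fs i) @[i --> F] --> 0%E.
Proof.
move=> mfs mg gy mp C0 b1 b2 cd.
apply/cvge0P => [i|e e0]; first exact: energy_ge0.
have mA (k : nat) := measurable_norm_gt k%:R mp.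
have C1 : 0 < C + 1 by lra.
have e1 : 0 < e / 2 / (C + 1) by rewrite !divr_gt0//; lra.
have [k _ /(_ k (leqnn k)) Hk] : \forall k \near \oo, (energy mu (fun x => ((\1_[set x | k%:R < `|p x|] x)%:C * g x)%R) <= (e / 2 / (C + 1))%:E)%E.
  by move/cvge0P: (energy_tail_cvg mg gy mp) => /(_ (fun n => energy_ge0 mu _) _ e1).
have gf : energy mu g \is a fin_num by rewrite ge0_fin_numE// energy_ge0.
have [a aE] : exists a, energy mu g = a%:E by exists (fine (energy mu g)); rewrite fineK.
have a0 : 0 <= a by rewrite -lee_fin -aE energy_ge0.
set h := (fun x => (\1_[set x | k%:R < `|p x|] x)%:C * g x) in Hk.
have mh : cmeasurable h by apply: cmeasurableM => //; apply: cmeasurable_real; exact: measurable_indic.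
have D0 : 0 < C * k%:R ^+ 2 * a + 1 by rewrite ltr_wpDl// !mulr_ge0// exprn_ge0.
(* The minimum with 1 gives delta^2 <= |delta|, so a linear smallness condition suffices; the added
   1 keeps the denominator positive. *)
have e2 : 0 < Num.min 1 (e / 2 / (C * k%:R ^+ 2 * a + 1)) by rewrite lt_min ltr01/= !divr_gt0//; lra.
move/cvgrPdist_le : cd => /(_ _ e2); apply: filterS => i.
rewrite sub0r normrN le_min => /andP[d1 d2].
have d3 : (delta i) ^+ 2 <= `|delta i|.
  by rewrite -(real_normK (num_real _)) expr2 ler_piMl.
apply: (@le_trans _ _ ((C * ((delta i) ^+ 2 * k%:R ^+ 2))%:E * energy mu g + C%:E * energy mu h)%E).
  have c1 : 0 <= C * ((delta i) ^+ 2 * k%:R ^+ 2) by rewrite mulr_ge0// -exprMn sqr_ge0.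
  rewrite /energy -!ge0_integralZl_EFin//; last 4 first.
  - by move=> x _; rewrite lee_fin sqnorm_ge0.
  - exact: emeasurable_sqnorm.
  - by move=> x _; rewrite lee_fin sqnorm_ge0.
  - exact: emeasurable_sqnorm.
  rewrite -ge0_integralD//; last 4 first.
  - by move=> x _; rewrite mule_ge0// lee_fin ?sqnorm_ge0//.
  - by apply: measurable_funeM; exact: emeasurable_sqnorm.
  - by move=> x _; rewrite mule_ge0// lee_fin ?sqnorm_ge0//.
  - by apply: measurable_funeM; exact: emeasurable_sqnorm.
  apply: ge0_le_integral => //.
  - by move=> x _; rewrite lee_fin sqnorm_ge0.
  - exact: emeasurable_sqnorm.
  - by apply: emeasurable_funD; apply: measurable_funeM; exact: emeasurable_sqnorm.
  move=> x _; rewrite -!EFinM -EFinD lee_fin.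
  have [px|px] := leP `|p x| k%:R.
    apply: (le_trans (b2 i x)); apply: (@le_trans _ _ (C * ((delta i) ^+ 2 * k%:R ^+ 2) * sqnorm (g x))).
      rewrite ler_wpM2r ?sqnorm_ge0// ler_wpM2l// exprMn ler_wpM2l ?sqr_ge0//.
      by rewrite ler_sqr_norm// [leRHS]ger0_norm.
    by rewrite lerDl mulr_ge0// sqnorm_ge0.
  apply: (le_trans (b1 i x)); rewrite /h indicE mem_set//= mul1r lerDr.
  by rewrite mulr_ge0// sqnorm_ge0.
have : (C%:E * energy mu h <= (e / 2)%:E)%E.
  apply: (@le_trans _ _ (C%:E * (e / 2 / (C + 1))%:E)%E); first by apply: lee_wpmul2l; rewrite ?lee_fin.
  by rewrite -EFinM lee_fin mulrCA ler_piMr ?ltW//; [lra|rewrite ltr_pdivrMr//; lra].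
have : ((C * ((delta i) ^+ 2 * k%:R ^+ 2))%:E * energy mu g <= (e / 2)%:E)%E.
  rewrite aE -EFinM lee_fin.
  rewrite ler_pdivlMr// in d2.
  have K0 : 0 <= C * k%:R ^+ 2 * a by rewrite !mulr_ge0// exprn_ge0.
  have := sqr_ge0 (delta i).
  have -> : C * (delta i ^+ 2 * k%:R ^+ 2) * a = delta i ^+ 2 * (C * k%:R ^+ 2 * a) by ring.
  move: d2 d3 K0.
  set K := C * k%:R ^+ 2 * a; set D := delta i ^+ 2; set n := `|delta i|.
  nra.
by move=> A B; apply: (le_trans (leeD A B)); rewrite -EFinD lee_fin; lra.
Qed.

End Multiplier.

(** * Differentiating the intensity *)

Section Intensity.
Context {R : realType}.

Section Pointwise.
Implicit Types (z w : R[i]) (t : R).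

Definition re_inner z w : R := complex.Re (z^*%C * w).

Lemma re_innerE z w : re_inner z w =
  complex.Re z * complex.Re w + complex.Im z * complex.Im w.
Proof. by case: z => a b; case: w => c e; rewrite /re_inner /=; ring. Qed.

(** A weighted arithmetic-geometric mean plays the role of Cauchy-Schwarz: it holds pointwise and
    integrates directly to a bound by energies. *)
Lemma norm_re_inner_le z w t : 0 < t ->
  `|2 * re_inner z w| <= t * sqnorm z + t^-1 * sqnorm w.
Proof.
move=> t0; have sq (a b : R) : 0 <= t * a ^+ 2 + t^-1 * b ^+ 2 - 2 * (a * b).
  have -> : t * a ^+ 2 + t^-1 * b ^+ 2 - 2 * (a * b) = t^-1 * (t * a - b) ^+ 2.
    by field; rewrite gt_eqF.
  by rewrite mulr_ge0 ?sqr_ge0// invr_ge0 ltW.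
have s1 := sq (complex.Re z) (complex.Re w); have s2 := sq (complex.Im z) (complex.Im w).
have s3 := sq (- complex.Re z) (complex.Re w); have s4 := sq (- complex.Im z) (complex.Im w).
rewrite !sqrrN !mulNr in s3 s4.
by rewrite re_innerE /sqnorm !mulrDr ler_norml; apply/andP; split; lra.
Qed.

(** With e the error of the difference quotient, v' = v + tau (e + w), and the left side is exactly
    the modulus of 2 Re(conj v e) + tau |e + w|^2. *)
Lemma diff_sqnorm_le v v' w (tau t : R) : tau != 0 -> 0 < t ->
  let e := (tau^-1)%:C * (v' - v) - w in
  `|(sqnorm v' - sqnorm v) / tau - 2 * re_inner v w| <=
    t * sqnorm v + t^-1 * sqnorm e + `|tau| * 2 * sqnorm e + `|tau| * 2 * sqnorm w.
Proof.
move=> tau0 t0 /=; set e := _ - w.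
have : v' = v + tau%:C * (e + w).
  rewrite /e subrK mulrA -rmorphM/= divff// mul1r.
  by rewrite addrC subrK.
clearbody e => ->.
have -> : (sqnorm (v + tau%:C * (e + w)) - sqnorm v) / tau - 2 * re_inner v w =
    2 * re_inner v e + tau * sqnorm (e + w).
  by rewrite !re_innerE /sqnorm !cReImE /=; field.
have : `|tau * sqnorm (e + w)| <= `|tau| * (2 * sqnorm e + 2 * sqnorm w).
  by rewrite normrM (ger0_norm (sqnorm_ge0 _)) ler_wpM2l// sqnormD_le2.
have := norm_re_inner_le v e t0.
by have := ler_normD (2 * re_inner v e) (tau * sqnorm (e + w)); lra.
Qed.

(** The difference splits into a pairing of v' - v with w' and one of v with w' - w. The large
    weight 1/t goes to the increments, the small weight t to the factors that are merely bounded. *)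
Lemma diff_re_inner_le v v' w w' t : 0 < t ->
  `|2 * re_inner v' w' - 2 * re_inner v w| <=
    t^-1 * sqnorm (v' - v) + (t * 2 + t^-1) * sqnorm (w' - w) +
    t * 2 * sqnorm w + t * sqnorm v.
Proof.
move=> t0; have ti : 0 < t^-1 by rewrite invr_gt0.
have -> : 2 * re_inner v' w' - 2 * re_inner v w =
    2 * re_inner (v' - v) w' + 2 * re_inner v (w' - w).
  by rewrite !re_innerE !cReImE; ring.
have := norm_re_inner_le (v' - v) w' ti; have := norm_re_inner_le v (w' - w) t0.
have := sqnormD_le2 (w' - w) w; rewrite subrK invrK => H A B.
have := ler_normD (2 * re_inner (v' - v) w') (2 * re_inner v (w' - w)).
have : t * sqnorm w' <= t * (2 * sqnorm (w' - w) + 2 * sqnorm w) by rewrite ler_pM2l.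
lra.
Qed.

End Pointwise.

(** This is the shape left by the weighted means: [C t] may blow up as t tends to 0, so t is chosen
    from e first, and only then is w made small. *)
Lemma cvge0_interpolation {I : Type} (F : set_system I) {FF : Filter F} (u w : I -> \bar R)
    (A : R) (C : R -> R) :
  (forall i, 0 <= u i)%E -> (forall i, 0 <= w i)%E -> 0 <= A ->
  (forall t, 0 < t -> 0 < C t) ->
  (forall t : R, 0 < t -> \forall i \near F, (u i <= (t * A)%:E + (C t)%:E * w i)%E) ->
  w i @[i --> F] --> 0%E -> u i @[i --> F] --> 0%E.
Proof.
move=> u0 w0 A0 C0 H /cvge0P => /(_ w0) W.
apply/cvge0P => // e e0.
have A1 : 0 < A + 1 by lra.
pose t := e / 2 / (A + 1).
have t0 : 0 < t by rewrite !divr_gt0//; lra.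
have e1 : 0 < e / 2 / C t by rewrite !divr_gt0// ?C0//; lra.
apply: filterS2 (H _ t0) (W _ e1) => i ui wi.
have : ((C t)%:E * w i <= (e / 2)%:E)%E.
  rewrite (_ : e / 2 = C t * (e / 2 / C t)); last by field; rewrite gt_eqF// C0.
  by rewrite EFinM; apply: lee_wpmul2l => //; rewrite lee_fin ltW// C0.
have : ((t * A)%:E <= (e / 2)%:E)%E.
  rewrite lee_fin /t -mulrA ler_piMr//; first lra.
  by rewrite mulrC ler_pdivrMr//; lra.
move=> a b; apply: (le_trans ui); apply: (le_trans (leeD a b)).
by rewrite -EFinD lee_fin; lra.
Qed.

Section L1.
Context {d} {T : measurableType d}.
Variable mu : {measure set T -> \bar R}.
Implicit Types (f : T -> R) (g h : T -> R[i]).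

Lemma measurable_re_inner g h : cmeasurable g -> cmeasurable h ->
  measurable_fun setT (fun x => re_inner (g x) (h x)).
Proof. by move=> mg mh; exact: (cmeasurableM (cmeasurable_conj mg) mh).1. Qed.

Lemma integral_norm_le f (a1 a2 a3 a4 : R) g1 g2 g3 g4 :
  measurable_fun setT f ->
  0 <= a1 -> 0 <= a2 -> 0 <= a3 -> 0 <= a4 ->
  cmeasurable g1 -> cmeasurable g2 -> cmeasurable g3 -> cmeasurable g4 ->
  (forall x, `|f x| <= a1 * sqnorm (g1 x) + a2 * sqnorm (g2 x) +
                       a3 * sqnorm (g3 x) + a4 * sqnorm (g4 x)) ->
  (\int[mu]_x `|(f x)%:E| <= a1%:E * energy mu g1 + a2%:E * energy mu g2 +
    a3%:E * energy mu g3 + a4%:E * energy mu g4)%E.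
Proof.
move=> mf a1P a2P a3P a4P m1 m2 m3 m4 le.
have p a g x : 0 <= a -> (0 <= a%:E * (sqnorm (g x))%:E)%E.
  by move=> aP; rewrite mule_ge0// lee_fin ?sqnorm_ge0.
have m a g : cmeasurable g -> measurable_fun setT (fun x => (a%:E * (sqnorm (g x))%:E)%E).
  by move=> mg; apply: measurable_funeM; exact: emeasurable_sqnorm.
have i a g : 0 <= a -> cmeasurable g ->
    (a%:E * energy mu g = \int[mu]_x (a%:E * (sqnorm (g x))%:E))%E.
  move=> aP mg; rewrite /energy ge0_integralZl_EFin//; last exact: emeasurable_sqnorm.
  by move=> x _; rewrite lee_fin sqnorm_ge0.
rewrite !i// -!ge0_integralD//.
- apply: ge0_le_integral => //.
  + by apply: measurableT_comp => //; exact/measurable_EFinP.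
  + by do !(apply: emeasurable_funD; last exact: m); exact: m.
  + by move=> x _; rewrite -!EFinM -!EFinD lee_fin.
all: try (by move=> x _; rewrite ?adde_ge0 ?p).
all: by do ?(apply: emeasurable_funD; last exact: m); exact: m.
Qed.

End L1.

Section C1.
Context {N : nat}.
Local Notation mu := (lebesgueN R N).
Local Notation T := (RN R N).
Implicit Types (f : T -> R) (V W : R -> T -> R[i]).

Lemma L1normE f : L1norm f = (\int[mu]_x `|(f x)%:E|)%E.
Proof. exact: Lnorm1. Qed.

Lemma measurable_in_L1 f : measurable_fun setT f -> (L1norm f < +oo)%E -> in_L1 f.
Proof.
move=> mf fy; exists f; last exact: aeW.
apply/Lfun1_integrable; apply/integrableP; split; first exact/measurable_EFinP.
by move: fy; rewrite L1normE.
Qed.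

(** The product rule from L^2 to L^1. The curves live on the whole line, and the one-sided limits at
    a and b are restrictions of two-sided ones. *)
Lemma sqnorm_C1_L1 V W (a b : R) :
  (forall t, cmeasurable (V t)) -> (forall t, energy mu (V t) < +oo)%E ->
  (forall t, cmeasurable (W t)) -> (forall t, energy mu (W t) < +oo)%E ->
  (forall t, energy mu (fun x => (tau^-1)%:C * (V (t + tau) x - V t x) - W t x)
     @[tau --> 0^'] --> 0%E) ->
  (forall t, energy mu (fun x => V s x - V t x) @[s --> t] --> 0%E) ->
  (forall t, energy mu (fun x => W s x - W t x) @[s --> t] --> 0%E) ->
  C1_L1 a b (fun t x => sqnorm (V t x)) (fun t x => 2 * re_inner (V t x) (W t x)).
Proof.
move=> mV Vy mW Wy cD cV cW.
have fin g : (energy mu g < +oo)%E -> energy mu g = (fine (energy mu g))%:E.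
  by move=> gy; rewrite fineK// ge0_fin_numE// energy_ge0.
have f0 g : 0 <= fine (energy mu g) by rewrite fine_ge0// energy_ge0.
have mVW t := measurable_re_inner (mV t) (mW t).
split=> [t _|t _|t _|t _].
- apply: measurable_in_L1; first exact: measurable_sqnorm.
  rewrite L1normE; under eq_integral do rewrite gee0_abs ?lee_fin ?sqnorm_ge0//.
  exact: Vy.
- apply: measurable_in_L1; first exact: measurable_funM.
  rewrite L1normE; have mVt := mV t; have mWt := mW t.
  have /le_lt_trans : (\int[mu]_x `|(2 * re_inner (V t x) (W t x))%:E| <=
    1%:E * energy mu (V t) + 1%:E * energy mu (W t) +
    0%:E * energy mu (V t) + 0%:E * energy mu (V t))%E.
    apply: integral_norm_le => //; first exact: measurable_funM.
    move=> x; rewrite !mul0r !addr0; have := norm_re_inner_le (V t x) (W t x) ltr01.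
    by rewrite invr1.
  by apply; rewrite (fin _ (Vy t)) (fin _ (Wy t)) -!EFinM -!EFinD ltry.
- pose e tau x := (tau^-1)%:C * (V (t + tau) x - V t x) - W t x.
  have me tau : cmeasurable (e tau).
    apply: cmeasurableB => //; apply: cmeasurableM; first exact: cmeasurable_cst.
    exact: cmeasurableB.
  have ey tau : (energy mu (e tau) < +oo)%E.
    apply: energyB_lty => //; last exact: energyZ_lty (cmeasurableB _ _) (energyB_lty _ _ _ _).
    by apply: cmeasurableM; [exact: cmeasurable_cst|exact: cmeasurableB].
  have ce : energy mu (e tau) @[tau --> within [set tau | t + tau \in `[a, b]] 0^'] --> 0%E.
    by apply: cvg_trans (cD t); apply: cvg_app; exact: cvg_within.
  (* Both constants come from [diff_sqnorm_le] with |tau| <= min(r, 1): the term in [W] is at most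
     2r times its energy, and the error terms add up to at most 1/r + 2 times the energy of
     [e tau]. *)
  apply: (cvge0_interpolation _ _ _ _ _ ce (A := fine (energy mu (V t)) + 2 * fine (energy mu (W t)))
    (C := fun r => r^-1 + 2)).
  + by move=> tau; exact: Lnorm_ge0.
  + by move=> tau; exact: energy_ge0.
  + by rewrite addr_ge0// mulr_ge0.
  + by move=> r r0; rewrite addr_gt0// invr_gt0.
  move=> r r0; apply: (cvg_within (F := 0^')).
  near=> tau.
  have tau0 : tau != 0 by near: tau; exact: nbhs_dnbhs_neq.
  have tr : `|tau| <= Num.min r 1.
    near: tau; apply: nbhs_dnbhs; apply/nbhs_ballP; exists (Num.min r 1).
      by rewrite /= lt_min r0 ltr01.
    by move=> y; rewrite /ball/= sub0r normrN => /ltW.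
  rewrite L1normE.
  have /le_trans : (\int[mu]_x `|(diff_quot (fun t x => sqnorm (V t x)) t tau x - 2 * re_inner (V t x) (W t x))%:E| <=
    r%:E * energy mu (V t) + (r^-1)%:E * energy mu (e tau) +
    (`|tau| * 2)%:E * energy mu (e tau) + (`|tau| * 2)%:E * energy mu (W t))%E.
    apply: integral_norm_le => //.
    - apply: measurable_funB; last exact: measurable_funM.
      apply: measurable_funM => //; apply: measurable_funB; exact: measurable_sqnorm.
    - exact: ltW.
    - by rewrite invr_ge0 ltW.
    - by move=> x; exact: diff_sqnorm_le.
  apply; rewrite (fin _ (Vy t)) (fin _ (Wy t)) (fin _ (ey tau)) -!EFinM -!EFinD lee_fin.
  move: tr; rewrite le_min => /andP[t1 t2].
  have A : `|tau| * fine (energy mu (W t)) <= r * fine (energy mu (W t)) by rewrite ler_wpM2r.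
  have B : `|tau| * fine (energy mu (e tau)) <= 1 * fine (energy mu (e tau)) by rewrite ler_wpM2r.
  lra.
- have cw : (energy mu (fun x => V s x - V t x)%R + energy mu (fun x => W s x - W t x)%R)%E
      @[s --> within [set` `[a, b]] (nbhs t)] --> 0%E.
    have c1 : energy mu (fun x => V s x - V t x) @[s --> within [set` `[a, b]] (nbhs t)] --> 0%E.
      by apply: cvg_trans (cV t); apply: cvg_app; exact: cvg_within.
    have c2 : energy mu (fun x => W s x - W t x) @[s --> within [set` `[a, b]] (nbhs t)] --> 0%E.
      by apply: cvg_trans (cW t); apply: cvg_app; exact: cvg_within.
    under eq_fun do rewrite -[X in (X + _)%E]mul1e -[X in (_ + X)%E]mul1e.
    by apply: cvge0ZD => // s; exact: energy_ge0.
  apply: (cvge0_interpolation _ _ _ _ _ cw (A := fine (energy mu (V t)) + 2 * fine (energy mu (W t)))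
    (C := fun r => r * 2 + r^-1)).
  + by move=> s; exact: Lnorm_ge0.
  + by move=> s; rewrite adde_ge0 ?energy_ge0.
  + by rewrite addr_ge0// mulr_ge0.
  + by move=> r r0; rewrite addr_gt0 ?invr_gt0// mulr_gt0.
  move=> r r0; apply: nearW => s.
  have dVy : (energy mu (fun x => V s x - V t x)%R < +oo)%E by exact: energyB_lty.
  have dWy : (energy mu (fun x => W s x - W t x)%R < +oo)%E by exact: energyB_lty.
  have ri : 0 < r^-1 by rewrite invr_gt0.
  rewrite L1normE.
  have /le_trans : (\int[mu]_x `|(2 * re_inner (V s x) (W s x) - 2 * re_inner (V t x) (W t x))%:E| <=
    (r^-1)%:E * energy mu (fun x => V s x - V t x)%R +
    (r * 2 + r^-1)%:E * energy mu (fun x => W s x - W t x)%R +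
    (r * 2)%:E * energy mu (W t) + r%:E * energy mu (V t))%E.
    apply: integral_norm_le => //.
    - by apply: measurable_funB; exact: measurable_funM.
    - exact: ltW.
    - by rewrite addr_ge0// ?mulr_ge0// ltW.
    - by rewrite mulr_ge0// ltW.
    - exact: ltW.
    - exact: cmeasurableB.
    - exact: cmeasurableB.
    - by move=> x; exact: diff_re_inner_le.
  apply; rewrite (fin _ (Vy t)) (fin _ (Wy t)) (fin _ dVy) (fin _ dWy) -!EFinM -!EFinD -?EFinM -?EFinD lee_fin.
  have := f0 (fun x => V s x - V t x).
  have : 0 <= r * fine (energy mu (fun x => V s x - V t x)) by rewrite mulr_ge0// ltW.
  lra.
Unshelve. all: by end_near. Qed.

End C1.
End Intensity.

(** * From chosen representatives to Borel limits *)

Section Transform.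
Context {R : realType} {N : nat}.
Local Notation mu := (lebesgueN R N).
Local Notation T := (RN R N).
Implicit Types (s t : R) (u v w f g h : T -> R[i]) (p : T -> R).

Lemma FTlim_ae_eq s f g v : FTlim s f v -> cmeasurable g ->
  {ae mu, forall x, f x = g x} -> FTlim s g v.
Proof.
move=> [mf fy mv vy cf] mg fg.
split; [exact: mg|by rewrite -(ae_eq_energy mf mg fg)|exact: mv|exact: vy|].
suff E : (fun k => energy mu (fun xi => FT s (cutoff k g) xi - v xi)) =
    (fun k => energy mu (fun xi => FT s (cutoff k f) xi - v xi)) by rewrite E; exact: cf.
apply/funext => k; apply: eq_energy => xi; congr (_ - _); rewrite /FT.
have me := cmeasurable_expi (measurable_phaseN s xi).
apply: ae_eq_cint; [|by apply: cmeasurableM => //; exact: cmeasurable_cut..|].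
  by apply: cmeasurableM => //; exact: cmeasurable_cut.
by apply: filterS fg => x fgx; rewrite /cutoff fgx.
Qed.

Lemma FTlim_energyB s f g v w : s ^+ 2 = 1 -> FTlim s f v -> FTlim s g w ->
  energy mu (fun x => v x - w x) = energy mu (fun x => f x - g x).
Proof. by move=> s1 Fv Gw; apply: FTlim_isometry s1 (FTlimB Fv Gw). Qed.

Lemma FTlim_unique s f v w : s ^+ 2 = 1 -> FTlim s f v -> FTlim s f w ->
  {ae mu, forall x, v x = w x}.
Proof.
move=> s1 Fv Fw; have := FTlim_energyB s1 Fv Fw.
have -> : energy mu (fun x => f x - f x) = 0%E.
  by rewrite (@eq_energy_sqnorm _ _ _ _ _ (fun=> 0)) => [|x]; rewrite ?subrr// /energy sqnorm0 integral0.
have [_ _ mv _ _] := Fv; have [_ _ mw _ _] := Fw.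
move/(energy_eq0 (cmeasurableB mv mw)).
by apply: filterS => x /eqP; rewrite subr_eq0 => /eqP.
Qed.

Lemma is_fourier_FTlim s u v : is_fourier s u v <->
  exists2 g, {ae mu, forall x, u x = g x} & FTlim s g v.
Proof.
split=> [[/borel_L2P[mv vy] [g [/borel_L2P[mg gy] ug /L2norm_cvg0 cg]]]|[g ug [mg gy mv vy cg]]].
  exists g; first by apply: filterS ug => x; exact.
  split; [exact: mg|exact: gy|exact: mv|exact: vy|].
  by under eq_fun do rewrite -truncated_fourierE.
split; first exact/borel_L2P.
exists g; split; [exact/borel_L2P|by apply: filterS ug|].
by apply/L2norm_cvg0; under eq_fun do rewrite truncated_fourierE.
Qed.

(** All that is known of the chosen transform is that it belongs to some Borel representative of u.
    Almost everywhere equality carries it over to the given representative g. *)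
Lemma fourier_sign_FTlim s u g : s ^+ 2 = 1 -> cmeasurable g -> (energy mu g < +oo)%E ->
  {ae mu, forall x, u x = g x} -> FTlim s g (fourier_sign s u).
Proof.
move=> s1 mg gy ug.
have : is_fourier s u (fourier_sign s u).
  apply: xgetPex; have [v gv] := FTlim_exists s1 mg gy.
  by exists v; apply/is_fourier_FTlim; exists g.
move=> /is_fourier_FTlim[f uf fv]; apply: FTlim_ae_eq fv mg _.
by apply: filterS2 uf ug => x <-.
Qed.

Lemma in_L2P u : in_L2 u -> exists g,
  [/\ cmeasurable g, (energy mu g < +oo)%E & {ae mu, forall x, u x = g x}].
Proof.
by move=> [g /borel_L2P[mg gy] ug]; exists g; split => //; apply: filterS ug => x; exact.
Qed.

(* Only the values of p where h does not vanish are constrained, and there they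
   are recovered from p * h and h, which are both Borel up to null sets. *)
Lemma borel_multiplier p h f : cmeasurable h -> cmeasurable f ->
  {ae mu, forall x, (p x)%:C * h x = f x} ->
  exists2 q, measurable_fun setT q & {ae mu, forall x, h x = 0 \/ p x = q x}.
Proof.
move=> mh mf pf; exists (fun x => re_inner (h x) (f x) / sqnorm (h x)).
  apply: measurable_funM; first exact: measurable_re_inner.
  exact: (measurable_invr (measurable_sqnorm mh)).
apply: filterS pf => x <-; have [h0|h0] := eqVneq (sqnorm (h x)) 0.
  by left; exact: sqnorm_eq0.
right; rewrite re_innerE !cReImE /= !mul0r subr0 addr0.
by move: h0; rewrite /sqnorm => h0; field.
Qed.

End Transform.

(** * The curve e^(i t p) h in L^2 *)

Section Multipliers.
Context {R : realType} {N : nat}.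
Local Notation mu := (lebesgueN R N).
Local Notation T := (RN R N).
Implicit Types (s t : R).
Variables (p : T -> R) (h : T -> R[i]).
Hypotheses (mp : measurable_fun setT p) (mh : cmeasurable h).
Hypotheses (hy : (energy mu h < +oo)%E).
Hypothesis (phy : (energy mu (fun x => (p x)%:C * h x)%R < +oo)%E).

Definition modulated t x : R[i] := expi (t * p x) * h x.
Definition modulated_deriv t x : R[i] := expi (t * p x) * ('i%C * ((p x)%:C * h x)).

Lemma cmeasurable_phase_mult t : cmeasurable (fun x => expi (t * p x)).
Proof. by apply: cmeasurable_expi; exact: measurable_funM. Qed.

Let mph : cmeasurable (fun x => (p x)%:C * h x).
Proof. by apply: cmeasurableM => //; exact: cmeasurable_real. Qed.

Lemma cmeasurable_modulated t : cmeasurable (modulated t).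
Proof. by apply: cmeasurableM => //; exact: cmeasurable_phase_mult. Qed.

Lemma cmeasurable_modulated_deriv t : cmeasurable (modulated_deriv t).
Proof.
apply: cmeasurableM; first exact: cmeasurable_phase_mult.
by apply: cmeasurableM => //; exact: cmeasurable_cst.
Qed.

Lemma sqnorm_i : sqnorm ('i%C : R[i]) = 1.
Proof. by rewrite /sqnorm /= expr0n expr1n add0r. Qed.

Lemma energy_modulated t : (energy mu (modulated t) < +oo)%E.
Proof.
by rewrite (@eq_energy_sqnorm _ _ _ _ _ h)// => x; rewrite sqnormM sqnorm_expi mul1r.
Qed.

Lemma energy_modulated_deriv t : (energy mu (modulated_deriv t) < +oo)%E.
Proof.
rewrite (@eq_energy_sqnorm _ _ _ _ _ (fun x => (p x)%:C * h x))// => x.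
by rewrite /modulated_deriv sqnormM sqnorm_expi mul1r sqnormM sqnorm_i mul1r.
Qed.

Lemma expi_phaseB s t x : expi (s * p x) = expi ((s - t) * p x) * expi (t * p x) :> R[i].
Proof. by rewrite -expiD -mulrDl subrK. Qed.

(** The function g is arbitrary because the result serves the curve (g = h) and its derivative (g =
    i p h). *)
Lemma modulated_cvg (g : T -> R[i]) t : cmeasurable g -> (energy mu g < +oo)%E ->
  energy mu (fun x => expi (s * p x) * g x - expi (t * p x) * g x) @[s --> t] --> 0%E.
Proof.
move=> mg gy.
have cst_ : s - t @[s --> t] --> (0 : R).
  by rewrite -(subrr t); apply: cvgB; [exact: cvg_id|exact: cvg_cst].
have E s x : sqnorm (expi (s * p x) * g x - expi (t * p x) * g x) =
    sqnorm (expi ((s - t) * p x) - 1) * sqnorm (g x).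
  rewrite (expi_phaseB s t) -[X in _ - X * _]mul1r -!mulrA -mulrBl.
  by rewrite sqnormM sqnormM sqnorm_expi mul1r.
apply: (@energy_multiplier_cvg _ _ _ mu _ _ _ _ g p 4 (fun s => s - t)) => //.
- by move=> s; apply: cmeasurableB; apply: cmeasurableM => //; exact: cmeasurable_phase_mult.
- by move=> s x; rewrite E ler_wpM2r ?sqnorm_ge0// sqnorm_expiB1_le4.
- move=> s x; rewrite E ler_wpM2r ?sqnorm_ge0//.
  have := sqnorm_expiB1_le ((s - t) * p x); have := sqr_ge0 ((s - t) * p x); lra.
Qed.

(** The dominating function is p h: dividing the crude remainder bound 8 (tau p)^2 |h|^2 by tau^2
    leaves 8 |p h|^2. The finer remainder bound gains the factor (tau p)^2 that tends to 0. *)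
Lemma modulated_derivable t :
  energy mu (fun x => (tau^-1)%:C * (modulated (t + tau) x - modulated t x) -
     modulated_deriv t x) @[tau --> 0^'] --> 0%E.
Proof.
have E (tau : R) x : tau != 0 ->
    tau ^+ 2 * sqnorm ((tau^-1)%:C * (modulated (t + tau) x - modulated t x) - modulated_deriv t x) =
    sqnorm (expi (tau * p x) - 1 - 'i%C * (tau * p x)%:C) * sqnorm (h x).
  move=> tau0; have K : tau%:C * (tau^-1)%:C = 1 :> R[i] by rewrite -rmorphM/= divff.
  have A (a b c : R[i]) : tau%:C * ((tau^-1)%:C * (a - b) - c) = a - b - tau%:C * c.
    by rewrite mulrBr mulrA K mul1r.
  rewrite -sqnorm_real -[LHS]sqnormM [X in sqnorm X]A.
  rewrite /modulated /modulated_deriv mulrDl expiD.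
  have -> : expi (t * p x) * expi (tau * p x) * h x - expi (t * p x) * h x -
      tau%:C * (expi (t * p x) * ('i%C * ((p x)%:C * h x))) =
      expi (t * p x) * ((expi (tau * p x) - 1 - 'i%C * (tau * p x)%:C) * h x).
    by rewrite rmorphM/=; ring.
  by rewrite sqnormM sqnorm_expi mul1r sqnormM.
(* At tau = 0 the quotient has a junk value (1/0 = 0) that violates the bound in
   delta; the limit ignores it. *)
pose D tau x := if tau == 0 then 0 else
  (tau^-1)%:C * (modulated (t + tau) x - modulated t x) - modulated_deriv t x.
have : energy mu (D tau) @[tau --> 0^'] --> 0%E.
  apply: (@energy_multiplier_cvg _ _ _ mu _ _ _ _ (fun x => (p x)%:C * h x) p 8 id) => //.
  - move=> tau; rewrite /D; case: eqP => _; first exact: cmeasurable_cst.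
    apply: cmeasurableB; last exact: cmeasurable_modulated_deriv.
    apply: cmeasurableM; first exact: cmeasurable_cst.
    by apply: cmeasurableB; exact: cmeasurable_modulated.
  - move=> tau x; rewrite /D; have [_|tau0] := eqVneq tau 0.
      by rewrite sqnorm0 mulr_ge0// sqnorm_ge0.
    have tau2 : 0 < tau ^+ 2 by rewrite exprn_even_gt0.
    rewrite -(ler_pM2l tau2).
    rewrite E// [in leRHS]sqnormM sqnorm_real.
    have := sqnorm_expi_remainder_le8 (tau * p x).
    rewrite exprMn => le; have := ler_wpM2r (sqnorm_ge0 (h x)) le.
    by congr (_ <= _); ring.
  - move=> tau x; rewrite /D; have [_|tau0] := eqVneq tau 0.
      by rewrite sqnorm0; apply: mulr_ge0 (sqnorm_ge0 _); rewrite mulr_ge0 ?sqr_ge0.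
    have tau2 : 0 < tau ^+ 2 by rewrite exprn_even_gt0.
    rewrite -(ler_pM2l tau2).
    rewrite E// [in leRHS]sqnormM sqnorm_real.
    have le := sqnorm_expi_remainder_le (tau * p x).
    have := ler_wpM2r (sqnorm_ge0 (h x)) le.
    by congr (_ <= _); ring.
  - exact: nbhs_dnbhs.
apply: cvg_trans; apply: near_eq_cvg.
near=> tau; apply: eq_energy => x; rewrite /D ifF//; apply/negbTE.
near: tau; exact: nbhs_dnbhs_neq.
Unshelve. all: by end_near. Qed.

End Multipliers.

(** * Derivative of the measured intensity *)

Theorem theorem4p1 (R : realType) (N : nat) (Omega : set (RN R N))
    (phi Psi : RN R N -> R) (n : R) :
  (0 < N)%N ->
  0 < n ->
  in_L2 (pupil Omega phi) ->
  in_L2 (fun xi => (Psi xi)%:C * fourier (pupil Omega phi) xi) ->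
  exists dI : R -> RN R N -> R,
    [/\ C1_L1 0 1 (intensity_at n Omega phi Psi) dI,
        (fun x => intensity n Omega phi Psi x - n * \1_Omega x)
          = diff_quot (intensity_at n Omega phi Psi) 0 1
          %[ae lebesgueN R N] &
        dI 0 = (fun x => 2 * n *
                  complex.Re ('i%C * ((\1_Omega x)%:C * expi (phi x)) *
                              calG Psi (pupil Omega phi) x))
          %[ae lebesgueN R N]].
Proof.
move=> _ n0 /in_L2P[u [mu_ uy Pu]] /in_L2P[G [mG Gy GE]].
have s1 : (1 : R) ^+ 2 = 1 by rewrite expr1n.
have sN : (-1 : R) ^+ 2 = 1 by rewrite sqrrN expr1n.
pose P := pupil Omega phi; pose uh := fourier P.
pose q : R[i] := (Num.sqrt n)%:C; pose qh := fourier (fun y => q * P y).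
have Fu : FTlim (-1) u uh by exact: fourier_sign_FTlim.
have [_ _ muh uhy _] := Fu.
have Fqu := FTlimZ q Fu.
have [mqu quy mh hy _] := Fqu.
have Fq : FTlim (-1) (fun x => q * u x) qh.
  by apply: fourier_sign_FTlim => //; apply: filterS Pu => x /= <-.
(* The intensity transforms sqrt n times the pupil, the hypothesis on [Psi] the pupil alone.
   Linearity of the limits relates the two transforms up to a null set. *)
have qhE := FTlim_unique sN Fq Fqu.
have [p mp pE] := borel_multiplier muh mG GE.
pose h x := q * uh x.
have GpE : {ae lebesgueN R N, forall x, q * G x = (p x)%:C * h x}.
  apply: filterS2 pE GE => x [u0|pP] <-.
    by rewrite /h (_ : uh x = 0)// (_ : fourier _ x = 0)// !mulr0.
  by rewrite -pP mulrCA.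
have mph : cmeasurable (fun x => (p x)%:C * h x).
  by apply: cmeasurableM => //; exact: cmeasurable_real.
have mqG : cmeasurable (fun x => q * G x) by apply: cmeasurableM => //; exact: cmeasurable_cst.
have phy : (energy (lebesgueN R N) (fun x => (p x)%:C * h x)%R < +oo)%E.
  by rewrite -(ae_eq_energy mqG mph GpE); exact: energyZ_lty.
have mm t : cmeasurable (modulated p h t) by exact: cmeasurable_modulated.
have md t : cmeasurable (modulated_deriv p h t) by exact: cmeasurable_modulated_deriv.
have my t : (energy (lebesgueN R N) (modulated p h t) < +oo)%E by exact: energy_modulated.
have dy t : (energy (lebesgueN R N) (modulated_deriv p h t) < +oo)%E by exact: energy_modulated_deriv.
pose V t := inv_fourier (fun xi => expi (t * Psi xi) * qh xi).
(* Replacing [Psi] by the Borel p is harmless almost everywhere: either they agree at the point or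
   the transform vanishes there. *)
have FV t : FTlim 1 (modulated p h t) (V t).
  apply: fourier_sign_FTlim => //.
  apply: filterS2 pE qhE => x [u0|pP] ->; last by rewrite pP.
  by rewrite /modulated /h u0 !mulr0.
pose W t := inv_fourier (modulated_deriv p h t).
have FW t : FTlim 1 (modulated_deriv p h t) (W t).
  by apply: fourier_sign_FTlim => //; exact: aeW.
have IE : intensity_at n Omega phi Psi = (fun t x => sqnorm (V t x)).
  by apply/funext => t; apply/funext => x; rewrite /intensity_at normc_sqnorm.
have V0 : {ae lebesgueN R N, forall x, V 0 x = q * P x}.
  have m0 : modulated p h 0 = h.
    by apply/funext => x; rewrite /modulated mul0r expi0 mul1r.
  have F0 := FV 0; rewrite m0 in F0; have [_ _ mV0 _ _] := F0.
  have := energy_eq0 (cmeasurableB mV0 mqu) (FTlim_inversion Fqu F0).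
  by apply: filterS2 Pu => x <- /eqP; rewrite subr_eq0 => /eqP.
(* At t = 0 the derivative on the frequency side is i p h, almost everywhere i sqrt n G, where G is
   the Borel representative of the function that [calG] transforms back. *)
have W0 : {ae lebesgueN R N, forall x, W 0 x = 'i%C * q * calG Psi P x}.
  have FG : FTlim 1 G (calG Psi P) by exact: fourier_sign_FTlim.
  have FiG := FTlimZ ('i%C * q) FG; have [miG _ _ _ _] := FiG.
  apply: (FTlim_unique s1 _ FiG); apply: FTlim_ae_eq (FW 0) miG _.
  by apply: filterS GpE => x; rewrite /modulated_deriv mul0r expi0 mul1r -mulrA => ->.
have qq : Num.sqrt n * Num.sqrt n = n by rewrite -expr2 sqr_sqrtr// ltW.
exists (fun t x => 2 * re_inner (V t x) (W t x)); split.
- rewrite IE; apply: sqnorm_C1_L1.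
  + by move=> t; have [] := FV t.
  + by move=> t; have [] := FV t.
  + by move=> t; have [] := FW t.
  + by move=> t; have [] := FW t.
  (* The inverse transform commutes with linear combinations and is isometric, so the error of the
     difference quotient has the same energy before and after it. *)
  + move=> t; have := modulated_derivable mp mh phy t.
    apply: cvg_trans; apply: near_eq_cvg; apply: nearW => tau.
    exact: esym (FTlim_energyB s1 (FTlimZ (tau^-1)%:C (FTlimB (FV (t + tau)) (FV t))) (FW t)).
  + move=> t; have := modulated_cvg mp t mh hy.
    apply: cvg_trans; apply: near_eq_cvg; apply: nearW => s.
    exact: esym (FTlim_energyB s1 (FV s) (FV t)).
  + move=> t; have := modulated_cvg mp t (cmeasurableM (cmeasurable_cst _) mph) (energyZ_lty 'i%C mph phy).
    apply: cvg_trans; apply: near_eq_cvg; apply: nearW => s.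
    exact: esym (FTlim_energyB s1 (FW s) (FW t)).
(* The difference quotient with step 1 starts from I(x, 0), which inversion identifies with n times
   the indicator only almost everywhere. *)
- apply: filterS V0 => x V0x _.
  rewrite /diff_quot divr1 add0r /intensity IE V0x; congr (_ - _).
  rewrite /q /P /pupil !sqnormM !sqnorm_real sqnorm_expi mulr1 expr2 qq indicE.
  by case: (x \in Omega); rewrite ?expr1n ?expr0n.
(* The conjugate of [V 0] turns e^(-i phi) into e^(i phi), and the two factors sqrt n multiply to
   n. *)
- apply: filterS2 V0 W0 => x -> -> _; rewrite -[in RHS]qq re_innerE /P /pupil.
  rewrite !cReImE /= cosN sinN.
  by ring.
Qed.
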